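(* Let $f\in\mathcal F(\mathbb R^n)$ be such that $f(0)=\|f\|_\infty$, let $H$ be an $i$-dimensional linear subspace of $\mathbb R^n$, and let $\lambda\in[0,1]$. Then $$(1-\lambda)^i\lambda^{n-i}\int_{H}P_Hf(x)^{1-\lambda}\,dx\int_{H^\perp}f(y)^\lambda\,dy\le\int_{\mathbb R^n}f(z)\,dz .$$ Equality holds if and only if for every $(x,y)\in H\times H^\perp$ one has $f(x,y)=\exp(-\|(x,y)\|_K)$ for some convex body $K\subset\mathbb R^n$ with $0\in K$ such that for every $v\in H$ the intersection $K\cap(H^\perp+\mathbb R^+v)$ is the convex hull of $K\cap H^\perp$ and one point.
   Context: $\mathcal F(\mathbb R^n)$ is the set of integrable log-concave functions $f:\mathbb R^n\to[0,\infty)$, i.e. $f((1-\lambda)x+\lambda y)\ge f(x)^{1-\lambda}f(y)^\lambda$ for all $x,y\in\mathbb R^n$, $\lambda\in[0,1]$. $\|f\|_\infty=\sup f$. For a linear subspace $H$ with orthogonal complement $H^\perp$, $P_Hf(x)=\max\{f(y):y\in x+H^\perp\}$ for $x\in H$; points of $\mathbb R^n$ are written $(x,y)\in H\times H^\perp$. Integrals over subspaces are with respect to Lebesgue measure of the corresponding dimension. A convex body is a compact convex set with nonempty interior. For a convex body $K$ with $0\in K$ (possibly on the boundary), $\|x\|_K=\inf\{\rho\ge0:x\in\rho K\}$ if $x\in\rho K$ for some $\rho\ge0$, and $\|x\|_K=\infty$ otherwise; $e^{-\infty}=0$. $\mathbb R^+v=\{sv:s\ge0\}$.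
   Formalization: The equality characterization is stated for 0<λ<1, ∫f>0 and f upper semicontinuous, with f = f(0)·exp(−‖·‖_K) and one K for all (x,y); as printed it fails for λ∈{0,1}, for ∫f=0, for some f that are not upper semicontinuous, and when f(0)≠1. *)

(* Defs.v *)
From HB Require Import structures.
From mathcomp Require Import all_boot all_order all_algebra.
From mathcomp Require Import all_classical all_reals all_analysis.
Import Order.TTheory GRing.Theory Num.Theory.
Import numFieldNormedType.Exports.

Set Implicit Arguments.
Unset Strict Implicit.
Unset Printing Implicit Defensive.

Local Open Scope classical_set_scope.
Local Open Scope ring_scope.

Lemma product_sigma_finite d1 d2 (T1 : measurableType d1)
    (T2 : measurableType d2) (R : realType)
    (m1 : {sigma_finite_measure set T1 -> \bar R})
    (m2 : {sigma_finite_measure set T2 -> \bar R}) :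
  sigma_finite setT (m1 \x m2)%E.
Proof.
have /sigma_finiteP[F [TF ndF Foo]] := sigma_finiteT m1.
have /sigma_finiteP[G [TG ndG Goo]] := sigma_finiteT m2.
exists (fun n => F n `*` G n).
  rewrite -setXTT TF TG predeqE => -[x y]; split.
    move=> [/= [n _ Fnx] [k _ Gky]]; exists (maxn n k) => //; split.
    - by move: x Fnx; exact/subsetPset/ndF/leq_maxl.
    - by move: y Gky; exact/subsetPset/ndG/leq_maxr.
  by move=> [n _ []/= ? ?]; split; exists n.
move=> k; have [? ?] := Foo k; have [? ?] := Goo k.
split; first exact: measurableX.
by rewrite product_measure1E// lte_mul_pinfty// ge0_fin_numE.
Qed.

(* The power of a sigma-finite measure, by T^(n+1) = T * T^n; on T^0 it is the
   unit mass at the only point. *)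
Section tuple_measure.
Context d (T : measurableType d) (R : realType).
Local Open Scope ereal_scope.

Definition tcons n (p : T * n.-tuple T) : n.+1.-tuple T := [tuple of p.1 :: p.2].

Lemma measurable_tcons n : measurable_fun [set: T * n.-tuple T] (@tcons n).
Proof.
apply: (@measurable_cons _ _ _ _ fst n snd); first exact: measurable_fst.
exact: measurable_snd.
Qed.

HB.instance Definition _ n :=
  isMeasurableFun.Build _ _ _ _ (@tcons n) (@measurable_tcons n).

Variable mu : {sigma_finite_measure set T -> \bar R}.

Section succ.
Variables (n : nat) (m : {sigma_finite_measure set (n.-tuple T) -> \bar R}).

Definition tuple_measureS : set (n.+1.-tuple T) -> \bar R :=
  pushforward (mu \x m) (@tcons n).

Let tuple_measureS0 : tuple_measureS set0 = 0.
Proof. exact: measure0. Qed.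

Let tuple_measureS_ge0 A : 0 <= tuple_measureS A.
Proof. exact: measure_ge0. Qed.

Let tuple_measureS_sigma_additive : semi_sigma_additive tuple_measureS.
Proof. exact: measure_semi_sigma_additive. Qed.

HB.instance Definition _ := isMeasure.Build _ _ _ tuple_measureS
  tuple_measureS0 tuple_measureS_ge0 tuple_measureS_sigma_additive.

Let tuple_measureS_sigma_finite : sigma_finite setT tuple_measureS.
Proof.
have [F FT Foo] := product_sigma_finite mu m.
pose g (t : n.+1.-tuple T) := (thead t, [tuple of behead t]).
have mg : measurable_fun setT g.
  by apply/measurable_fun_pair => /=; [exact: measurable_tnth|exact: measurable_behead].
have gK p : g (tcons p) = p.
  by case: p => x t; rewrite /g theadE; congr pair; apply: val_inj.
exists (fun k => g @^-1` F k).
  by rewrite -preimage_bigcup -FT preimage_setT.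
move=> k; have [mFk Fkoo] := Foo k; split.
  by rewrite -[X in measurable X]setTI; exact: mg.
rewrite /tuple_measureS /pushforward -comp_preimage.
by rewrite (_ : g \o _ = id) //; apply/funext => p; exact: gK.
Qed.

HB.instance Definition _ := Measure_isSigmaFinite.Build _ _ _ tuple_measureS
  tuple_measureS_sigma_finite.

End succ.

Fixpoint tuple_measure n : {sigma_finite_measure set (n.-tuple T) -> \bar R} :=
  if n is k.+1 then tuple_measureS (tuple_measure k) else \d_([tuple] : 0.-tuple T).

End tuple_measure.

Section lebesgue_Rn.
Context {R : realType}.

Definition lebesgue_tuple (n : nat) :
    {sigma_finite_measure set (n.-tuple (measurableTypeR R)) -> \bar R} :=
  tuple_measure (@lebesgue_measure R) n.

Definition row_of_tuple n (t : n.-tuple R) : 'rV[R]_n := \row_j tnth t j.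

(* The functions integrated below are nonnegative but need not be Borel. For
   such functions the integral of the library is the supremum of the integrals
   of the Borel simple functions below them, which agrees with the integral for
   the completed measure whenever the function is Lebesgue measurable. *)
Definition integral_Rn n (g : 'rV[R]_n -> R) : \bar R :=
  (\int[lebesgue_tuple n]_t (g (row_of_tuple t))%:E)%E.

(* A linear subspace of R^n is the row space of a matrix H. If the rows of B
   form a basis of it, then t |-> t *m B carries Lebesgue measure on R^(\rank H)
   to Lebesgue measure on the subspace divided by sqrt (det (B B^T)), the
   Euclidean volume of the parallelepiped spanned by the rows of B. *)
Definition integral_subspace n (H : 'M[R]_n) (g : 'rV[R]_n -> R) : \bar R :=
  let B := row_base H in
  ((Num.sqrt (\det (B *m B^T)))%:E *
   \int[lebesgue_tuple (\rank H)]_t (g (row_of_tuple t *m B))%:E)%E.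

(* u lies in its row space iff u *m H^T = 0 *)
Definition orth_compl n (H : 'M[R]_n) : 'M[R]_n := kermx H^T.

End lebesgue_Rn.

Section log_concave_functions.
Context {R : realType} {n : nat}.
Implicit Types (f : 'rV[R]_n -> R) (H : 'M[R]_n).

Definition log_concave f :=
  forall (x y : 'rV[R]_n) (l : R), 0 <= l <= 1 ->
    f x `^ (1 - l) * f y `^ l <= f ((1 - l) *: x + l *: y).

(* Measurability is not required: the superlevel sets of a log-concave function
   are convex, hence Lebesgue measurable, but they need not be Borel. *)
Definition integrable_log_concave f :=
  [/\ forall x, 0 <= f x, log_concave f & (integral_Rn f < +oo)%E].

(* for nonnegative f; extended, so that an unbounded f has norm +oo *)
Definition sup_norm f : \bar R := ereal_sup (range (EFin \o f)).

(* A supremum, since without upper semicontinuity the maximum over the fibre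
   x + H^perp need not be attained. *)
Definition proj_fun H f (x : 'rV[R]_n) : R :=
  sup [set f y | y in [set y | (y - x <= orth_compl H)%MS]].

Definition upper_semicontinuous f :=
  lower_semicontinuous (fun x => (- f x)%:E).

End log_concave_functions.

Section convex_bodies.
Context {R : realType} {n : nat}.
Implicit Types (A K : set 'rV[R]_n) (H : 'M[R]_n).

Definition convex_body K := [/\ compact K, convex_set K & K° !=set0].

Definition convex_hull A : set 'rV[R]_n :=
  smallest (@convex_set R 'rV[R]_n) A.

(* ereal_inf set0 = +oo *)
Definition gauge K (x : 'rV[R]_n) : \bar R :=
  ereal_inf [set r%:E | r in
    [set r : R | 0 <= r /\ exists2 k, K k & x = r *: k]].

Definition orth_halfspace H (v : 'rV[R]_n) : set 'rV[R]_n :=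
  [set w | exists2 s : R, 0 <= s & (w - s *: v <= orth_compl H)%MS].

Definition hull_with_one_point_over H K :=
  forall v : 'rV[R]_n, (v <= H)%MS ->
    exists p : 'rV[R]_n,
      K `&` orth_halfspace H v =
      convex_hull ((K `&` [set y | (y <= orth_compl H)%MS]) `|` [set p]).

End convex_bodies.

(* Main.v *)
Require Import Defs.
From HB Require Import structures.
From mathcomp Require Import all_boot all_order all_algebra.
From mathcomp Require Import all_classical all_reals all_analysis.
From mathcomp Require Import measurable_realfun ring lra.
Import Order.TTheory GRing.Theory Num.Theory.
Import numFieldNormedType.Exports.
Set Implicit Arguments.
Unset Strict Implicit.
Unset Printing Implicit Defensive.
Local Open Scope classical_set_scope.
Local Open Scope ring_scope.

(* Write z = x + y with x in H and y in H^perp. If f(x, eta) almost realizes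
   P_H f(x), log-concavity along the segments from (x, eta) to (0, y) gives
   f((1 - l)(x, eta) + l (0, y)) >= P_H f(x)^(1 - l) f(0, y)^l; integrating over y
   and then over x, by Tonelli and homotheties, yields the inequality.

   In the equality case let q(y) = f(0, y), P = P_H f, and let m(x) be the integral
   of f over the fibre x + H^perp. For almost every x the fibre inequality is an
   equality; it holds for every x because m does not decrease much along a
   contraction towards a box on which f is bounded below, while P is upper
   semicontinuous. At x = 0 it shows that q(l y) = q(y)^l. Comparing m(x) with
   m((1 - e) x) then gives P((1 - l) x) = P(x)^(1 - l), and finally each fibre
   satisfies f(x, eta + w) = P(x) q(w). As q(w) = 1 only for w = 0 by integrability,
   maximizers are unique, so f(s z) = f(z)^s: f is the exponential of the opposite
   of the gauge of K = {f >= 1/e}, and the product formula on the fibres is the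
   description of the sections of K as convex hulls. *)

(** [f] need not be Borel, and the integral of a function that is not measurable is only a lower
    integral: monotone, homogeneous and compatible with affine bijections, but not subject to
    Tonelli. Tonelli is therefore applied to a Borel majorant of [f] whose integral exceeds that of
    [f] by a factor as close to 1 as desired. In the equality case upper semicontinuity makes [f]
    Borel; together with integrability it makes the superlevel sets at positive heights compact, so
    that maxima over fibres are attained. The recurring device is the contraction towards a box on
    which f >= c > 0. By log-concavity it loses only a factor (1 - e)^k c^e, where (1 - e)^k is a
    Jacobian, and this tends to 1 with e. A positive integral provides such a box, since otherwise
    [f] would live on a hyperplane. Everything is computed in coordinates along bases of H and of
    its orthogonal complement; orthogonality makes the Gram determinant of the two bases together a
    product. *)

(** * Integrals of functions that need not be measurable *)

Section lower_integral.
Local Open Scope ereal_scope.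
Context d (T : measurableType d) (R : realType).
Implicit Types (mu : {measure set T -> \bar R}) (f g h : T -> \bar R).

Import HBNNSimple.

(* On a function that is not measurable the integral of the library is a lower
   integral. *)
Lemma integral_le_of_minorant mu f (c : \bar R) : (forall x, 0 <= f x) ->
  (forall h : T -> \bar R, measurable_fun [set: T] h -> (forall x, 0 <= h x <= f x) ->
    \int[mu]_x h x <= c) -> \int[mu]_x f x <= c.
Proof.
move=> f0 fc; rewrite ge0_integralTE//; apply: ge_ereal_sup => _ [h hf <-].
have := fc (EFin \o h); rewrite integral_nnsfun// patch_setT; apply.
  exact/measurable_EFinP.
by move=> x; rewrite hf lee_fin fun_ge0.
Qed.

Lemma le_integralT mu f g : (forall x, 0 <= f x) -> (forall x, f x <= g x) ->
  \int[mu]_x f x <= \int[mu]_x g x.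
Proof.
move=> f0 fg; rewrite !ge0_integralTE//; last first.
  by move=> x; exact: le_trans (fg x).
by apply: le_ereal_sup => _ [h hf <-]; exists h => // x; exact: le_trans (fg x).
Qed.

(** Multiplying Borel minorants by a positive [a] gives one inequality for every [a]; the other is
    the same inequality for the inverse factor. *)
Lemma integralZT mu f (c : R) : (forall x, 0 <= f x) -> (0 <= c)%R ->
  \int[mu]_x (c%:E * f x) = c%:E * \int[mu]_x f x.
Proof.
move=> f0; rewrite le_eqVlt => /predU1P[<-|c0].
  rewrite mul0e; under eq_integral do rewrite mul0e.
  exact: integral0.
have le (a : R) g : (0 < a)%R -> (forall x, 0 <= g x) ->
    a%:E * \int[mu]_x g x <= \int[mu]_x (a%:E * g x).
  move=> a0 g0; rewrite -lee_pdivlMl//; apply: integral_le_of_minorant => // h mh hg.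
  have h0 x : 0 <= h x by have /andP[] := hg x.
  rewrite lee_pdivlMl// -ge0_integralZl//; last exact: ltW.
  apply: le_integralT => x; first by rewrite mule_ge0// lee_fin ltW.
  by rewrite lee_pmul2l//; have /andP[] := hg x.
apply/eqP; rewrite eq_le le// andbT.
have cf0 x : 0 <= c%:E * f x by rewrite mule_ge0// lee_fin ltW.
have := le c^-1%R _ _ cf0.
rewrite invr_gt0 => /(_ c0) {}le.
rewrite -lee_pdivrMl// (le_trans le)//; apply: le_integralT => x.
  by rewrite mule_ge0// lee_fin invr_ge0 ltW.
by rewrite muleA -EFinM mulVf ?mul1e// gt_eqF.
Qed.

End lower_integral.

(** The measurable inverse [q] is what lets a Borel minorant of f o p come from a Borel minorant of
    [f]. *)
Lemma integral_pushforward_bij d1 d2 (T1 : measurableType d1)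
    (T2 : measurableType d2) (R : realType) (mu : {measure set T1 -> \bar R})
    (p : T1 -> T2) (q : T2 -> T1) (f : T2 -> \bar R) :
    measurable_fun [set: T1] p -> measurable_fun [set: T2] q ->
    cancel p q -> cancel q p -> (forall x, 0 <= f x)%E ->
  (\int[pushforward mu p]_x f x = \int[mu]_x f (p x))%E.
Proof.
move=> mp mq pK qK f0.
apply/eqP; rewrite eq_le; apply/andP; split.
  apply: (@integral_le_of_minorant _ _ _ (pushforward mu p)) => // h mh hf.
  rewrite ge0_integral_pushforward//; last first.
    by move=> x _; have /andP[] := hf x.
  rewrite preimage_setT; apply: le_integralT => x; by have /andP[] := hf (p x).
apply: (@integral_le_of_minorant _ _ _ mu) => // h mh hf.
have -> : h = (h \o q) \o p by apply/funext => x /=; rewrite pK.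
have mhq : measurable_fun [set: T2] (h \o q) by exact: measurableT_comp.
have hq0 y : (0 <= (h \o q) y)%E by have /andP[] := hf (q y).
have hp0 : {in [set: T2], forall y, (0 <= (h \o q) y)%E} by [].
have /esym := @ge0_integral_pushforward _ _ _ _ _ p mp mu setT _ measurableT mhq hp0.
rewrite preimage_setT => ->.
apply: (@le_integralT _ _ _ (pushforward mu p)) => // x /=.
by have /andP[_] := hf (q x); rewrite qK.
Qed.

(** * Lebesgue measure on row vectors *)

Section row_vectors_measurable.
Context {R : realType} (n : nat).

(** The product sigma-algebra of tuples, carried to row vectors, so that measure theory and matrix
    algebra share one space. *)
Let measurable_rV (A : set 'rV[R]_n) : Prop :=
  measurable ((@row_of_tuple R n : n.-tuple (measurableTypeR R) -> _) @^-1` A).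

Let measurable_rV0 : measurable_rV set0.
Proof. by rewrite /measurable_rV preimage_set0. Qed.

Let measurable_rVC A : measurable_rV A -> measurable_rV (~` A).
Proof. by rewrite /measurable_rV preimage_setC => mA; exact: measurableC mA. Qed.

Let measurable_rV_bigcup (F : (set 'rV[R]_n)^nat) :
  (forall i, measurable_rV (F i)) -> measurable_rV (\bigcup_i (F i)).
Proof. by move=> mF; rewrite /measurable_rV preimage_bigcup; exact: bigcupT_measurable. Qed.

HB.instance Definition _ := @isMeasurable.Build default_measure_display
  'rV[R]_n measurable_rV measurable_rV0 measurable_rVC measurable_rV_bigcup.

Lemma measurable_row_of_tuple :
  measurable_fun [set: n.-tuple (measurableTypeR R)] (@row_of_tuple R n).
Proof. by move=> _ A mA; rewrite setTI. Qed.

HB.instance Definition _ :=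
  isMeasurableFun.Build _ _ _ _ (@row_of_tuple R n) measurable_row_of_tuple.

Definition tuple_of_row (v : 'rV[R]_n) : n.-tuple (measurableTypeR R) :=
  [tuple v 0 j | j < n].

Lemma tuple_of_rowK : cancel tuple_of_row (@row_of_tuple R n).
Proof. by move=> v; apply/rowP => j; rewrite mxE tnth_mktuple. Qed.

Lemma row_of_tupleK : cancel (@row_of_tuple R n) tuple_of_row.
Proof. by move=> t; apply: eq_from_tnth => j; rewrite tnth_mktuple mxE. Qed.

Lemma measurable_tuple_of_row : measurable_fun [set: 'rV[R]_n] tuple_of_row.
Proof.
move=> _ A mA; rewrite setTI /measurable/= /measurable_rV -comp_preimage.
by rewrite (_ : _ \o _ = id) //; apply/funext => t /=; rewrite row_of_tupleK.
Qed.

Lemma measurable_fun_rVP d (T : measurableType d) (f : T -> 'rV[R]_n) :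
  measurable_fun [set: T] f <->
  forall j, measurable_fun [set: T] (fun x => f x 0 j : measurableTypeR R).
Proof.
have fE : f = @row_of_tuple R n \o (tuple_of_row \o f).
  by apply/funext => x /=; rewrite tuple_of_rowK.
have jE j : (fun x => f x 0 j : measurableTypeR R) =
    @tnth n _ ^~ j \o (tuple_of_row \o f).
  by apply/funext => x /=; rewrite tnth_mktuple.
split=> [mf j|mf].
  rewrite jE; apply: measurableT_comp; first exact: measurable_tnth.
  exact: measurableT_comp measurable_tuple_of_row mf.
rewrite fE; apply: measurableT_comp; first exact: measurable_row_of_tuple.
by apply/measurable_fun_tnthP => j; rewrite -jE; exact: mf.
Qed.

Lemma measurable_coord (j : 'I_n) :
  measurable_fun [set: 'rV[R]_n] (fun v => v 0 j : measurableTypeR R).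
Proof. by move: j; apply/measurable_fun_rVP; exact: measurable_id. Qed.

Definition leb : set 'rV[R]_n -> \bar R :=
  pushforward (lebesgue_tuple n) (@row_of_tuple R n).

Let leb0 : leb set0 = 0%E.
Proof. by rewrite /leb /pushforward preimage_set0 measure0. Qed.

Let leb_ge0 A : (0 <= leb A)%E.
Proof. by rewrite /leb /pushforward measure_ge0. Qed.

Let leb_sigma_additive : semi_sigma_additive leb.
Proof.
apply: (@measure_semi_sigma_additive _ _ _
  (pushforward (lebesgue_tuple n) (@row_of_tuple R n))).
exact: measurable_row_of_tuple.
Qed.

HB.instance Definition _ := isMeasure.Build _ _ _ leb
  leb0 leb_ge0 leb_sigma_additive.

Let leb_sigma_finite : sigma_finite setT leb.
Proof.
have [F FT Foo] := sigma_finiteT (@lebesgue_tuple R n).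
exists (fun k => tuple_of_row @^-1` F k).
  by rewrite -preimage_bigcup -FT preimage_setT.
move=> k; have [mFk Fkoo] := Foo k; split.
  by rewrite -[X in measurable X]setTI; exact: measurable_tuple_of_row.
rewrite /leb /pushforward -comp_preimage (_ : _ \o _ = id)//.
by apply/funext => t /=; rewrite row_of_tupleK.
Qed.

HB.instance Definition _ := Measure_isSigmaFinite.Build _ _ _ leb
  leb_sigma_finite.

Lemma integral_leb (g : 'rV[R]_n -> \bar R) : (forall x, 0 <= g x)%E ->
  (\int[leb]_x g x = \int[lebesgue_tuple n]_t g (row_of_tuple t))%E.
Proof.
move=> g0; apply: (integral_pushforward_bij _ _ measurable_tuple_of_row) => //.
- exact: measurable_row_of_tuple.
- exact: row_of_tupleK.
- exact: tuple_of_rowK.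
Qed.

End row_vectors_measurable.
Arguments leb {R} n.

Section row_vectors_fubini.
Context {R : realType}.
Local Open Scope ereal_scope.

Lemma measurable_fun_affine d (T : measurableType d) m n (f : T -> 'rV[R]_m)
    (M : 'M[R]_(m, n)) (b : 'rV[R]_n) :
  measurable_fun [set: T] f -> measurable_fun [set: T] (fun x => (f x *m M + b)%R).
Proof.
move=> /measurable_fun_rVP mf; apply/measurable_fun_rVP => j.
under eq_fun do rewrite !mxE.
apply: measurable_funD; last exact: measurable_cst.
by apply: measurable_sum => i; apply: measurable_funM => //; exact: mf.
Qed.

Lemma measurable_row_mx d (T : measurableType d) m n (f : T -> 'rV[R]_m)
    (g : T -> 'rV[R]_n) : measurable_fun [set: T] f -> measurable_fun [set: T] g ->
  measurable_fun [set: T] (fun x => row_mx (f x) (g x)).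
Proof.
move=> /measurable_fun_rVP mf /measurable_fun_rVP mg; apply/measurable_fun_rVP => j.
by under eq_fun do rewrite mxE; case: (fintype.split j) => k; [exact: mf|exact: mg].
Qed.

Lemma measurable_scalar_mx d (T : measurableType d) (f : T -> measurableTypeR R) :
  measurable_fun [set: T] f -> measurable_fun [set: T] (fun x => (f x)%:M : 'rV[R]_1).
Proof.
move=> mf; apply/measurable_fun_rVP => j.
by under eq_fun do rewrite mxE ord1 eqxx mulr1n.
Qed.

Lemma integral_leb0 (g : 'rV[R]_0 -> \bar R) : (forall x, 0 <= g x) ->
  \int[leb 0]_x g x = g 0%R.
Proof.
move=> g0; rewrite integral_leb//= (_ : (fun t => _) = cst (g 0%R)).
  by rewrite integral_cst//= diracT mule1.
by apply/funext => t /=; congr g; apply/rowP => -[].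
Qed.

Lemma measurable_cons_row n : measurable_fun [set: measurableTypeR R * 'rV[R]_n]
  (fun p => row_mx (p.1%:M : 'rV[R]_1) p.2 : 'rV[R]_n.+1).
Proof.
apply: (@measurable_row_mx _ _ 1 n); last exact: measurable_snd.
by apply: measurable_scalar_mx; exact: measurable_fst.
Qed.

Lemma integral_lebS n (g : 'rV[R]_n.+1 -> \bar R) :
  measurable_fun setT g -> (forall x, 0 <= g x) ->
  \int[leb n.+1]_v g v =
  \int[@lebesgue_measure R \x leb n]_p g (row_mx (p.1%:M : 'rV[R]_1) p.2).
Proof.
move=> mg g0; rewrite integral_leb//=.
have mgr : measurable_fun [set: n.+1.-tuple (measurableTypeR R)]
    (g \o @row_of_tuple R n.+1).
  by apply: measurableT_comp => //; exact: measurable_row_of_tuple.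
have := @ge0_integral_pushforward _ _ _ _ R _
  (@measurable_tcons _ (measurableTypeR R) n)
  (@lebesgue_measure R \x lebesgue_tuple n) setT _ measurableT mgr.
rewrite preimage_setT /= => -> //.
rewrite fubini_tonelli1//; last first.
  exact: measurableT_comp mgr (@measurable_tcons _ _ n).
rewrite fubini_tonelli1//; last first.
  exact: measurableT_comp mg (@measurable_cons_row n).
apply: eq_integral => x _; rewrite /fubini_F/= integral_leb//.
apply: eq_integral => t _; congr g; apply/rowP => j.
rewrite !mxE; case: splitP => k jk; rewrite ?mxE ?(tnth_nth 0%R)/= jk.
  by rewrite ord1.
by [].
Qed.

End row_vectors_fubini.

(** * Linear change of variables for Borel functions *)

Section linear_change_of_variables.
Context {R : realType}.
Local Notation leb1 := (@lebesgue_measure R).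

Let measurable_affine (a b : R) :
  measurable_fun [set: measurableTypeR R] (fun x => (a * x + b) : measurableTypeR R).
Proof.
apply: (@measurable_funD _ _ R); last exact: measurable_cst.
by apply: (@measurable_funM _ _ R); [exact: measurable_cst|exact: measurable_id].
Qed.

(** By uniqueness of the measure that gives half-open intervals their length. A negative slope moves
    the closed end to the left, which does not change the length. *)
Lemma lebesgue_measure_affine (a b : R) (A : set (measurableTypeR R)) :
  a != 0 -> measurable A ->
  (`|a|%:E * leb1 ((fun x => a * x + b : measurableTypeR R)%R @^-1` A) = leb1 A)%E.
Proof.
move=> a0 mA.
have ma := measurable_affine a b.
pose mu' : {measure set (measurableTypeR R) -> \bar R} := mscale (NngNum (normr_ge0 a))
  (measure_function_pushforward__canonical__measure_function_Measure leb1 ma).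
rewrite -[LHS]/(mu' A).
apply/esym; apply: lebesgue_measure_unique => // _ [[u v] _ <-].
rewrite -[RHS]/(`|a|%:E *
  leb1 ((fun x => a * x + b : measurableTypeR R)%R @^-1` `]u, v]%classic))%E.
have [a_gt0|a_lt0|/eqP] := ltgtP 0 a; last by rewrite eq_sym (negbTE a0).
- rewrite (_ : _ @^-1` _ = `](u - b) / a, (v - b) / a]%classic); last first.
    apply/seteqP; split=> x /=; rewrite !in_itv/= ltr_pdivrMr// ler_pdivlMr//;
      by rewrite ltrBlDr lerBrDr mulrC.
  rewrite !lebesgue_measure_itv/= !lte_fin ltr_pM2r ?invr_gt0// ltrD2r.
  case: ifPn => uv; last by rewrite mule0.
  rewrite gtr0_norm// -!EFinB -EFinM; congr EFin; rewrite -mulrBl mulrC divfK//.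
  by ring.
- rewrite (_ : _ @^-1` _ = `[(v - b) / a, (u - b) / a[%classic); last first.
    apply/seteqP; split=> x /=; rewrite !in_itv/= ler_ndivrMr// ltr_ndivlMr//;
      by rewrite ltrBlDr lerBrDr mulrC andbC.
  rewrite !lebesgue_measure_itv/= !lte_fin ltr_nM2r ?invr_lt0// ltrD2r.
  case: ifPn => uv; last by rewrite mule0.
  rewrite ltr0_norm// -!EFinB -EFinM; congr EFin; rewrite -mulrBl mulNr mulrC divfK//.
  by ring.
Qed.

Lemma integral_affine1 (a b : R) (g : measurableTypeR R -> \bar R) :
  a != 0 -> measurable_fun setT g -> (forall x, 0 <= g x)%E ->
  (`|a|%:E * \int[leb1]_x g (a * x + b)%R = \int[leb1]_x g x)%E.
Proof.
move=> a0 mg g0; have ma := measurable_affine a b.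
pose mu : {measure set (measurableTypeR R) -> \bar R} :=
  measure_function_pushforward__canonical__measure_function_Measure leb1 ma.
have := @ge0_integral_pushforward _ _ _ _ R _ ma leb1 setT _ measurableT mg.
rewrite preimage_setT => <-//.
rewrite -[LHS](ge0_integral_mscale mu measurableT (NngNum (normr_ge0 a)) mg)//.
apply: eq_measure_integral => A mA _; exact: lebesgue_measure_affine.
Qed.

(** The translation [b] belongs to the predicate because, once the first coordinate is fixed, the
    shear in a block matrix acts on the other coordinates as a translation. *)
Definition change_of_variables n (M : 'M[R]_n) :=
  forall (g : 'rV[R]_n -> \bar R) (b : 'rV[R]_n),
  measurable_fun setT g -> (forall x, 0 <= g x)%E ->
  (`|\det M|%:E * \int[leb n]_v g (v *m M + b)%R = \int[leb n]_v g v)%E.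

Lemma measurable_comp_affine n m (g : 'rV[R]_n -> \bar R) (M : 'M[R]_(m, n))
    (b : 'rV[R]_n) : measurable_fun setT g ->
  measurable_fun [set: 'rV[R]_m] (fun v => g (v *m M + b)).
Proof.
move=> mg; apply: (measurableT_comp mg).
by apply: measurable_fun_affine; exact: measurable_id.
Qed.

Lemma change_of_variablesM n (M N : 'M[R]_n) :
  change_of_variables M -> change_of_variables N -> change_of_variables (M *m N).
Proof.
move=> cM cN g b mg g0; rewrite det_mulmx normrM mulrC EFinM -muleA.
under eq_integral do rewrite mulmxA -[_ *m M]addr0.
have /= -> := cM (fun v => g (v *m N + b)) 0 => //; last exact: measurable_comp_affine.
by rewrite -(cN g b mg g0).
Qed.

Lemma integral_lebS1 n (g : 'rV[R]_n.+1 -> \bar R) :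
  measurable_fun setT g -> (forall x, 0 <= g x)%E ->
  (\int[leb n.+1]_v g v =
   \int[leb1]_x \int[leb n]_v g (row_mx (x%:M : 'rV[R]_1) v))%E.
Proof.
move=> mg g0; rewrite integral_lebS// fubini_tonelli1//.
exact: measurableT_comp mg (@measurable_cons_row R n).
Qed.

Lemma integral_lebS2 n (g : 'rV[R]_n.+1 -> \bar R) :
  measurable_fun setT g -> (forall x, 0 <= g x)%E ->
  (\int[leb n.+1]_v g v =
   \int[leb n]_v \int[leb1]_x g (row_mx (x%:M : 'rV[R]_1) v))%E.
Proof.
move=> mg g0; rewrite integral_lebS// fubini_tonelli2//.
exact: measurableT_comp mg (@measurable_cons_row R n).
Qed.

(** For a fixed first coordinate the row [r] only translates the others, which the hypothesis on [S]
    absorbs; the first coordinate then obeys the one-dimensional formula. *)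
Lemma change_of_variables_ublock n (a : R) (r : 'rV[R]_n) (S : 'M[R]_n) :
  a != 0 -> change_of_variables S ->
  change_of_variables (block_mx (a%:M : 'M[R]_1) r 0 S : 'M[R]_(1 + n)).
Proof.
move=> a0 cS g b mg g0.
rewrite -[b](@hsubmxK _ 1 1 n); set b1 := lsubmx _; set b2 := rsubmx _.
rewrite (@det_ublock _ 1 n) det_scalar1 normrM EFinM.
rewrite [X in (_ * X)%E]integral_lebS1//; last exact: measurable_comp_affine.
rewrite [RHS]integral_lebS1//.
pose G x := (\int[leb n]_v g (row_mx (x%:M : 'rV[R]_1) v))%E.
have mG : measurable_fun [set: measurableTypeR R] G.
  have := @measurable_fun_fubini_tonelli_F _ _ _ _ _ (leb n) _
    (measurableT_comp mg (@measurable_cons_row R n)).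
  by apply => p; exact: g0.
have G0 x : (0 <= G x)%E by exact: integral_ge0.
rewrite -[RHS](integral_affine1 (b1 0 0) a0 mG G0) -muleA; congr (_ * _)%E.
rewrite -integralZT//; last by move=> x; exact: integral_ge0.
apply: eq_integral => x _; rewrite /G.
rewrite -(cS (fun v => g (row_mx ((a * x + b1 0 0)%:M : 'rV[R]_1) v)) (x *: r + b2))//; last first.
  apply: measurableT_comp mg _ => /=.
  apply: (@measurable_row_mx _ _ _ 1 n); last exact: measurable_id.
  exact: measurable_cst.
congr (_ * _)%E; apply: eq_integral => v _; congr g.
rewrite (@mul_row_block _ 1 1 n 1 n) mulmx0 addr0 (@add_row_mx _ 1 1 n).
congr row_mx; last by rewrite mul_scalar_mx addrAC addrA addrAC [v *m S + _]addrC.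
apply/rowP => j; rewrite !ord1 mul_scalar_mx !mxE.
by rewrite eqxx !mulr1n mulrC.
Qed.

(** Here the inner integral runs over the first coordinate: for fixed [v] the column [c] only
    translates it. *)
Lemma change_of_variables_lblock n (c : 'cV[R]_n) :
  change_of_variables (1%:M : 'M[R]_n) ->
  change_of_variables (block_mx (1%:M : 'M[R]_1) 0 c 1%:M : 'M[R]_(1 + n)).
Proof.
move=> c1 g b mg g0.
rewrite -[b](@hsubmxK _ 1 1 n); set b1 := lsubmx _; set b2 := rsubmx _.
rewrite (@det_lblock _ 1 n) !det1 mul1r normr1 mul1e.
rewrite integral_lebS2//; last exact: measurable_comp_affine.
have trans v : (\int[leb1]_x g (row_mx (x%:M : 'rV[R]_1) v *m
     block_mx (1%:M : 'M[R]_1) 0 c 1%:M + row_mx b1 b2)%R =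
   \int[leb1]_x g (row_mx (x%:M : 'rV[R]_1) (v + b2)%R))%E.
  have mgv : measurable_fun [set: measurableTypeR R]
      (fun x => g (row_mx (x%:M : 'rV[R]_1) (v + b2))).
    apply: (measurableT_comp mg).
    apply: (@measurable_row_mx _ _ _ 1 n); last exact: measurable_cst.
    by apply: measurable_scalar_mx; exact: measurable_id.
  rewrite -(@integral_affine1 1 ((v *m c) 0 0 + b1 0 0) _ _ mgv)// normr1 mul1e.
  apply: eq_integral => x _; congr g.
  rewrite (@mul_row_block _ 1 1 n 1 n) !mulmx1 mulmx0 add0r (@add_row_mx _ 1 1 n).
  congr row_mx; apply/rowP => j; rewrite !ord1 [RHS]mxE eqxx mulr1n mul1r addrA.
  by rewrite mxE [X in X + _]mxE [X in X + _ + _]mxE eqxx mulr1n.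
pose G v := (\int[leb1]_x g (row_mx (x%:M : 'rV[R]_1) v))%E.
have mG : measurable_fun [set: 'rV[R]_n] G.
  have := @measurable_fun_fubini_tonelli_G _ _ _ _ _ leb1 _
    (measurableT_comp mg (@measurable_cons_row R n)).
  by apply => p; exact: g0.
have G0 v : (0 <= G v)%E by exact: integral_ge0.
transitivity (\int[leb n]_v G (v *m 1%:M + b2)%R)%E.
  by apply: eq_integral => v _; rewrite trans mulmx1.
by have := c1 G b2 mG G0; rewrite det1 normr1 mul1e => ->; rewrite (integral_lebS2 mg g0).
Qed.

(** One step of Gaussian elimination: [M] is a lower shear times an upper block matrix whose corner
    [S] is the Schur complement of the pivot. *)
Lemma change_of_variables_pivot n (M : 'M[R]_(1 + n)) :
  (forall S : 'M[R]_n, \det S != 0 -> change_of_variables S) ->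
  \det M != 0 -> M 0 0 != 0 -> change_of_variables M.
Proof.
move=> IH dM; set a := M 0 0 => a0.
pose c : 'cV[R]_n := a^-1 *: @dlsubmx _ 1 n 1 n M; pose r := @ursubmx _ 1 n 1 n M.
pose S : 'M[R]_n := @drsubmx _ 1 n 1 n M - c *m r.
have aE : @ulsubmx _ 1 n 1 n M = a%:M.
  by apply/rowP => j; rewrite !ord1 !mxE eqxx mulr1n /a; congr (M _ _); exact/val_inj.
have ME : M = block_mx (1%:M : 'M[R]_1) 0 c 1%:M *m block_mx (a%:M : 'M[R]_1) r 0 S.
  rewrite (@mulmx_block _ 1 n 1 n 1 n) !mul1mx !mulmx0 !mul0mx !addr0 /S addrC subrK.
  by rewrite mul_mx_scalar scalerA divff// scale1r -aE (@submxK _ 1 n 1 n).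
have := dM; rewrite ME det_mulmx (@det_lblock _ 1 n) (@det_ublock _ 1 n) !det1 !mul1r.
rewrite mulf_eq0 negb_or => /andP[_ dS].
apply: change_of_variablesM; last exact/change_of_variables_ublock/IH.
by apply: change_of_variables_lblock; apply: IH; rewrite det1 oner_eq0.
Qed.

(* Block elimination on the first column; when the pivot vanishes, adding another
   row to the first one makes it nonzero. *)
Lemma change_of_variables_unit n (M : 'M[R]_n) :
  \det M != 0 -> change_of_variables M.
Proof.
elim: n M => [M _ g b mg g0|n IH M dM].
  rewrite det_mx00 normr1 mul1e; congr integral; apply/funext => v; congr g.
  by apply/rowP => -[].
have [M0|] := eqVneq (M 0 0) 0; last exact: (@change_of_variables_pivot n).
(* If the first column vanished below the zero pivot as well, the determinant would be 0. *)
have [j Mj] : exists j, @dlsubmx _ 1 n 1 n M j 0 != 0.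
  apply/existsP; apply: contraNT dM; rewrite negb_exists => /forallP d0.
  rewrite -[M](@submxK _ 1 n 1 n) (_ : dlsubmx _ = 0); last first.
    by apply/colP => i; rewrite [RHS]mxE; apply/eqP; rewrite -[_ == _]negbK d0.
  rewrite (@det_ublock _ 1 n) det_mx11 (_ : _ 0 0 = 0) ?mul0r//.
  by rewrite !mxE -[RHS]M0; congr (M _ _); exact/val_inj.
pose E e := block_mx (1%:M : 'M[R]_1) (e *: delta_mx 0 j) 0 1%:M : 'M[R]_(1 + n).
have dE e : \det (E e) = 1 by rewrite (@det_ublock _ 1 n) !det1 mulr1.
have EE : M = E (-1) *m (E 1 *m M).
  rewrite mulmxA (@mulmx_block _ 1 n 1 n 1 n) !mul1mx !mulmx1 !mulmx0 mul0mx.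
  by rewrite scaleN1r scale1r subrr !addr0 !add0r -(@scalar_mx_block _ 1 n) mul1mx.
rewrite EE; apply: change_of_variablesM.
  apply: change_of_variables_ublock; first exact: oner_neq0.
  by apply: IH; rewrite det1 oner_eq0.
apply: (@change_of_variables_pivot n) => //; first by rewrite det_mulmx dE mul1r.
rewrite -[M](@submxK _ 1 n 1 n) (@mulmx_block _ 1 n 1 n 1 n) !mul1mx scale1r.
rewrite (_ : 0 = lshift n (0 : 'I_1)); last exact/val_inj.
rewrite block_mxEul mxE -rowE.
rewrite (_ : ulsubmx _ _ _ = 0) ?add0r; last first.
  by rewrite !mxE -[RHS]M0; congr (M _ _); exact/val_inj.
by rewrite mxE.
Qed.

End linear_change_of_variables.

(** * Integration along two orthogonal subspaces *)

Section lebesgue_decomposition.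
Context {R : realType}.

(** Borel minorants are transported by the affine map and by its inverse, which extends the formula
    to functions that are not Borel. *)
Lemma integral_affine n (M : 'M[R]_n) (b : 'rV[R]_n) (f : 'rV[R]_n -> \bar R) :
  \det M != 0 -> (forall x, 0 <= f x)%E ->
  (`|\det M|%:E * \int[leb n]_v f (v *m M + b)%R = \int[leb n]_v f v)%E.
Proof.
move=> dM f0; have cM := change_of_variables_unit dM.
have uM : M \in unitmx by rewrite unitmxE unitfE.
have d0 : 0 < `|\det M| by rewrite normr_gt0.
apply/eqP; rewrite eq_le; apply/andP; split.
  rewrite -lee_pdivlMl//; apply: integral_le_of_minorant => // h mh hf.
  rewrite lee_pdivlMl//.
  pose q w := (w *m invmx M - b *m invmx M)%R.
  have qK v : q (v *m M + b) = v by rewrite /q mulmxDl mulmxK// addrK.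
  have Kq w : (q w *m M + b) = w by rewrite /q mulmxBl !mulmxKV// subrK.
  have h0 x : (0 <= h x)%E by have /andP[] := hf x.
  have := cM (h \o q) b; rewrite /=; under eq_integral do rewrite qK.
  move=> ->//; last exact: measurable_comp_affine.
  by apply: le_integralT => // w; have /andP[_] := hf (q w); rewrite Kq.
apply: integral_le_of_minorant => // h mh hf.
have h0 x : (0 <= h x)%E by have /andP[] := hf x.
rewrite -(cM h b)// lee_pmul2l//; apply: le_integralT => // v.
by have /andP[] := hf (v *m M + b).
Qed.

(** In dimension 0 the ratio may be 0, as a^0 = 1; this covers the end values of lambda when one of
    the two subspaces is trivial. *)
Lemma integral_homothety n (a : R) (b : 'rV[R]_n) (f : 'rV[R]_n -> \bar R) :
  0 < a \/ n = 0 -> (forall x, 0 <= f x)%E ->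
  ((a ^+ n)%:E * \int[leb n]_v f (a *: v + b)%R = \int[leb n]_v f v)%E.
Proof.
case=> [a0 f0|n0 f0]; last first.
  subst n; rewrite expr0 mul1e; congr integral; apply/funext => v; congr f.
  by apply/rowP => -[].
rewrite -(@integral_affine n a%:M b f)//; last by rewrite det_scalar expf_neq0// gt_eqF.
rewrite det_scalar gtr0_norm ?exprn_gt0//; congr (_ * _)%E.
by apply: eq_integral => v _; rewrite mul_mx_scalar.
Qed.

Lemma measurable_fiber_integral i k n (B : 'M[R]_(i, n)) (C : 'M[R]_(k, n))
    (b : 'rV[R]_n) (g : 'rV[R]_n -> \bar R) :
  measurable_fun setT g -> (forall x, 0 <= g x)%E ->
  measurable_fun setT (fun x => \int[leb k]_y g (x *m B + y *m C + b)%R)%E.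
Proof.
move=> mg g0.
have := @measurable_fun_fubini_tonelli_F _ _ _ _ _ (leb k)
  (fun p : 'rV[R]_i * 'rV[R]_k => g (p.1 *m B + p.2 *m C + b)).
apply=> //; apply: (measurableT_comp mg).
under eq_fun do rewrite -mul_row_col.
apply: measurable_fun_affine; apply: measurable_row_mx.
  exact: measurable_fst.
exact: measurable_snd.
Qed.

Lemma integral_col_mx i k n (B : 'M[R]_(i, n)) (C : 'M[R]_(k, n)) (b : 'rV[R]_n)
    (g : 'rV[R]_n -> \bar R) : measurable_fun setT g -> (forall x, 0 <= g x)%E ->
  (\int[leb (i + k)]_v g (v *m col_mx B C + b)%R =
   \int[leb i]_x \int[leb k]_y g (x *m B + y *m C + b)%R)%E.
Proof.
move=> mg g0; elim: i B b => [|i IH] B b.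
  rewrite integral_leb0//; last by move=> x; exact: integral_ge0.
  apply: eq_integral => y _; congr g; congr (_ + _); rewrite mul0mx add0r.
  apply/rowP => j; rewrite !mxE; apply: eq_bigr => l _; rewrite mxE.
  by case: splitP => [[]//|l' ll']; congr (_ * C _ _); exact/val_inj.
have BE : B = col_mx (@usubmx _ 1 i n B) (@dsubmx _ 1 i n B) by rewrite vsubmxK.
set B0 := usubmx _ in BE; set B1 := dsubmx _ in BE.
rewrite [LHS](@integral_lebS1 _ (i + k))//; last exact: (@measurable_comp_affine _ n (i.+1 + k)%N).
have mG := @measurable_fiber_integral _ _ _ B C b _ mg g0.
rewrite [RHS]integral_lebS1//; last by move=> x; exact: integral_ge0.
apply: eq_integral => x _.
transitivity (\int[leb (i + k)]_v g (v *m col_mx B1 C + (x *: B0 + b))%R)%E.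
  apply: eq_integral => v _; congr g; rewrite addrA; congr (_ + _).
  rewrite [in LHS]BE.
  have -> : col_mx (col_mx B0 B1) C = col_mx B0 (col_mx B1 C).
    have /= -> := @col_mxA _ 1 i k n B0 B1 C.
    exact/esym/(@castmx_id _ (1 + i + k) n).
  by rewrite (@mul_row_col _ 1 1 (i + k)) mul_scalar_mx addrC.
rewrite IH; apply: eq_integral => v _; apply: eq_integral => y _; congr g.
rewrite [in RHS]BE (@mul_row_col _ 1 1 i) mul_scalar_mx.
by rewrite addrA; congr (_ + _); rewrite -[RHS]addrA [RHS]addrC.
Qed.

(** One Gram-Schmidt step: removing from the other rows their component along the first is a
    unimodular operation, and it makes the Gram matrix block diagonal with first entry |b|^2. *)
Lemma det_gram_ge0 m n (B : 'M[R]_(m, n)) : 0 <= \det (B *m B^T).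
Proof.
elim: m B => [B|m IH B]; first by rewrite det_mx00.
rewrite -[B](@vsubmxK _ 1 m n); move: (@usubmx _ 1 m n B) (@dsubmx _ 1 m n B) => b B'.
have bE : b *m b^T = (\sum_j b 0 j ^+ 2)%:M.
  apply/matrixP => p q; rewrite !ord1 !mxE eqxx mulr1n; apply: eq_bigr => j _.
  by rewrite mxE expr2.
have [b0|b0] := eqVneq (\sum_j b 0 j ^+ 2) 0.
  have -> : b = 0.
    apply/rowP => j; rewrite mxE; apply/eqP; rewrite -sqrf_eq0.
    move/eqP: b0; rewrite psumr_eq0; last by move=> l _; exact: sqr_ge0.
    by move=> /allP/(_ j); rewrite mem_index_enum; apply.
  by rewrite (@tr_col_mx _ 1 m n) (@mul_col_row _ 1 m n 1 m) trmx0 !mulmx0 !mul0mx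
    (@det_ublock _ 1 m) det_mx11 mxE mul0r.
set s := \sum_j _ in bE b0.
pose c := s^-1 *: (B' *m b^T).
pose L := block_mx (1%:M : 'M[R]_1) 0 (- c) 1%:M : 'M[R]_(1 + m).
have dL : \det L = 1 by rewrite (@det_lblock _ 1 m) !det1 mulr1.
pose B2 := B' - c *m b.
have LB : L *m col_mx b B' = col_mx b B2.
  by rewrite (@mul_block_col _ 1 m 1 m) mul1mx mul0mx addr0 mul1mx mulNmx addrC.
have -> : \det (col_mx b B' *m (col_mx b B')^T) =
    \det (L *m col_mx b B' *m (L *m col_mx b B')^T).
  by rewrite trmx_mul mulmxA -[L *m _ *m _]mulmxA !det_mulmx det_tr dL mul1r mulr1.
have B2b : B2 *m b^T = 0.
  by rewrite mulmxBl -mulmxA bE mul_mx_scalar scalerA divff// scale1r subrr.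
have bB2 : b *m B2^T = 0 by rewrite -[b]trmxK -trmx_mul B2b trmx0.
rewrite LB (@tr_col_mx _ 1 m n) (@mul_col_row _ 1 m n 1 m) bE B2b bB2.
rewrite (@det_ublock _ 1 m) det_scalar1.
by rewrite mulr_ge0// sumr_ge0// => j _; rewrite sqr_ge0.
Qed.

(** The matrix has [m] rows with an equation [m = n], since it will be made of two stacked bases
    with i + k rows in all. *)
Lemma integral_gram m n (M : 'M[R]_(m, n)) (g : 'rV[R]_n -> \bar R) :
  m = n -> \det (M *m M^T) != 0 -> (forall x, 0 <= g x)%E ->
  ((Num.sqrt (\det (M *m M^T)))%:E * \int[leb m]_v g (v *m M)%R = \int[leb n]_v g v)%E.
Proof.
move=> mn; subst m; rewrite det_mulmx det_tr mulf_eq0 orbb => dM g0.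
rewrite -expr2 sqrtr_sqr -(@integral_affine n M 0 g)//; congr (_ * _)%E.
by apply: eq_integral => v _; rewrite addr0.
Qed.

(** Orthogonality makes the Gram matrix of the stacked bases block diagonal, so its determinant is
    the product of the two. *)
Lemma integral_orthogonal_sum i k n (B : 'M[R]_(i, n)) (C : 'M[R]_(k, n))
    (g : 'rV[R]_n -> \bar R) : measurable_fun setT g -> (forall x, 0 <= g x)%E ->
  (i + k)%N = n -> B *m C^T = 0 ->
  \det (B *m B^T) != 0 -> \det (C *m C^T) != 0 ->
  (\int[leb n]_z g z = (Num.sqrt (\det (B *m B^T)))%:E *
    ((Num.sqrt (\det (C *m C^T)))%:E *
     \int[leb i]_x \int[leb k]_y g (x *m B + y *m C)%R))%E.
Proof.
move=> mg g0 ikn BC dB dC.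
have CB : C *m B^T = 0 by rewrite -[C]trmxK -trmx_mul BC trmx0.
have DE : \det (col_mx B C *m (col_mx B C)^T) = \det (B *m B^T) * \det (C *m C^T).
  by rewrite tr_col_mx mul_col_row BC CB det_ublock.
rewrite -(@integral_gram _ _ (col_mx B C) _ ikn _ g0) DE; last by rewrite mulf_neq0.
rewrite sqrtrM ?det_gram_ge0//.
rewrite EFinM -muleA; congr (_ * (_ * _))%E.
transitivity (\int[leb (i + k)]_v g (v *m col_mx B C + 0)%R)%E.
  by apply: eq_integral => v _; rewrite addr0.
rewrite (integral_col_mx B C 0 mg g0); apply: eq_integral => x _.
by apply: eq_integral => y _; rewrite addr0.
Qed.

End lebesgue_decomposition.

(** * Open boxes and Borel measurability of semicontinuous functions *)

Section boxes.
Context {R : realType} {n : nat}.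
Implicit Types (z w : 'rV[R]_n) (r : R) (U : set 'rV[R]_n).

Definition box z r : set 'rV[R]_n := [set w | forall j, `|w 0 j - z 0 j| < r].

Lemma box_center z r : 0 < r -> box z r z.
Proof. by move=> r0 j; rewrite subrr normr0. Qed.

Lemma ball_box z r : 0 < r -> ball z r = box z r.
Proof.
move=> r0; apply/seteqP; split=> [w [_ zw] j|w zw].
  by have := zw 0 j; rewrite /ball/= distrC.
by split=> // i j; rewrite ord1 /ball/= distrC.
Qed.

Lemma open_boxP U : open U <->
  forall z, U z -> exists2 r, 0 < r & box z r `<=` U.
Proof.
split=> [oU z Uz|boxU].
  have /nbhs_ballP[r /= r0 zU] := open_nbhs_nbhs (conj oU Uz).
  by exists r => //; rewrite -ball_box.
rewrite openE => z /boxU[r r0 zU]; apply/nbhs_ballP; exists r => //=.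
by rewrite ball_box.
Qed.

Lemma open_box z r : open (box z r).
Proof.
apply/open_boxP => w zw.
have [r0|r0] := ltP 0 r; last first.
  exists 1 => // v _ j.
  by have := le_lt_trans (normr_ge0 _) (zw j); rewrite ltNge r0.
pose s := \big[Num.min/r]_j (r - `|w 0 j - z 0 j|).
exists s; first by apply/bigmin_gtP; split=> // j _; rewrite subr_gt0.
move=> v wv j; have := wv j; rewrite /s => /bigmin_gtP[_ /(_ j isT)].
by rewrite ltrBrDr; apply: le_lt_trans; rewrite -(subrKA (w 0 j)) ler_normD.
Qed.

Lemma measurable_box z r : measurable (box z r).
Proof.
rewrite (_ : box z r = \bigcap_(j in [set: 'I_n]) [set w | `|w 0 j - z 0 j| < r]); last first.
  by apply/seteqP; split=> w zw; [move=> j _|move=> j]; exact: zw.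
apply: fin_bigcap_measurable => // j _.
have mj : measurable_fun [set: 'rV[R]_n] (fun w => `|w 0 j - z 0 j| : measurableTypeR R).
  apply: (measurableT_comp (@normr_measurable R setT)).
  by apply: (measurable_funB (measurable_coord j)); exact: measurable_cst.
have : measurable ((fun w => `|w 0 j - z 0 j| : measurableTypeR R) @^-1` `]-oo, r[%classic).
  by rewrite -[X in measurable X]setTI; exact: mj.
by congr measurable; apply/seteqP; split=> w /=; rewrite in_itv.
Qed.

(* Rational boxes form a countable basis. *)
Lemma open_measurable_rV U : open U -> measurable U.
Proof.
move=> /open_boxP oU.
pose B (p : 'rV[rat]_n * nat) := box (map_mx ratr p.1) p.2.+1%:R^-1.
rewrite (_ : U = \bigcup_(p in [set p | B p `<=` U]) B p).
  rewrite bigcup_mkcond; apply: countable_bigcupT_measurable => // p.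
  by case: ifPn => _ //; exact: measurable_box.
apply/seteqP; split=> [z /oU[r r0 zU]|z [p /=]]; last exact.
pose k := Num.truncn (2 / r); pose e : R := k.+1%:R^-1.
have e0 : 0 < e by rewrite invr_gt0 ltr0n.
have er : e + e <= r.
  rewrite -mulr2n -mulr_natr -ler_pdivlMr// /e -[leRHS]invrK lef_pV2 ?posrE ?invr_gt0 ?divr_gt0//.
  by rewrite invf_div ltW// truncnS_gt.
have /choice[q qP] : forall j, exists q : rat, ratr q \in `]z 0 j - e, z 0 j + e[.
  by move=> j; apply: rat_in_itvoo; rewrite ltrD2l gt0_cp.
have zq j : `|z 0 j - ratr (q j)| < e.
  by have := qP j; rewrite in_itv/= => /andP[? ?]; rewrite ltr_norml; apply/andP; split; lra.
exists (\row_j q j, k); last by move=> j; rewrite !mxE.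
move=> w wq; apply: zU => j; have := wq j; rewrite !mxE /= => wqj.
rewrite -(subrKA (ratr (q j))); apply: le_lt_trans (ler_normD _ _) _.
apply: lt_le_trans er; apply: ltrD => //.
by rewrite distrC.
Qed.

Lemma measurable_fun_usc (f : 'rV[R]_n -> R) :
  (forall a, open [set x | f x < a]) -> measurable_fun setT (EFin \o f).
Proof.
move=> fo; apply: (measurability _ (ErealGenInftyO.measurableE R)).
move=> /= _ [_ [a ->]] <-; apply: measurableI => //; apply: open_measurable_rV.
rewrite (_ : _ @^-1` _ = [set x | f x < a]); first exact: fo.
by apply/seteqP; split=> x /=; rewrite in_itv/= lte_fin.
Qed.

Lemma measurable_fun_lsc (f : 'rV[R]_n -> R) :
  (forall a, open [set x | a < f x]) -> measurable_fun setT (EFin \o f).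
Proof.
move=> fo; apply: (measurability _ (ErealGenOInfty.measurableE R)).
move=> /= _ [_ [a ->]] <-; apply: measurableI => //; apply: open_measurable_rV.
rewrite (_ : _ @^-1` _ = [set x | a < f x]); first exact: fo.
by apply/seteqP; split=> x /=; rewrite in_itv/= andbT lte_fin.
Qed.

End boxes.

(** * Boxes have positive measure, hyperplanes are null *)

Section volume.
Context {R : realType}.

Lemma leb_setT_gt0 n : (0 < leb n [set: 'rV[R]_n])%E.
Proof.
rewrite -[X in (_ < X)%E]mul1e -integral_cst//.
elim: n => [|n IH]; first by rewrite integral_leb0// lte01.
rewrite (integral_lebS1 (@measurable_cst _ _ _ _ setT 1%E))//=.
rewrite integral_cst// mule_gt0//.
have := @lebesgue_measure_itv R `]-oo, +oo[; rewrite set_itvNyy/= => ->; exact: ltry.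
Qed.

Lemma lebE n (A : set 'rV[R]_n) : measurable A ->
  leb n A = (\int[leb n]_x (\1_A x)%:E)%E.
Proof. by move=> mA; rewrite integral_indic// setIT. Qed.

(** All boxes are homothetic: one null box would make all boxes around 0 null, and with them the
    whole space. *)
Lemma leb_box_gt0 n (z : 'rV[R]_n) r : 0 < r -> (0 < leb n (box z r))%E.
Proof.
move=> r0; rewrite lt0e measure_ge0 andbT; apply/eqP => b0.
have k0 k : leb n (box (0 : 'rV[R]_n) k.+1%:R) = 0%E.
  pose a : R := k.+1%:R / r.
  have a0 : 0 < a by rewrite divr_gt0// ltr0n.
  rewrite lebE; last exact: measurable_box.
  rewrite -(@integral_homothety _ n a (- (a *: z))) //; last by left.
  rewrite (_ : integral _ _ _ = \int[leb n]_v (\1_(box z r) v)%:E)%E; last first.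
    apply: eq_integral => v _; rewrite !indicE; congr (_%:R%:E); congr (nat_of_bool _).
    apply/idP/idP; rewrite !inE => vz j; have := vz j; rewrite !mxE.
      rewrite subr0 -mulrBr normrM gtr0_norm// mulrC -ltr_pdivlMr//.
      by rewrite /a invf_div mulrCA mulfV ?mulr1// pnatr_eq0.
    rewrite subr0 -mulrBr normrM gtr0_norm// mulrC -ltr_pdivlMr//.
    by rewrite /a invf_div mulrCA mulfV ?mulr1// pnatr_eq0.
  by rewrite -lebE ?b0 ?mule0//; exact: measurable_box.
have : leb n [set: 'rV[R]_n] = 0%E.
  apply/eqP; rewrite -measure_le0.
  rewrite (_ : setT = \bigcup_k box (0 : 'rV[R]_n) k.+1%:R); last first.
    apply/seteqP; split=> // w _.
    exists (Num.truncn `|w|) => // j; rewrite mxE subr0.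
    by apply: le_lt_trans (truncnS_gt _); rewrite [leRHS]mx_normrE (le_bigmax _ _ (0, j)).
  have /negligibleP : (leb n).-negligible (\bigcup_k box (0 : 'rV[R]_n) k.+1%:R).
    by apply: negligible_bigcup => k; apply/negligibleP; [exact: measurable_box|exact: k0].
  by move=> ->//; apply: bigcupT_measurable => k; exact: measurable_box.
by apply/eqP; rewrite gt_eqF// leb_setT_gt0.
Qed.

Lemma measurable_hyperplane n (c : 'cV[R]_n) :
  measurable [set z : 'rV[R]_n | z *m c = 0].
Proof.
have mc : measurable_fun [set: 'rV[R]_n] (fun z => z *m c).
  by under eq_fun do rewrite -[_ *m c]addr0; apply: measurable_fun_affine; exact: measurable_id.
have := measurableT_comp (measurable_coord 0) mc.
move=> /(_ measurableT _ (measurable_set1 0)); rewrite setTI.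
congr measurable; apply/seteqP; split=> z /= zc; last by rewrite zc mxE.
by apply/rowP => j; rewrite ord1 zc mxE.
Qed.

Lemma leb_hyperplane n (c : 'cV[R]_n) : c != 0 ->
  leb n [set z : 'rV[R]_n | z *m c = 0] = 0%E.
Proof.
move=> c0.
have mN := measurable_hyperplane c.
rewrite lebE//.
case: n c c0 mN => [|n] c c0 mN; first by case/eqP: c0; apply/colP => -[].
(* Since c^T is a scalar times the first unit row times [E], the transposed inverse of [E] sends [c]
   to a multiple of the first unit column: the hyperplane becomes the set where the first coordinate
   is 0. *)
pose E := row_ebase c^T.
have uE : E \in unitmx by rewrite row_ebase_unit.
pose M := (invmx E)^T.
have uM : M \in unitmx by rewrite unitmx_tr unitmx_inv.
have [a a0 Mc] : exists2 a : R, a != 0 & M *m c = a *: delta_mx 0 0.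
  pose a := (col_ebase c^T) 0 0; exists a.
    by have := col_ebase_unit c^T; rewrite unitmxE unitfE det_mx11.
  rewrite -[c in LHS]trmxK -trmx_mul -[c^T]mulmx_ebase -/E mulmxK//.
  rewrite rank_rV; have -> : c^T != 0 by rewrite -[0]trmx0 (inj_eq (can_inj (@trmxK _ _ _))).
  apply/colP => j; rewrite !mxE big_ord1 !mxE /= !andbT.
  by rewrite -[j == 0]val_eqE eq_sym.
rewrite -(@integral_affine _ n.+1 M 0)//; last by rewrite -unitfE -unitmxE.
rewrite (_ : integral _ _ _ = \int[leb n.+1]_v (\1_[set v | v 0 0 = 0] v)%:E)%E; last first.
  apply: eq_integral => v _; rewrite addr0 !indicE; congr (_%:R%:E); congr (nat_of_bool _).
  have vMc : (v *m M *m c) = a *: (v 0 0)%:M.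
    rewrite -mulmxA Mc -scalemxAr; congr (_ *: _).
    apply/rowP => j; rewrite !ord1 -colE !mxE eqxx mulr1n//.
  apply/idP/idP; rewrite !inE/= vMc.
    by move/rowP/(_ 0)/eqP; rewrite !mxE eqxx mulr1n mulf_eq0 (negbTE a0) => /eqP.
  by move=> ->; rewrite raddf0 scaler0.
have mv : measurable [set v : 'rV[R]_n.+1 | v 0 0 = 0].
  have := @measurable_coord R n.+1 0 measurableT _ (measurable_set1 0).
  by rewrite setTI.
rewrite integral_lebS2//; last first.
  by apply/measurable_EFinP; exact: measurable_indic.
rewrite integral0_eq ?mule0// => v _.
rewrite (_ : (fun x => _) = (fun x => (\1_[set 0 : measurableTypeR R] x)%:E)); last first.
  apply/funext => x; rewrite !indicE; congr (_%:R%:E); congr (nat_of_bool _).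
  by apply/idP/idP; rewrite !inE/= mxE; case: splitP => // j _; rewrite ord1 mxE eqxx mulr1n.
by rewrite integral_indic// setIT; exact: lebesgue_measure_set1.
Qed.

End volume.

(** * A convex set lies in a hyperplane or contains a box *)

Section convex_interior.
Context {R : realType} {n : nat}.
Implicit Types (A : set 'rV[R]_n).

(** Convexity with real weights, placed as in [log_concave]; [convex_setP] identifies it with
    [convex_set]. *)
Definition segment_closed A := forall (x y : 'rV[R]_n) (l : R),
  0 <= l <= 1 -> A x -> A y -> A ((1 - l) *: x + l *: y).

(** As [A] contains 0, the missing weight can be put there: a partial sum of total weight at most
    [t] is [t] times a point of [A]. *)
Lemma segment_closed_sum A k (s : 'I_k -> R) (v : 'I_k -> 'rV[R]_n) :
  segment_closed A -> A 0 -> (forall j, 0 <= s j) -> \sum_j s j <= 1 ->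
  (forall j, A (v j)) -> A (\sum_j s j *: v j).
Proof.
move=> cA A0 s0 s1 vA.
suff H (r : seq 'I_k) t : \sum_(j <- r) s j <= t ->
    exists2 a, A a & \sum_(j <- r) s j *: v j = t *: a.
  by have [a Aa ->] := H _ _ s1; rewrite scale1r.
elim: r t => [|i r IH] t; first by rewrite !big_nil => _; exists 0; rewrite ?scaler0.
rewrite !big_cons => st.
have [|a Aa ->] := IH (t - s i); first by rewrite lerBrDl.
have := sumr_ge0 r (fun j _ => s0 j) => /(_ xpredT) sr0.
have ti : 0 <= s i <= t by rewrite s0/=; apply: le_trans st; rewrite lerDl.
have [t0|t0] := eqVneq t 0.
  have -> : s i = 0 by apply/eqP; rewrite eq_le; case/andP: ti => ->; rewrite t0 => ->.
  by exists a => //; rewrite scale0r add0r subr0.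
have tp : 0 < t by rewrite lt_neqAle eq_sym t0; case/andP: ti; exact: le_trans.
exists ((1 - s i / t) *: a + (s i / t) *: v i).
  by apply: cA => //; rewrite divr_ge0 ?(ltW tp)//= ler_pdivrMr// mul1r; case/andP: ti.
by rewrite scalerDr !scalerA mulrBr mulr1 mulrC divfK// addrC.
Qed.

Lemma box_in_simplex (M : 'M[R]_n) : M \in unitmx ->
  exists (z0 : 'rV[R]_n) (r : R), 0 < r /\
  forall z, box z0 r z -> exists s : 'rV[R]_n,
    [/\ forall j, 0 <= s 0 j, \sum_j s 0 j <= 1 & z = s *m M].
Proof.
move=> uM; pose N := invmx M.
(* Coordinates within [e] of [e] lie in [0, 2e], and n of them add up to less than 1. Dividing the
   radius by [D], which dominates the inverse matrix, keeps the coordinates that close. *)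
pose e : R := (2 * n.+1%:R)^-1.
have e0 : 0 < e by rewrite invr_gt0 mulr_gt0.
pose D : R := 1 + \sum_k \sum_j `|N k j|.
have D0 : 0 < D.
  by rewrite ltr_pwDl// sumr_ge0// => k _; rewrite sumr_ge0.
pose b : 'rV[R]_n := const_mx e.
exists (b *m M), (e / D); split; first by rewrite divr_gt0.
move=> z zr; exists (z *m N).
have dz j : `|(z *m N) 0 j - e| <= e.
  have -> : (z *m N) 0 j - e = \sum_k (z 0 k - (b *m M) 0 k) * N k j.
    have -> : e = (b *m M *m N) 0 j by rewrite mulmxK// mxE.
    by rewrite !mxE -sumrB; apply: eq_bigr => k _; rewrite mulrBl.
  apply: le_trans (ler_norm_sum _ _ _) _.
  apply: (@le_trans _ _ (\sum_k (e / D) * `|N k j|)).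
    by apply: ler_sum => k _; rewrite normrM ler_wpM2r// ltW// zr.
  rewrite -mulr_sumr -mulrA ler_piMr ?(ltW e0)// mulrC ler_pdivrMr// mul1r.
  rewrite /D (@le_trans _ _ (\sum_k \sum_j `|N k j|)) ?lerDr//.
  apply: ler_sum => k _; rewrite (bigD1 j)//= lerDl sumr_ge0//.
split.
- move=> j; have := dz j; rewrite ler_distl => /andP[+ _]; by rewrite subrr.
- apply: (@le_trans _ _ (\sum_(j < n) (e + e))).
    by apply: ler_sum => j _; have := dz j; rewrite ler_distl => /andP[].
  rewrite sumr_const card_ord -mulr2n -mulrnA -[leLHS]mulr_natl ler_pdivrMr ?mulr_gt0//.
  by rewrite mul1r -natrM ler_nat leq_mul2l leqnSn orbT.
by rewrite mulmxKV.
Qed.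

(** An independent family in [A] of maximal size is either a basis or spans a proper subspace that
    contains [A]. *)
Lemma hyperplane_or_basis A : (exists2 c : 'cV[R]_n, c != 0 &
    forall z, A z -> z *m c = 0) \/
  exists2 M : 'M[R]_n, M \in unitmx & forall j, A (row j M).
Proof.
pose P k := `[< exists2 M : 'M[R]_(k, n), row_free M & forall j, A (row j M) >].
have P0 : exists k, P k.
  exists 0; apply/asboolP; exists 0 => [|[]//].
  by rewrite /row_free mxrank0.
have Pn k : P k -> (k <= n)%N.
  by move=> /asboolP[M /eqP fM _]; rewrite -fM; exact: rank_leq_col.
case: (ex_maxnP P0 Pn) => k /asboolP[M fM MA] kmax.
have [kn|kn] := eqVneq k n.
  by subst k; right; exists M => //; rewrite -row_free_unit.
have {}kn : (k < n)%N by rewrite ltn_neqAle kn Pn//; apply/asboolP; exists M.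
left; have : kermx M^T != 0.
  by rewrite -mxrank_eq0 mxrank_ker mxrank_tr (eqP fM) subn_eq0 -ltnNge.
case/rowV0Pn => u /sub_kermxP uM u0.
exists u^T; first by rewrite -[0]trmx0 (inj_eq (can_inj (@trmxK _ _ _))).
move=> z Az; have zM : (z <= M)%MS.
  apply/negPn/negP => zM; suff /kmax : P k.+1 by rewrite ltnn.
  apply/asboolP; exists (col_mx z M : 'M[R]_(1 + k, n)).
    rewrite -row_leq_rank (@leq_trans (\rank M).+1)//; first by rewrite (eqP fM).
    have -> : \rank (col_mx z M) = \rank (z + M)%MS by rewrite addsmxE.
    rewrite rank_ltmx// ltmxE addsmxSr; apply: contra zM.
    by apply: submx_trans; exact: addsmxSl.
  move=> j; rewrite -(@splitK 1 k j); case: (@fintype.split 1 k j) => l /=.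
    by rewrite (@rowKu _ 1) ord1 (_ : row 0 z = z)//; apply/rowP => m; rewrite mxE.
  by rewrite (@rowKd _ 1).
have /submxP[d ->] := zM.
by rewrite -mulmxA -[M]trmxK -trmx_mul uM trmx0 mulmx0.
Qed.

(** The box lies in every convex set containing 0 and the rows of [M]. This allows passing from the
    support of a function to one of its superlevel sets, where it has a positive lower bound. *)
Lemma convex_hyperplane_or_box A : segment_closed A -> A 0 ->
  (exists2 c : 'cV[R]_n, c != 0 & forall z, A z -> z *m c = 0) \/
  exists (z0 : 'rV[R]_n) (r : R), 0 < r /\ exists M : 'M[R]_n,
    (forall j, A (row j M)) /\ forall B, segment_closed B -> B 0 ->
      (forall j, B (row j M)) -> box z0 r `<=` B.
Proof.
move=> cA A0; have [|[M uM MA]] := hyperplane_or_basis A; [by left|right].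
have [z0 [r [r0 zr]]] := box_in_simplex uM.
exists z0, r; split => //; exists M; split => // B cB B0 MB z /zr[s [s0 s1 ->]].
by rewrite mulmx_sum_row; exact: segment_closed_sum.
Qed.

End convex_interior.

(** * Log-concave functions and their Borel majorants *)

Section log_concave_basics.
Context {R : realType}.

(** This is the factor lost in a contraction of ratio 1 - e towards a box where the function is at
    least [c]; it is continuous in [e] with value 1 at e = 0. *)
Lemma contraction_factor_near1 (c tau : R) (k : nat) : 0 < c -> tau < 1 ->
  exists2 e0 : R, 0 < e0 < 1 &
    forall e, 0 < e <= e0 -> tau < (1 - e) ^+ k * c `^ e.
Proof.
move=> c0 tau1; pose F (e : R) := (1 - e) ^+ k * expR (e * ln c).
have cF : {for 0, continuous F}.
  apply: continuousM.
    apply: (@continuous_comp _ _ _ (fun e : R => 1 - e) (fun x => x ^+ k)).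
      by apply: continuousB; [exact: cvg_cst|exact: cvg_id].
    exact: exprn_continuous.
  apply: (@continuous_comp _ _ _ (fun e : R => e * ln c) expR).
    by apply: continuousM; [exact: cvg_id|exact: cvg_cst].
  exact: continuous_expR.
have F0 : F 0 = 1 by rewrite /F subr0 expr1n mul0r expR0 mulr1.
have /nbhs_ballP[d /= d0 dF] : \forall e \near (0 : R), tau < F e.
  by apply: (cvgr_gt _ cF); rewrite F0.
exists (Num.min (d / 2) (1 / 2)).
  rewrite lt_min !divr_gt0//= gt_min; apply/orP; right.
  by rewrite ltr_pdivrMr// mul1r ltrDl.
move=> e /andP[e0]; rewrite le_min => /andP[ed _].
have := dF e; rewrite /ball/= sub0r normrN gtr0_norm// /F.
rewrite /powR (gt_eqF c0); apply.
by apply: le_lt_trans ed _; rewrite ltr_pdivrMr// ltr_pMr// ltrDl.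
Qed.

Context {n : nat} (f : 'rV[R]_n -> R).
Hypotheses (f0 : forall x, 0 <= f x) (flc : log_concave f).

Lemma log_concave_ge (x y : 'rV[R]_n) (l a b : R) : 0 <= l <= 1 ->
  0 <= a -> 0 <= b -> a <= f x -> b <= f y ->
  a `^ (1 - l) * b `^ l <= f ((1 - l) *: x + l *: y).
Proof.
move=> /andP[l0 l1] a0 b0 ax by_; apply: le_trans (flc _ _ _); last by rewrite l0.
apply: ler_pM; rewrite ?powR_ge0//; apply: ge0_ler_powR; rewrite ?nnegrE ?subr_ge0//.
Qed.

Lemma superlevel_segment_closed (c : R) : segment_closed [set x | c <= f x].
Proof.
move=> x y l l01 /= cx cy; have [c0|c0] := leP c 0; first exact: le_trans c0 _.
have := log_concave_ge l01 (ltW c0) (ltW c0) cx cy.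
by rewrite -powRD ?subrK ?powRr1// ?(ltW c0)//; apply/implyP; rewrite gt_eqF.
Qed.

Lemma support_segment_closed : segment_closed [set x | 0 < f x].
Proof.
move=> x y l l01 /= fx fy; apply: (@lt_le_trans _ _ (Num.min (f x) (f y))).
  by rewrite lt_min fx fy.
by apply: superlevel_segment_closed => //=; rewrite ge_min lexx ?orbT.
Qed.

Lemma log_concave_hyperplane_or_box : 0 < f 0 ->
  (exists2 c : 'cV[R]_n, c != 0 & forall z, 0 < f z -> z *m c = 0) \/
  exists (z0 : 'rV[R]_n) (r c : R),
    [/\ 0 < r, 0 < c & forall z, box z0 r z -> c <= f z].
Proof.
move=> f00; have [|] := convex_hyperplane_or_box support_segment_closed f00; first by left.
move=> [z0 [r [r0 [M [fM MB]]]]]; right.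
pose c := \big[Num.min/f 0]_j f (row j M).
exists z0, r, c; split=> //; first by apply/bigmin_gtP; split=> // j _; exact: fM.
apply: (MB [set x | c <= f x]) => /=; first exact: superlevel_segment_closed.
  exact: bigmin_le_id.
by move=> j; exact: bigmin_le.
Qed.

Hypothesis fmax : forall x, f x <= f 0.

(* [h] is, up to a factor close to 1, the supremal convolution of [f] with the
   indicator of a small box, moved back by the inverse contraction. This avoids
   showing that boundaries of convex sets are null. *)
Lemma borel_majorant (d : R) : 0 < d ->
  exists h : 'rV[R]_n -> \bar R, [/\ measurable_fun setT h,
    (forall x, (f x)%:E <= h x)%E &
    (\int[leb n]_x h x <= (1 + d)%:E * \int[leb n]_x (f x)%:E)%E].
Proof.
move=> d0.
have If0 : (0 <= \int[leb n]_x (f x)%:E)%E by apply: integral_ge0 => x _; rewrite lee_fin.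
have [f00|f00] := eqVneq (f 0) 0.
  exists (cst 0%E); split; [exact: measurable_cst| |].
    by move=> x; rewrite lee_fin -f00.
  by rewrite integral0 mule_ge0// lee_fin addr_ge0// ltW.
have {}f00 : 0 < f 0 by rewrite lt_neqAle eq_sym f00 f0.
have [[c c0 fc]|[z0 [r [c [r0 c0 cf]]]]] := log_concave_hyperplane_or_box f00.
  (* In the degenerate case [f] vanishes off a null hyperplane, and the constant [f 0] on that
     hyperplane is a majorant of integral 0. *)
  pose N := [set z : 'rV[R]_n | z *m c = 0].
  have mN : measurable N by exact: measurable_hyperplane.
  exists (fun x => (f 0)%:E * (\1_N x)%:E)%E; split.
  - apply: emeasurable_funM; first exact: measurable_cst.
    by apply/measurable_EFinP; exact: measurable_indic.
  - move=> x; rewrite -EFinM lee_fin.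
    have [fx|fx] := ltP 0 (f x); last by apply: le_trans fx _; rewrite mulr_ge0.
    by rewrite indicE mem_set ?mulr1//; exact: fc.
  - by rewrite integralZT// -lebE// leb_hyperplane// mule0 mule_ge0// lee_fin addr_ge0// ltW.
have cf0 : c <= f 0 by apply: le_trans (fmax z0); apply: cf; exact: box_center.
have [e0 /andP[e00 e01] eP] : exists2 e0 : R, 0 < e0 < 1 & forall e, 0 < e <= e0 ->
    (1 + d)^-1 < (1 - e) ^+ n * (c / f 0) `^ e.
  apply: contraction_factor_near1; first by rewrite divr_gt0.
  by rewrite invf_lt1 ?ltrDl// addr_gt0.
have {eP} := eP e0; rewrite e00 lexx => /(_ isT); move: e0 e00 e01 => e e_gt0 e_lt1 ed.
have e01 : 0 <= e <= 1 by rewrite !ltW.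
(* If [w] is in this box, then w = (1 - e) a + e b with [b] in the box around [z0], so every element
   of [S w] is a lower bound of [f w]. The boxes being open, the supremum is lower semicontinuous in
   [w]. *)
pose S w := [set f a `^ (1 - e) * c `^ e | a in [set a | box ((1 - e) *: a + e *: z0) (e * r) w]].
pose g w := sup (S w).
have Sf w : ubound (S w) (f w).
  move=> _ [a /= aw <-].
  have -> : w = (1 - e) *: a + e *: (e^-1 *: (w - (1 - e) *: a)).
    by rewrite scalerA mulfV ?gt_eqF// scale1r addrC subrK.
  apply: log_concave_ge => //; first exact: ltW.
  apply: cf => j; have := aw j; rewrite !mxE.
  have -> : e^-1 * (w 0 j - (1 - e) * a 0 j) - z0 0 j =
      e^-1 * (w 0 j - ((1 - e) * a 0 j + e * z0 0 j)).
    by field; rewrite gt_eqF.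
  by rewrite normrM gtr0_norm ?invr_gt0// ltr_pdivrMl.
(* The supremum of the empty set is 0, which is still below [f w]. *)
have gf w : g w <= f w.
  rewrite /g; have [->|/set0P S0] := eqVneq (S w) set0; first by rewrite sup0.
  exact: ge_sup.
have Sg w x : S w x -> x <= g w.
  by move=> Swx; apply: ub_le_sup => //; exists (f w).
have g0 w : 0 <= g w.
  rewrite /g; have [->|/set0P[x Sx]] := eqVneq (S w) set0; first by rewrite sup0.
  apply: le_trans (Sg _ _ Sx); case: Sx => a _ <-.
  by rewrite mulr_ge0// powR_ge0.
have mg : measurable_fun setT (EFin \o g).
  apply: measurable_fun_lsc => a; have [a0|a0] := ltP a 0.
    rewrite (_ : mkset _ = setT); first exact: openT.
    by apply/seteqP; split => // w _ /=; exact: lt_le_trans (g0 w).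
  apply/open_boxP => w /= ag.
  have [x [b bw <-] ax] : exists2 x, S w x & a < x.
    have [E|/set0P S0] := eqVneq (S w) set0.
      by move: ag; rewrite /g E sup0 ltNge a0.
    have [||x Sx] := @sup_adherent _ (S w) (g w - a).
    - by rewrite subr_gt0.
    - by split=> //; exists (f w).
    by rewrite /g subKr => ?; exists x.
  have /open_boxP/(_ _ bw)[s s0 sw] := @open_box R n ((1 - e) *: b + e *: z0) (e * r).
  exists s => // v /sw bv; apply: lt_le_trans ax _.
  by apply: Sg; exists b.
(* This constant makes up for the two losses: c^e in the definition of [S], and f(a)^e <= f(0)^e
   when f(a) is split as f(a)^(1 - e) f(a)^e. *)
pose C := (f 0 / c) `^ e.
pose h a := (C%:E * (g ((1 - e) *: a + e *: z0))%:E)%E.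
have C0 : 0 <= C by exact: powR_ge0.
have mg' : measurable_fun [set: 'rV[R]_n] (fun a => (g ((1 - e) *: a + e *: z0))%:E).
  have := measurable_comp_affine (1 - e)%:M (e *: z0) mg.
  by under eq_fun do rewrite mul_mx_scalar.
exists h; split.
- by apply: emeasurable_funM => //; exact: measurable_cst.
- move=> a; rewrite /h -EFinM lee_fin.
  have ag : f a `^ (1 - e) * c `^ e <= g ((1 - e) *: a + e *: z0).
    by apply: Sg; exists a => //; apply: box_center; rewrite mulr_gt0.
  apply: le_trans (ler_wpM2l C0 ag).
  rewrite mulrCA /C -powRM ?divr_ge0 ?(ltW c0)// divfK ?gt_eqF//.
  apply: (@le_trans _ _ (f a `^ (1 - e) * f a `^ e)).
    by rewrite -powRD ?subrK ?powRr1//; apply/implyP; rewrite oner_eq0.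
  by rewrite ler_wpM2l ?powR_ge0// ge0_ler_powR ?nnegrE// ltW.
rewrite integralZT//; last by move=> x; rewrite lee_fin.
have -> : (\int[leb n]_x (g ((1 - e) *: x + e *: z0)%R)%:E =
    ((1 - e) ^- n)%:E * \int[leb n]_x (g x)%:E)%E.
  rewrite -(@integral_homothety _ n (1 - e) (e *: z0) (EFin \o g)).
  - by rewrite muleA -EFinM mulVf ?mul1e// expf_neq0// subr_eq0 gt_eqF.
  - by left; rewrite subr_gt0.
  - by move=> x /=; rewrite lee_fin.
rewrite muleA -EFinM; apply: lee_pmul => //.
- by rewrite lee_fin mulr_ge0// invr_ge0 exprn_ge0// subr_ge0 ltW.
- by apply: integral_ge0 => x _ /=; rewrite lee_fin.
- have e1n : 0 < (1 - e) ^+ n by rewrite exprn_gt0// subr_gt0.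
  have d1 : 0 < 1 + d by rewrite addr_gt0.
  have Cp : 0 < C by rewrite powR_gt0// divr_gt0.
  have CK : C * (c / f 0) `^ e = 1.
    rewrite /C -powRM ?divr_ge0 ?(ltW c0) ?(ltW f00)// mulrA divfK ?gt_eqF//.
    by rewrite divff ?powR1// gt_eqF.
  rewrite lee_fin ler_pdivrMr// ltW//.
  move: ed; rewrite -(ltr_pM2l (mulr_gt0 d1 Cp)) mulrAC mulfV ?gt_eqF// mul1r.
  by rewrite mulrACA CK mulr1.
- by apply: le_integralT => x; rewrite lee_fin.
Qed.

End log_concave_basics.

(** Only real constants are moved through the lower integral; a factor that may be +oo, such as the
    integral over the orthogonal complement, is reached through the reals below it. *)
Lemma lee_scaled_approx (R : realType) (a X Y : \bar R) : (0 <= a)%E -> (0 <= X)%E ->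
  (forall r : R, 0 <= r -> (r%:E <= a)%E -> (r%:E * X <= Y)%E) -> (a * X <= Y)%E.
Proof.
move=> a0 X0 H; case: a a0 H => [r|_|//] => [r0|] H; first exact: H.
have [->|Xneq0] := eqVneq X 0%E.
  by rewrite mule0; have := H 0; rewrite mul0e; apply=> //; rewrite leey.
have Xgt0 : (0 < X)%E by rewrite lt0e Xneq0.
have [x x0 xX] : exists2 x : R, 0 < x & (x%:E <= X)%E.
  case: X Xgt0 {X0 H Xneq0} => [x|_|//]; first by rewrite lte_fin => x0; exists x.
  by exists 1 => //; exact: leey.
suff -> : Y = +oo%E by exact: leey.
apply: eq_infty => A; have [A0|A0] := leP A 0.
  apply: (@le_trans _ _ 0%E); first by rewrite lee_fin.
  by have := H 0 (lexx _) (leey _); rewrite mul0e.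
apply: le_trans (H (A / x) _ (leey _)); last by rewrite divr_ge0// ltW.
have -> : A%:E = ((A / x)%:E * x%:E)%E by rewrite -EFinM divfK// gt_eqF.
by rewrite lee_wpmul2l// lee_fin divr_ge0// ltW.
Qed.

(** * The inequality in coordinates *)

Section coordinates.
Context {R : realType} (i k n : nat) (B : 'M[R]_(i, n)) (C : 'M[R]_(k, n)).

Definition coord_proj (f : 'rV[R]_n -> R) (x : 'rV[R]_i) : R :=
  sup (range (fun y : 'rV[R]_k => f (x *m B + y *m C))).

Variable f : 'rV[R]_n -> R.
Hypotheses (f0 : forall x, 0 <= f x) (flc : log_concave f).
Hypothesis fmax : forall x, f x <= f 0.

Lemma coord_proj_ge x y : f (x *m B + y *m C) <= coord_proj f x.
Proof. by apply: ub_le_sup; [exists (f 0) => _ [w _ <-]|exists y]. Qed.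

Lemma coord_proj_le x a : (forall y, f (x *m B + y *m C) <= a) -> coord_proj f x <= a.
Proof. by move=> fa; apply: ge_sup; [exists (f (x *m B + 0 *m C)), 0|move=> _ [y _ <-]]. Qed.

Lemma coord_proj_ge0 x : 0 <= coord_proj f x.
Proof. exact: le_trans (coord_proj_ge x 0). Qed.

Variable l : R.
Hypothesis l01 : 0 <= l <= 1.

Local Notation Iq := (\int[leb k]_y (f (y *m C) `^ l)%:E)%E.

(** The factor [l ^+ k] is the Jacobian of w -> l w + (1 - l) y in the fibre over (1 - l) x. *)
Lemma fiber_integral_ge x y : 0 < l \/ k = 0 ->
  ((l ^+ k)%:E * ((f (x *m B + y *m C) `^ (1 - l))%:E * Iq) <=
   \int[leb k]_w (f (((1 - l) *: x) *m B + w *m C))%:E)%E.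
Proof.
move=> lk; have [l0 l1] := andP l01.
rewrite -[X in (_ <= X)%E](@integral_homothety _ k l ((1 - l) *: y))//; last first.
  by move=> w; rewrite lee_fin.
rewrite lee_wpmul2l// ?lee_fin ?exprn_ge0//.
rewrite -integralZT//; last 2 first.
- by move=> w; rewrite lee_fin powR_ge0.
- exact: powR_ge0.
apply: le_integralT => w; first by rewrite -EFinM lee_fin mulr_ge0// powR_ge0.
rewrite -EFinM lee_fin; apply: le_trans (flc _ _ _) _ => //.
by rewrite scalerDr -!scalemxAl mulmxDl -!scalemxAl addrAC addrA.
Qed.

(** The supremum over the fibre is approached rather than attained: the claim is proved up to every
    factor r < 1, using r <= r^(1 - l). *)
Lemma fiber_integral_ge_proj x : 0 < l \/ k = 0 ->
  ((l ^+ k)%:E * ((coord_proj f x `^ (1 - l))%:E * Iq) <=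
   \int[leb k]_w (f (((1 - l) *: x) *m B + w *m C))%:E)%E.
Proof.
move=> lk; have [l0 l1] := andP l01.
have Iq0 : (0 <= Iq)%E by apply: integral_ge0 => w _; rewrite lee_fin powR_ge0.
have [P0|P0] := eqVneq (coord_proj f x) 0.
  apply: le_trans (fiber_integral_ge x 0 lk).
  rewrite P0 (_ : f (x *m B + 0 *m C) = 0)//.
  by apply/eqP; rewrite eq_le f0 andbT -[leRHS]P0 coord_proj_ge.
have {}P0 : 0 < coord_proj f x by rewrite lt_neqAle eq_sym P0 coord_proj_ge0.
apply/lee_mul01Pr.
  by rewrite !mule_ge0// lee_fin ?exprn_ge0// powR_ge0.
move=> r /andP[r0 r1].
have [_ [y _ <-] ry] : exists2 z, range (fun y => f (x *m B + y *m C)) z & r * coord_proj f x < z.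
  apply: sup_gt; last by rewrite gtr_pMl.
  by exists (f (x *m B + 0 *m C)), 0.
apply: le_trans (fiber_integral_ge x y lk).
rewrite muleCA lee_wpmul2l ?lee_fin ?exprn_ge0// muleA lee_wpmul2r//.
rewrite -EFinM lee_fin.
apply: (@le_trans _ _ ((r * coord_proj f x) `^ (1 - l))).
  rewrite powRM ?(ltW r0) ?coord_proj_ge0// ler_wpM2r ?powR_ge0//.
  by rewrite ger1_powR ?r0 ?(ltW r1)// gerBl.
by apply: ge0_ler_powR; rewrite ?nnegrE ?subr_ge0// ?mulr_ge0 ?(ltW r0)// ltW.
Qed.

(** The right-hand side carries a majorant [h] of [f] because Tonelli will be applied to it, and [f]
    itself may fail to be Borel. *)
Lemma core_inequality (h : 'rV[R]_n -> \bar R) :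
  measurable_fun setT h -> (forall z, (f z)%:E <= h z)%E ->
  (((1 - l) ^+ i * l ^+ k)%:E *
     (\int[leb i]_x (coord_proj f x `^ (1 - l))%:E * Iq) <=
   \int[leb i]_x \int[leb k]_y h (x *m B + y *m C)%R)%E.
Proof.
move=> mh fh; have [l0 l1] := andP l01.
have h0 z : (0 <= h z)%E by apply: le_trans (fh z); rewrite lee_fin.
have Iq0 : (0 <= Iq)%E by apply: integral_ge0 => w _; rewrite lee_fin powR_ge0.
have P0 x : (0 <= (coord_proj f x `^ (1 - l))%:E)%E by rewrite lee_fin powR_ge0.
have IP0 : (0 <= \int[leb i]_x (coord_proj f x `^ (1 - l))%:E)%E by exact: integral_ge0.
have M0 x : (0 <= \int[leb k]_y h (x *m B + y *m C)%R)%E by exact: integral_ge0.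
(* If the constant is 0 the claim is trivial. Otherwise each ratio is positive or acts in dimension
   0, so both homotheties are legitimate. *)
have [c0|] := eqVneq ((1 - l) ^+ i * l ^+ k) 0.
  by rewrite c0 mul0e; exact: integral_ge0.
rewrite mulf_eq0 negb_or !expf_eq0 !negb_and -!leqNgt !leqn0 => /andP[li lk].
have {}li : 0 < 1 - l \/ i = 0.
  by case/orP: li => [/eqP|li]; [right|left; rewrite lt_neqAle eq_sym li subr_ge0].
have {}lk : 0 < l \/ k = 0.
  by case/orP: lk => [/eqP|lk]; [right|left; rewrite lt_neqAle eq_sym lk].
rewrite EFinM -muleA -[X in (_ <= X)%E](@integral_homothety _ i (1 - l) 0)//.
rewrite lee_wpmul2l ?lee_fin ?exprn_ge0 ?subr_ge0//.
rewrite [X in (_ * X <= _)%E]muleC muleCA.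
apply: lee_scaled_approx => //; first by rewrite mule_ge0// lee_fin exprn_ge0.
move=> r r0 rI; rewrite -integralZT ?exprn_ge0// -integralZT//; last first.
  by move=> x; rewrite mule_ge0// lee_fin exprn_ge0.
apply: le_integralT => x.
  by rewrite !mule_ge0// lee_fin exprn_ge0.
apply: (@le_trans _ _ ((l ^+ k)%:E * ((coord_proj f x `^ (1 - l))%:E * Iq))%E).
  rewrite muleCA lee_wpmul2l ?lee_fin ?exprn_ge0// muleC lee_wpmul2l//.
apply: le_trans (fiber_integral_ge_proj x lk) _.
apply: le_integralT => w; first by rewrite lee_fin.
by rewrite addr0.
Qed.

End coordinates.

(** * Subspaces, their bases and the inequality *)

Section subspaces.
Context {R : realType}.

Lemma mulmx_tr_eq0 n (u : 'rV[R]_n) : u *m u^T = 0 -> u = 0.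
Proof.
move=> /matrixP/(_ 0 0)/eqP; rewrite !mxE psumr_eq0 => [/allP u0|j _]; last first.
  by rewrite mxE -expr2 sqr_ge0.
apply/rowP => j; have := u0 j; rewrite mem_index_enum !mxE -expr2 sqrf_eq0.
by move=> /(_ isT)/eqP.
Qed.

Lemma det_gram_neq0 m n (B : 'M[R]_(m, n)) : row_free B -> \det (B *m B^T) != 0.
Proof.
move=> fB; rewrite -unitfE -unitmxE -row_free_unit -kermx_eq0.
apply/negPn/negP => /rowV0Pn[u /sub_kermxP uB /negP]; apply.
have : (u *m B) *m (u *m B)^T = 0 by rewrite trmx_mul !mulmxA -[u *m B *m _]mulmxA uB mul0mx.
by move/mulmx_tr_eq0/eqP; rewrite mulmx_free_eq0.
Qed.

Context {n : nat} (H : 'M[R]_n).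

Lemma rank_orth_compl : (\rank H + \rank (orth_compl H))%N = n.
Proof. by rewrite mxrank_ker mxrank_tr subnKC// rank_leq_row. Qed.

Lemma row_base_orth : row_base H *m (row_base (orth_compl H))^T = 0.
Proof.
have /submxP[D ->] : (row_base H <= H)%MS by rewrite eq_row_base.
have : (row_base (orth_compl H) <= kermx H^T)%MS by rewrite eq_row_base.
move: (row_base (orth_compl H)) => C /sub_kermxP CH.
suff -> : D *m H *m C^T = D *m (C *m H^T)^T.
  by rewrite CH trmx0 mulmx0.
by rewrite trmx_mul trmxK mulmxA.
Qed.

Lemma sub_row_baseP m (A : 'M[R]_(m, n)) (v : 'rV[R]_n) :
  reflect (exists y, v = y *m row_base A) (v <= A)%MS.
Proof.
apply: (iffP idP) => [|[y ->]].
  by rewrite -(eq_row_base A) => /submxP.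
by rewrite -(eq_row_base A) submxMl.
Qed.

Lemma proj_funE (f : 'rV[R]_n -> R) (x : 'rV[R]_(\rank H)) :
  proj_fun H f (x *m row_base H) =
  coord_proj (row_base H) (row_base (orth_compl H)) f x.
Proof.
congr sup; apply/seteqP; split=> [_ [z /= /sub_row_baseP[y zy] <-]|_ [y _ <-]].
  by exists y => //; rewrite -zy addrC subrK.
exists (x *m row_base H + y *m row_base (orth_compl H)) => //=.
by apply/sub_row_baseP; exists y; rewrite addrC addKr.
Qed.

End subspaces.

Definition gram_vol (R : realType) m n (A : 'M[R]_(m, n)) : R :=
  Num.sqrt (\det (A *m A^T)).

Lemma gram_vol_gt0 (R : realType) m n (A : 'M[R]_(m, n)) : row_free A -> 0 < gram_vol A.
Proof.
by move=> fA; rewrite sqrtr_gt0 lt_neqAle eq_sym det_gram_neq0//= det_gram_ge0.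
Qed.

Section orthogonal_coordinates.
Context {R : realType} (i k n : nat) (B : 'M[R]_(i, n)) (C : 'M[R]_(k, n)).
Hypotheses (ikn : (i + k)%N = n) (BC : B *m C^T = 0).
Hypotheses (fB : row_free B) (fC : row_free C).

Lemma integral_coords (g : 'rV[R]_n -> \bar R) :
  measurable_fun setT g -> (forall x, 0 <= g x)%E ->
  (\int[leb n]_z g z = (gram_vol B * gram_vol C)%:E *
    \int[leb i]_x \int[leb k]_y g (x *m B + y *m C)%R)%E.
Proof.
move=> mg g0; rewrite EFinM -muleA.
by rewrite (integral_orthogonal_sum mg g0 ikn BC)// det_gram_neq0.
Qed.

Lemma coord_inequality (f : 'rV[R]_n -> R) (l : R) :
  (forall x, 0 <= f x) -> log_concave f -> (forall x, f x <= f 0) -> 0 <= l <= 1 ->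
  (((1 - l) ^+ i * l ^+ k)%:E *
     ((gram_vol B)%:E * \int[leb i]_x (coord_proj B C f x `^ (1 - l))%:E) *
     ((gram_vol C)%:E * \int[leb k]_y (f (y *m C) `^ l)%:E) <=
   \int[leb n]_x (f x)%:E)%E.
Proof.
move=> f0 flc fmax l01; have [l0 l1] := andP l01.
set IP := (\int[leb i]_x _)%E; set Iq := (\int[leb k]_y _)%E.
have IP0 : (0 <= IP)%E by apply: integral_ge0 => x _; rewrite lee_fin powR_ge0.
have Iq0 : (0 <= Iq)%E by apply: integral_ge0 => x _; rewrite lee_fin powR_ge0.
have c0 : 0 <= (1 - l) ^+ i * l ^+ k by rewrite mulr_ge0// exprn_ge0// subr_ge0.
have -> : (((1 - l) ^+ i * l ^+ k)%:E * ((gram_vol B)%:E * IP) * ((gram_vol C)%:E * Iq) =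
    (gram_vol B * gram_vol C)%:E * (((1 - l) ^+ i * l ^+ k)%:E * (IP * Iq)))%E.
  rewrite [in RHS]EFinM -!muleA muleCA; congr (_ * _)%E.
  by rewrite [RHS]muleCA; congr (_ * _)%E; rewrite muleCA.
have v0 : 0 < gram_vol B * gram_vol C by rewrite mulr_gt0// gram_vol_gt0.
apply/lee_mul01Pr; first by rewrite !mule_ge0// lee_fin ltW.
move=> r /andP[r0 r1].
(* With d = 1/r - 1 the majorant loses the factor 1 + d = 1/r, which [r] cancels. *)
have d0 : 0 < r^-1 - 1 by rewrite subr_gt0 invf_gt1.
have [h [mh fh hf]] := borel_majorant f0 flc fmax d0.
have h0 z : (0 <= h z)%E by apply: le_trans (fh z); rewrite lee_fin.
apply: (@le_trans _ _ (r%:E * \int[leb n]_x h x)%E).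
  rewrite lee_wpmul2l// ?lee_fin ?(ltW r0)// integral_coords//.
  by rewrite lee_wpmul2l// ?lee_fin ?(ltW v0)// core_inequality.
by rewrite -lee_pdivlMl//; move: hf; rewrite addrC subrK.
Qed.

End orthogonal_coordinates.

(** * Semicontinuity, and from almost everywhere to everywhere *)

Section affine_topology.
Context {R : realType}.

Lemma open_preimage_affine m n (M : 'M[R]_(m, n)) (b : 'rV[R]_n) (U : set 'rV[R]_n) :
  open U -> open [set v | U (v *m M + b)].
Proof.
move=> /open_boxP oU; apply/open_boxP => v /= /oU[r r0 rU].
pose D : R := 1 + \sum_k \sum_j `|M k j|.
have D0 : 0 < D by rewrite ltr_pwDl// sumr_ge0// => k _; rewrite sumr_ge0.
exists (r / D); first by rewrite divr_gt0.
move=> w vw; apply: rU => j; rewrite !mxE opprD addrACA subrr addr0 -sumrB.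
apply: le_lt_trans (ler_norm_sum _ _ _) _.
apply: (@le_lt_trans _ _ (\sum_k (r / D) * `|M k j|)).
  by apply: ler_sum => k _; rewrite -mulrBl normrM ler_wpM2r// ltW// vw.
rewrite -mulr_sumr -mulrA gtr_pMr// mulrC ltr_pdivrMr// mul1r.
rewrite /D (@le_lt_trans _ _ (\sum_k \sum_j `|M k j|)) ?ltrDr//.
by apply: ler_sum => k _; rewrite (bigD1 j)//= lerDl sumr_ge0.
Qed.

Lemma continuous_mulmxr m n (M : 'M[R]_(m, n)) :
  continuous (fun v : 'rV[R]_m => v *m M).
Proof.
apply/continuousP => U oU.
have := @open_preimage_affine _ _ M 0 _ oU.
by congr open; apply/seteqP; split => v /=; rewrite addr0.
Qed.

(** Without a maximum the open sets where g < g(y), for [y] in [K], cover [K]; among the finitely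
    many [y] of a subcover, one with the largest value is left uncovered. *)
Lemma usc_attains n (K : set 'rV[R]_n) (g : 'rV[R]_n -> R) :
  compact K -> K !=set0 -> (forall a, open [set x | g x < a]) ->
  exists2 x, K x & forall y, K y -> g y <= g x.
Proof.
move=> cK [x0 Kx0] og; apply: contrapT => /forall2NP H.
have {}H x : K x -> exists2 y, K y & g x < g y.
  move=> Kx; have [//|/existsNP[y /not_implyP[Ky /negP]]] := H x.
  by rewrite -ltNge; exists y.
move: cK; rewrite compact_cover.
have oD y : K y -> open [set x | g x < g y] by [].
move=> /(_ _ K (fun y => [set x | g x < g y]) oD)[].
  by move=> x /H[y Ky xy]; exists y.
move=> D DK Dc.
have argmax (s : seq 'rV[R]_n) : s != [::] ->
    exists2 y0, y0 \in s & forall y, y \in s -> g y <= g y0.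
  elim: s => // y [|y' s] IH _.
    by exists y => [|z]; rewrite !inE// => /eqP->.
  have [//|y0 y0s y0max] := IH; have [yy0|/ltW yy0] := leP (g y) (g y0).
    exists y0; first by rewrite inE y0s orbT.
    by move=> z; rewrite inE => /predU1P[->//|]; exact: y0max.
  exists y; first by rewrite inE eqxx.
  move=> z; rewrite inE => /predU1P[->//|/y0max/le_trans]; exact.
have [y0 Dy0 y0max] : exists2 y0, y0 \in finmap.enum_fset D &
    forall y, y \in finmap.enum_fset D -> g y <= g y0.
  apply: argmax; have [y Dy _] := Dc _ Kx0.
  by have : y \in finmap.enum_fset D by []; case: (finmap.enum_fset D).
have Ky0 : K y0 by apply/set_mem/DK.
have [y Dy /= ] := Dc _ Ky0.
by rewrite ltNge y0max.
Qed.

Lemma leb_box_translate n (z : 'rV[R]_n) r : leb n (box z r) = leb n (box 0 r).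
Proof.
rewrite !lebE; [|exact: measurable_box..].
rewrite -(@integral_homothety _ n 1 z)//; last by left.
rewrite expr1n mul1e; apply: eq_integral => v _; rewrite !indicE.
congr (_%:R%:E); congr (nat_of_bool _).
by apply/idP/idP; rewrite !inE => vr j; have := vr j; rewrite !mxE mul1r addrK subr0.
Qed.

(* If [g w < h w], then [g < h] on the image of the box under a strong
   contraction towards [w], and that image has positive measure. *)
Lemma ae_le_everywhere n (h : 'rV[R]_n -> \bar R) (g : 'rV[R]_n -> R)
    (z0 : 'rV[R]_n) (r c : R) (k : nat) : 0 < r -> 0 < c ->
  (forall w v e, 0 < e < 1 -> box z0 r v ->
    (((1 - e) ^+ k * c `^ e)%:E * h w <= h ((1 - e) *: w + e *: v)%R)%E) ->
  (forall x, 0 <= h x)%E -> (forall x, 0 <= g x) ->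
  (forall a, open [set x | g x < a]) ->
  {ae leb n, forall x, (h x <= (g x)%:E)%E} ->
  forall x, (h x <= (g x)%:E)%E.
Proof.
move=> r0 c0 hc h0 g0 og [N [mN N0 sN]] w; rewrite leNgt; apply/negP => gh.
have [b gb bh] : exists2 b : R, g w < b & (b%:E <= h w)%E.
  move: gh (h0 w); case: (h w) => [y| |]// gy _; last by exists (g w + 1); rewrite ?ltrDl ?leey.
  by exists y => //; rewrite -lte_fin.
have b0 : 0 < b := le_lt_trans (g0 w) gb.
pose beta := (g w + b) / 2.
have gbeta : g w < beta by rewrite /beta; lra.
have [e0 /andP[e00 e01] eP] : exists2 e0 : R, 0 < e0 < 1 & forall e, 0 < e <= e0 ->
    beta / b < (1 - e) ^+ k * c `^ e.
  by apply: contraction_factor_near1; rewrite // ltr_pdivrMr// mul1r /beta; lra.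
have /open_boxP/(_ w gbeta)[s s0 sg] := og beta.
pose D := \sum_j `|z0 0 j - w 0 j| + r.
have D0 : 0 < D by rewrite ltr_wpDl// sumr_ge0.
(* [D] bounds the distance from [w] to the points of the box, so the contracted box stays within [s]
   of [w], where g < beta; and e <= e0 keeps the loss above beta / b, so that h > beta there. *)
pose e := Num.min e0 (s / D).
have e_gt0 : 0 < e by rewrite lt_min e00 divr_gt0.
have e_lt1 : e < 1 by rewrite (le_lt_trans _ e01)// ge_min lexx.
have eDs : e * D <= s by rewrite -ler_pdivlMr// ge_min lexx orbT.
have sub : box ((1 - e) *: w + e *: z0) (e * r) `<=` N.
  move=> u ur; apply: sN => /= ug.
  have [v uE vz] : exists2 v, u = (1 - e) *: w + e *: v & box z0 r v.
    exists (e^-1 *: (u - (1 - e) *: w)).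
      by rewrite scalerA mulfV ?gt_eqF// scale1r addrC subrK.
    move=> j; have := ur j; rewrite !mxE.
    have -> : e^-1 * (u 0 j - (1 - e) * w 0 j) - z0 0 j =
      e^-1 * (u 0 j - ((1 - e) * w 0 j + e * z0 0 j)) by field; rewrite gt_eqF.
    by rewrite normrM gtr0_norm ?invr_gt0// ltr_pdivrMl.
  have gu : g u < beta.
    apply: sg => j; rewrite uE !mxE.
    have -> : (1 - e) * w 0 j + e * v 0 j - w 0 j = e * (v 0 j - z0 0 j + (z0 0 j - w 0 j)).
      by ring.
    rewrite normrM gtr0_norm//; apply: lt_le_trans eDs; rewrite ltr_pM2l//.
    apply: le_lt_trans (ler_normD _ _) _; rewrite addrC ler_ltD//.
    by rewrite (bigD1 j)//= lerDl sumr_ge0.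
  have : (beta%:E < h u)%E.
    rewrite uE; apply: lt_le_trans (hc w v e _ vz); last by rewrite e_gt0.
    have ee : 0 < e <= e0 by rewrite e_gt0 ge_min lexx.
    apply: (@lt_le_trans _ _ (((1 - e) ^+ k * c `^ e)%:E * b%:E)%E).
      by rewrite -EFinM lte_fin -ltr_pdivrMr// eP.
    by rewrite lee_wpmul2l// lee_fin mulr_ge0 ?powR_ge0// exprn_ge0// subr_ge0 ltW.
  rewrite ltNge => /negP; apply; apply: le_trans ug _; rewrite lee_fin ltW//.
have : (leb n (box ((1 - e) *: w + e *: z0)%R (e * r)) <= 0)%E.
  by rewrite -N0; apply: le_measure => //; rewrite inE//; exact: measurable_box.
by rewrite leNgt leb_box_gt0// mulr_gt0.
Qed.

End affine_topology.

(** * Compactness of superlevel sets *)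

Section superlevel_sets.
Context {R : realType} {n : nat} (f : 'rV[R]_n -> R).
Hypotheses (f0 : forall x, 0 <= f x) (flc : log_concave f).
Hypothesis fmax : forall x, f x <= f 0.
Hypothesis fpos : (0 < \int[leb n]_x (f x)%:E)%E.

(** Otherwise [f] would vanish off a hyperplane and have integral 0. *)
Lemma log_concave_box : exists (z0 : 'rV[R]_n) (r c : R),
  [/\ 0 < r, 0 < c & forall z, box z0 r z -> c <= f z].
Proof.
have f00 : 0 < f 0.
  rewrite lt_neqAle f0 andbT eq_sym; apply: contraTneq fpos => f00.
  rewrite -leNgt (_ : (fun x => _) = cst 0%E) ?integral0//.
  by apply/funext => x; congr EFin; apply/eqP; rewrite eq_le f0 -f00 fmax.
have [[c c0 fc]|//] := log_concave_hyperplane_or_box f0 flc f00.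
pose N := [set z : 'rV[R]_n | z *m c = 0].
have mN : measurable N by exact: measurable_hyperplane.
suff : (\int[leb n]_x (f x)%:E <= 0)%E by rewrite leNgt fpos.
apply: (@le_trans _ _ (\int[leb n]_x ((f 0)%:E * (\1_N x)%:E))%E).
  apply: le_integralT => x; first by rewrite lee_fin.
  rewrite -EFinM lee_fin; have [fx|fx] := ltP 0 (f x).
    by rewrite indicE mem_set ?mulr1//; exact: fc.
  by apply: le_trans fx _; rewrite mulr_ge0.
by rewrite integralZT// -lebE// leb_hyperplane// mule0.
Qed.

Hypothesis ffin : (\int[leb n]_x (f x)%:E < +oo)%E.

(* A point of the superlevel set far from a box contained in it forces many
   disjoint translates of a smaller box in it. *)
Lemma superlevel_bounded (a : R) : 0 < a ->
  exists D : R, forall z, a <= f z -> forall j, `|z 0 j| <= D.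
Proof.
move=> a0; have [z0 [r [c [r0 c0 cf]]]] := log_concave_box.
pose m := Num.min c a.
have m0 : 0 < m by rewrite lt_min c0 a0.
have r20 : 0 < r / 2 by rewrite divr_gt0.
have [v v0 vb] : exists2 v : R, 0 < v & (v%:E <= leb n (box 0 (r / 2)))%E.
  have := @leb_box_gt0 R n 0 _ r20; case: (leb n _) => [x|_|//].
    by rewrite lte_fin => x0; exists x.
  by exists 1 => //; exact: leey.
have claim z j (N : nat) : a <= f z -> N%:R * (2 * r) <= `|z 0 j - z0 0 j| ->
    ((N%:R * (m * v))%:E <= \int[leb n]_x (f x)%:E)%E.
  move=> az; set L := `|_| => NL.
  have [->|N0] := eqVneq N 0%N.
    by rewrite mul0r; apply: integral_ge0 => x _; rewrite lee_fin.
  have L0 : 0 < L.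
    by apply: lt_le_trans NL; rewrite !mulr_gt0// ltr0n lt0n.
  pose t (p : 'I_N) : R := p%:R * r / L.
  have t0 p : 0 <= t p by rewrite divr_ge0 ?mulr_ge0// ltW.
  have t2 p : t p <= 1 / 2.
    rewrite ler_pdivrMr//; suff : p%:R * (2 * r) <= L by lra.
    apply: le_trans NL; rewrite ler_wpM2r ?mulr_ge0 ?(ltW r0)//.
    by rewrite ler_nat ltnW.
  pose F p := box ((1 - t p) *: z0 + t p *: z) (r / 2).
  have mF p : measurable (F p) by exact: measurable_box.
  have Fm p w : F p w -> m <= f w.
    move=> wp; have t1 : 0 < 1 - t p by have := t2 p; lra.
    have [b bz0 ->] : exists2 b, box z0 r b & w = (1 - t p) *: b + t p *: z.
      exists ((1 - t p)^-1 *: (w - t p *: z)); last first.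
        by rewrite scalerA mulfV ?gt_eqF// scale1r subrK.
      move=> l; have := wp l; rewrite !mxE.
      have -> : (1 - t p)^-1 * (w 0 l - t p * z 0 l) - z0 0 l =
          (1 - t p)^-1 * (w 0 l - ((1 - t p) * z0 0 l + t p * z 0 l)).
        by field; rewrite gt_eqF.
      move=> wl; rewrite normrM gtr0_norm ?invr_gt0// ltr_pdivrMl//.
      apply: lt_le_trans wl _; rewrite mulrC ler_wpM2r ?(ltW r0)//.
      by have := t2 p; lra.
    apply: (superlevel_segment_closed f0 flc) => /=.
    - by rewrite t0 -subr_ge0 ltW.
    - by rewrite ge_min cf.
    - by rewrite ge_min az orbT.
  have tF : trivIset setT F.
    apply/trivIsetP => p q _ _ pq; apply/seteqP; split=> // w [wp wq].
    have {wp} := wp j; have {wq} := wq j; rewrite !mxE.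
    set u := w 0 j => uq up.
    have : `|(t p - t q) * (z 0 j - z0 0 j)| < r.
      have -> : (t p - t q) * (z 0 j - z0 0 j) =
        (u - ((1 - t q) * z0 0 j + t q * z 0 j)) - (u - ((1 - t p) * z0 0 j + t p * z 0 j)).
        by ring.
      by apply: le_lt_trans (ler_normB _ _) _; lra.
    rewrite normrM -/L -mulrBl -mulrBl normrM normfV (gtr0_norm L0) divfK ?gt_eqF//.
    rewrite normrM (gtr0_norm r0) gtr_pMl// => pq1.
    move: pq1; rewrite ltr_norml => /andP[pq1 pq2].
    have [lt_pq|lt_qp|/val_inj eq_pq] := ltngtP p q; last by rewrite eq_pq eqxx in pq.
    - have H : p%:R + 1 <= q%:R :> R by rewrite natr1 ler_nat.
      by exfalso; clear -H pq1 pq2; lra.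
    - have H : q%:R + 1 <= p%:R :> R by rewrite natr1 ler_nat.
      by exfalso; clear -H pq1 pq2; lra.
  pose U := \big[setU/set0]_(p < N) F p.
  have mU : measurable U by apply: bigsetU_measurable.
  apply: (@le_trans _ _ (\int[leb n]_x (m%:E * (\1_U x)%:E))%E); last first.
    apply: le_integralT => x; first by rewrite mule_ge0// lee_fin ltW.
    rewrite -EFinM lee_fin indicE; have [|_] := boolP (x \in U); last by rewrite mulr0.
    by rewrite inE /U -bigcup_seq => -[p _ /Fm]; rewrite mulr1.
  rewrite integralZT ?(ltW m0)// -lebE// measure_semi_additive_ord//.
  rewrite (eq_bigr (fun=> leb n (box 0 (r / 2)))); last by move=> p _; exact: leb_box_translate.
  rewrite mulrCA EFinM lee_wpmul2l ?lee_fin ?(ltW m0)//.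
  apply: (@le_trans _ _ (\sum_(p < N) v%:E)%E); last exact: lee_sum.
  by rewrite sumEFin sumr_const card_ord mulr_natl.
have [I Ie] : exists I : R, (\int[leb n]_x (f x)%:E)%E = I%:E.
  exists (fine (\int[leb n]_x (f x)%:E)%E); rewrite fineK// ge0_fin_numE//.
  exact: ltW.
pose N := (Num.truncn (I / (m * v))).+1.
have NI : I < N%:R * (m * v) by rewrite -ltr_pdivrMr ?mulr_gt0// truncnS_gt.
exists (\sum_j `|z0 0 j| + N%:R * (2 * r)) => z az j.
rewrite -[z 0 j](subrK (z0 0 j)) addrC; apply: le_trans (ler_normD _ _) _.
apply: lerD; first by rewrite (bigD1 j)//= lerDl sumr_ge0.
rewrite leNgt; apply/negP => /ltW /(claim z j N az).
by rewrite Ie lee_fin leNgt NI.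
Qed.

Hypothesis fusc : forall a, open [set x | f x < a].

Lemma superlevel_closed (a : R) : closed [set x | a <= f x].
Proof.
rewrite (_ : mkset _ = ~` [set x | f x < a]); first exact/open_closedC/fusc.
by apply/seteqP; split => x /=; rewrite leNgt => /negP.
Qed.

Lemma superlevel_compact (a : R) : 0 < a -> compact [set x | a <= f x].
Proof.
move=> a0; apply: bounded_closed_compact; last exact: superlevel_closed.
have [D fD] := superlevel_bounded a0.
exists (Num.max 0 D); split; first exact: num_real.
move=> M; rewrite gt_max => /andP[M0 DM] z /= az.
rewrite [leLHS]mx_normrE; apply/bigmax_leP; split; first exact: ltW.
by move=> [i j] _ /=; rewrite ord1 (le_trans (fD z az j))// ltW.
Qed.

Lemma superlevel_no_ray (a : R) (v : 'rV[R]_n) : 0 < a ->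
  (forall t, 0 <= t -> a <= f (t *: v)) -> v = 0.
Proof.
move=> a0 av; have [D fD] := superlevel_bounded a0.
apply/rowP => j; rewrite [RHS]mxE; apply/eqP; apply: contraT => vj.
have D0 : 0 <= D by apply: le_trans (fD _ (av 0 (lexx _)) j).
have t0 : 0 <= (D + 1) / `|v 0 j| by rewrite divr_ge0// addr_ge0.
have := fD _ (av _ t0) j; rewrite mxE normrM (ger0_norm t0) divfK ?normr_eq0//.
by rewrite gerDl ler10.
Qed.

End superlevel_sets.

(** * Homogeneity and equality of integrals *)

Section homogeneity.
Context {R : realType}.

Lemma exists_expr_lt (mu s : R) : 0 < mu < 1 -> 0 < s -> exists j, mu ^+ j < s.
Proof.
move=> /andP[mu0 mu1] s0.
have /cvgrPdist_lt/(_ _ s0) : (fun n => mu ^+ n) @ \oo --> 0.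
  by apply: cvg_expr; rewrite gtr0_norm.
case=> j _ /(_ j (leqnn j)); rewrite /= sub0r normrN gtr0_norm ?exprn_gt0//.
by exists j.
Qed.

(* The ratios [mu ^+ j] are exact, and star-shapedness carries the equality over
   to any larger ratio. *)
Lemma homogeneous_of_one_ratio d (g : 'rV[R]_d -> R) (mu : R) : 0 < mu < 1 ->
  (forall z, 0 <= g z) ->
  (forall t z, 0 <= t <= 1 -> g z `^ t <= g (t *: z)) ->
  (forall z, g (mu *: z) = g z `^ mu) ->
  forall s z, 0 < s -> g (s *: z) = g z `^ s.
Proof.
move=> mu01 g0 gstar gmu; have /andP[mu0 mu1] := mu01.
have gmuj j z : g (mu ^+ j *: z) = g z `^ (mu ^+ j).
  elim: j => [|j IH]; first by rewrite expr0 scale1r powRr1.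
  by rewrite exprS -scalerA gmu IH -powRrM mulrC.
have small s z : 0 < s <= 1 -> g (s *: z) = g z `^ s.
  move=> /andP[s0 s1]; apply/eqP; rewrite eq_le gstar ?(ltW s0)// andbT.
  have [j js] := exists_expr_lt mu01 s0.
  have j0 : 0 < mu ^+ j by rewrite exprn_gt0.
  (* Contracting further from s z to mu^j z, where the value is known exactly, bounds g(s z) from
     above once the exponent is undone. *)
  have : g (s *: z) `^ (mu ^+ j / s) <= g z `^ (mu ^+ j).
    rewrite -gmuj.
    have -> : mu ^+ j *: z = (mu ^+ j / s) *: (s *: z) by rewrite scalerA divfK// gt_eqF.
    by apply: gstar; rewrite divr_ge0 ?(ltW j0) ?(ltW s0)//= ler_pdivrMr// mul1r ltW.
  have sj0 : 0 <= s / mu ^+ j by rewrite divr_ge0// ltW.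
  move=> /(ge0_ler_powR sj0); rewrite !nnegrE !powR_ge0 -!powRrM => /(_ isT isT).
  have -> : mu ^+ j / s * (s / mu ^+ j) = 1 by field; rewrite !gt_eqF.
  have -> : mu ^+ j * (s / mu ^+ j) = s by field; rewrite gt_eqF.
  by rewrite powRr1.
move=> s z s0; have [s1|s1] := leP s 1; first by rewrite small ?s0.
have /= := small s^-1 (s *: z); rewrite scalerA mulVf ?gt_eqF// scale1r => ->.
  by rewrite -powRrM mulVf ?gt_eqF// powRr1.
by rewrite invr_gt0 s0 invf_le1// ltW.
Qed.

Lemma usc_scale_powR d (g : 'rV[R]_d -> R) (u p b : R) :
  (forall x, 0 <= g x) -> (forall a, open [set x | g x < a]) -> 0 < p -> 0 <= b ->
  forall a, open [set x | g (u *: x) `^ p * b < a].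
Proof.
move=> g0 gusc p0 b0 a.
have [a0|a0] := leP a 0.
  rewrite (_ : mkset _ = set0); first exact: open0.
  by apply/seteqP; split=> // x /=; rewrite ltNge (le_trans a0)// mulr_ge0// powR_ge0.
have [->|bn0] := eqVneq b 0.
  rewrite (_ : mkset _ = setT); first exact: openT.
  by apply/seteqP; split=> // x _ /=; rewrite mulr0.
have {bn0}b0 : 0 < b by rewrite lt_neqAle eq_sym bn0.
have := @open_preimage_affine _ _ _ (u%:M : 'M[R]_d) 0 _ (gusc ((a / b) `^ p^-1)).
congr open; apply/seteqP; split=> x /=; rewrite ?addr0 mul_mx_scalar => ga.
  rewrite -ltr_pdivlMr//; have := @gt0_ltr_powR _ p p0 (g (u *: x)) _ _ _ ga.
  by rewrite !nnegrE g0 powR_ge0 -powRrM mulVf ?gt_eqF// powRr1 ?divr_ge0 ?ltW//; apply.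
rewrite -ltr_pdivlMr// in ga.
have := @gt0_ltr_powR _ p^-1 _ (g (u *: x) `^ p) _ _ _ ga.
rewrite invr_gt0 p0 !nnegrE powR_ge0 divr_ge0 ?ltW//.
by rewrite -powRrM mulfV ?gt_eqF// powRr1//; apply.
Qed.

(** The difference h - g is nonnegative with integral 0; finiteness of the integral of [g] is what
    allows the subtraction. *)
Lemma ae_le_of_integral_le d (T : measurableType d) (mu : {measure set T -> \bar R})
    (h : T -> \bar R) (g : T -> R) :
  measurable_fun setT h -> measurable_fun setT (EFin \o g) ->
  (forall x, 0 <= g x) -> (forall x, (g x)%:E <= h x)%E ->
  (\int[mu]_x h x <= \int[mu]_x (g x)%:E)%E ->
  (\int[mu]_x (g x)%:E < +oo)%E ->
  {ae mu, forall x, (h x <= (g x)%:E)%E}.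
Proof.
move=> mh mg g0 gh hg goo.
pose D x := (h x - (g x)%:E)%E.
have D0 x : (0 <= D x)%E by rewrite sube_ge0 ?fin_numE//; left.
have mD : measurable_fun setT D by exact: emeasurable_funB.
have Ig : (\int[mu]_x (g x)%:E)%E \is a fin_num.
  by rewrite ge0_fin_numE//; apply: integral_ge0 => x _; rewrite lee_fin.
have ID : (\int[mu]_x D x = 0)%E.
  have : (\int[mu]_x (D x + (g x)%:E) = \int[mu]_x D x + \int[mu]_x (g x)%:E)%E.
    by rewrite ge0_integralD// => x _; rewrite lee_fin.
  under eq_integral do rewrite subeK//.
  move=> E; apply/eqP; rewrite eq_le integral_ge0// andbT.
  by move: hg; rewrite E -leeBrDr// subee.
have /(ae_eq_integral_abs mu measurableT mD).1 : (\int[mu]_x `|D x| = 0)%E.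
  by under eq_integral do rewrite gee0_abs//.
apply: filterS => x /= /(_ I) Dx.
by rewrite -sube_le0 -/(D x) Dx.
Qed.

End homogeneity.

(** * Orthogonal coordinates and maxima over fibres *)

Section orthogonal_projections.
Context {R : realType} (i k n : nat) (B : 'M[R]_(i, n)) (C : 'M[R]_(k, n)).
Hypotheses (ikn : (i + k)%N = n) (BC : B *m C^T = 0).
Hypotheses (fB : row_free B) (fC : row_free C).

(** The Moore-Penrose inverse when the rows of [A] are independent: it yields the coordinates, along
    these rows, of the orthogonal projection of a vector. *)
Definition gram_pinv m (A : 'M[R]_(m, n)) : 'M[R]_(n, m) := A^T *m invmx (A *m A^T).

Lemma gram_pinvK m (A : 'M[R]_(m, n)) : row_free A -> A *m gram_pinv A = 1%:M.
Proof. by move=> fA; rewrite mulmxA mulmxV// unitmxE unitfE det_gram_neq0. Qed.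

Lemma CB0 : C *m B^T = 0.
Proof. by rewrite -[C]trmxK -trmx_mul BC trmx0. Qed.

Lemma coordB (x : 'rV[R]_i) (y : 'rV[R]_k) : (x *m B + y *m C) *m gram_pinv B = x.
Proof.
by rewrite mulmxDl -!mulmxA gram_pinvK// [C *m _]mulmxA CB0 mul0mx mulmx0 addr0 mulmx1.
Qed.

Lemma coordC (x : 'rV[R]_i) (y : 'rV[R]_k) : (x *m B + y *m C) *m gram_pinv C = y.
Proof.
by rewrite mulmxDl -!mulmxA gram_pinvK// [B *m _]mulmxA BC mul0mx mulmx0 add0r mulmx1.
Qed.

Lemma coords_exist (z : 'rV[R]_n) : exists x y, z = x *m B + y *m C.
Proof.
pose M := col_mx B C.
have fM : row_free M.
  rewrite -kermx_eq0; apply/negPn/negP => /rowV0Pn[u /sub_kermxP uM /negP]; apply.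
  rewrite -[u]hsubmxK mul_row_col in uM *.
  have := coordB (lsubmx u) (rsubmx u); have := coordC (lsubmx u) (rsubmx u).
  by rewrite uM !mul0mx => <- <-; rewrite row_mx0.
have /submxP[w zw] : (z <= M)%MS by rewrite submx_full// -col_leq_rank (eqP fM) ikn.
exists (lsubmx w), (rsubmx w).
by rewrite -mul_row_col hsubmxK.
Qed.

Lemma coordsK (z : 'rV[R]_n) : z = z *m gram_pinv B *m B + z *m gram_pinv C *m C.
Proof. by have [x [y ->]] := coords_exist z; rewrite coordB coordC. Qed.

Variable f : 'rV[R]_n -> R.
Hypotheses (f0 : forall x, 0 <= f x) (fmax : forall x, f x <= f 0).
Hypothesis fusc : forall a, open [set x | f x < a].
Hypothesis fcompact : forall a, 0 < a -> compact [set x | a <= f x].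

Local Notation P := (coord_proj B C f).

(** When P(x) > 0, only the part of the fibre where f >= P(x) / 2 matters, and it is compact. *)
Lemma coord_proj_attained x : exists y, f (x *m B + y *m C) = P x.
Proof.
have [P0|P0] := eqVneq (P x) 0.
  exists 0; apply/eqP; rewrite P0 eq_le f0 andbT -P0; exact: coord_proj_ge.
have {}P0 : 0 < P x by rewrite lt_neqAle eq_sym P0 coord_proj_ge0.
have P20 : 0 < P x / 2 by rewrite divr_gt0.
pose K := [set z | P x / 2 <= f z] `&` [set z | z *m gram_pinv B = x].
have clF : closed [set z : 'rV[R]_n | z *m gram_pinv B = x].
  have := @closed_comp _ _ (fun z : 'rV[R]_n => z *m gram_pinv B) [set x].
  apply; [by move=> z _; exact: continuous_mulmxr|apply: compact_closed].
  - exact: norm_hausdorff.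
  - exact: compact_set1.
have cK : compact K by apply: compact_closedI => //; exact: fcompact.
have [_ [y _ <-] Py] : exists2 z, range (fun y => f (x *m B + y *m C)) z & P x / 2 < z.
  apply: sup_gt; last by rewrite ltr_pdivrMr// ltr_pMr// ltrDl.
  by exists (f (x *m B + 0 *m C)), 0.
have K0 : K !=set0 by exists (x *m B + y *m C); split; [exact: ltW|exact: coordB].
have [z [/= Pz zx] zmax] := usc_attains cK K0 fusc.
exists (z *m gram_pinv C); apply/eqP; rewrite eq_le coord_proj_ge//=.
apply: coord_proj_le => // w; rewrite -{2}zx -coordsK.
have [Pw|Pw] := leP (P x / 2) (f (x *m B + w *m C)); last exact: ltW (lt_le_trans Pw Pz).
by apply: zmax; split => //=; exact: coordB.
Qed.

(** The set where P >= a > 0 is the linear image of the compact set where f >= a, because maxima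
    over fibres are attained. *)
Lemma coord_proj_usc a : open [set x | P x < a].
Proof.
have [a0|a0] := leP a 0.
  rewrite (_ : mkset _ = set0); first exact: open0.
  by apply/seteqP; split=> // x /=; rewrite ltNge (le_trans a0)// coord_proj_ge0.
have : closed ((fun z => z *m gram_pinv B) @` [set z | a <= f z]).
  apply: compact_closed; first exact: norm_hausdorff.
  apply: continuous_compact; last exact: fcompact.
  exact/continuous_subspaceT/continuous_mulmxr.
move=> /closed_openC; congr open; apply/seteqP; split=> x /=.
  move=> H; rewrite ltNge; apply/negP => aP; apply: H.
  have [y fy] := coord_proj_attained x.
  by exists (x *m B + y *m C); [rewrite fy|exact: coordB].
move=> Pa [z az zx]; move: Pa; rewrite ltNge => /negP; apply.
by apply: le_trans az _; rewrite [z in f z]coordsK zx coord_proj_ge.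
Qed.

End orthogonal_projections.

(** * From equality to the product structure of the fibres *)

Section equality_case.
Context {R : realType} (i k n : nat) (B : 'M[R]_(i, n)) (C : 'M[R]_(k, n)).
Hypotheses (ikn : (i + k)%N = n) (BC : B *m C^T = 0).
Hypotheses (fB : row_free B) (fC : row_free C).
Variable f : 'rV[R]_n -> R.
Hypotheses (f0 : forall x, 0 <= f x) (flc : log_concave f).
Hypotheses (f1 : f 0 = 1) (fle1 : forall x, f x <= 1).
Hypothesis fusc : forall a, open [set x | f x < a].
Hypotheses (fpos : (0 < \int[leb n]_x (f x)%:E)%E)
           (ffin : (\int[leb n]_x (f x)%:E < +oo)%E).

Local Notation P := (coord_proj B C f).
Local Notation q y := (f (y *m C)).
Local Notation qf := (fun y : 'rV[R]_k => f (y *m C)).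
Local Notation marginal := (fun x => \int[leb k]_y (f (x *m B + y *m C))%:E)%E.

Let fmax x : f x <= f 0. Proof. by rewrite f1. Qed.

Let fcompact (a : R) : 0 < a -> compact [set x | a <= f x].
Proof. exact: superlevel_compact. Qed.

Let Pusc : forall a, open [set x | P x < a].
Proof. exact: coord_proj_usc. Qed.

Let mf : measurable_fun setT (EFin \o f).
Proof. exact: measurable_fun_usc. Qed.

Let P0 x : 0 <= P x. Proof. exact: coord_proj_ge0. Qed.

Let P00 : P 0 = 1.
Proof.
apply/eqP; rewrite eq_le coord_proj_le//=.
by rewrite -f1 -[X in f X]addr0 -{1}(mul0mx 1 B) -{1}(mul0mx 1 C) coord_proj_ge.
Qed.

Lemma star_shaped (t : R) z : 0 <= t <= 1 -> f z `^ t <= f (t *: z).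
Proof.
move=> t01; have := flc 0 z t01; rewrite f1 powR1 mul1r scaler0 add0r; exact.
Qed.

Lemma coord_proj_star_shaped (t : R) x : 0 <= t <= 1 -> P x `^ t <= P (t *: x).
Proof.
move=> t01; have [y <-] := coord_proj_attained ikn BC fB fC f0 fmax fusc fcompact x.
apply: le_trans (star_shaped _ t01) _.
by rewrite scalerDr !scalemxAl coord_proj_ge.
Qed.

(** As f <= 1, one has f(w) <= f(w)^(1 - e): the log-concavity bound becomes linear in f(w) and can
    be integrated. *)
Let fcontract e w v c : 0 < e < 1 -> 0 <= c -> c <= f v ->
  c `^ e * f w <= f ((1 - e) *: w + e *: v).
Proof.
move=> /andP[e0 e1] c0 cv; have e01 : 0 <= e <= 1 by rewrite !ltW.
apply: le_trans (log_concave_ge f0 flc e01 (f0 w) c0 (lexx _) cv).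
rewrite mulrC ler_wpM2r ?powR_ge0//.
have [->|fw] := eqVneq (f w) 0; first exact: powR_ge0.
by rewrite ger1_powR ?fle1 ?lt_neqAle ?f0 ?(eq_sym 0) ?fw//= gerBl ltW.
Qed.

Lemma fiber_box : exists (x0 : 'rV[R]_i) (y0 : 'rV[R]_k) (r c : R),
  [/\ 0 < r, 0 < c & forall v, box x0 r v -> c <= f (v *m B + y0 *m C)].
Proof.
have [z0 [r [c [r0 c0 cf]]]] := log_concave_box f0 flc fmax fpos.
have [x0 [y0 z0E]] := coords_exist ikn BC fB fC z0.
have /open_boxP/(_ x0) := @open_preimage_affine _ _ _ B (y0 *m C) _ (@open_box R n z0 r).
rewrite /= -z0E => /(_ (box_center _ r0))[s s0 sr].
by exists x0, y0, s, c; split=> // v /sr /cf.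
Qed.

(** The point [y0] is the same for the whole box, so contracting the fibre over [w] is a homothety
    of ratio 1 - e, with Jacobian (1 - e)^k. *)
Lemma marginal_contract (x0 : 'rV[R]_i) (y0 : 'rV[R]_k) (r c : R) : 0 < c ->
  (forall v, box x0 r v -> c <= f (v *m B + y0 *m C)) ->
  forall w v e, 0 < e < 1 -> box x0 r v ->
    (((1 - e) ^+ k * c `^ e)%:E * marginal w <= marginal ((1 - e) *: w + e *: v)%R)%E.
Proof.
move=> c0 cf w v e e01 /cf cv; have /andP[e0 e1] := e01.
rewrite -[X in (_ <= X)%E](@integral_homothety _ k (1 - e) (e *: y0))//; last 2 first.
- by left; rewrite subr_gt0.
- by move=> y; rewrite lee_fin.
rewrite EFinM -muleA lee_wpmul2l ?lee_fin ?exprn_ge0 ?subr_ge0 ?(ltW e1)//.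
rewrite -integralZT ?powR_ge0//; last by move=> y; rewrite lee_fin.
apply: le_integralT => y; first by rewrite -EFinM lee_fin mulr_ge0// powR_ge0.
rewrite -EFinM lee_fin; apply: le_trans (fcontract (w *m B + y *m C) e01 (ltW c0) cv) _.
by rewrite !scalerDr !mulmxDl -!scalemxAl addrACA.
Qed.

Lemma integral_marginal_bounds :
  (0 < \int[leb i]_x marginal x)%E /\ (\int[leb i]_x marginal x < +oo)%E.
Proof.
have J0 : 0 < gram_vol B * gram_vol C by rewrite mulr_gt0// gram_vol_gt0.
have := fpos; have := ffin; rewrite (integral_coords ikn BC fB fC mf)//=.
  rewrite pmule_rgt0// => fi fp; split=> //.
  move: fi fp; case: (\int[leb i]_x _)%E => [x| |]//.
    by move=> _ _; exact: ltry.
  by rewrite gt0_muley.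
Qed.

Variable l : R.
Hypothesis l01 : 0 < l < 1.
Local Notation IP := (\int[leb i]_x (P x `^ (1 - l))%:E)%E.
Local Notation Iq := (\int[leb k]_y (f (y *m C) `^ l)%:E)%E.
Hypothesis EQ : (((1 - l) ^+ i * l ^+ k)%:E * (IP * Iq) = \int[leb i]_x marginal x)%E.

(** The product of the two integrals is positive and finite, so neither factor is 0 and neither can
    be infinite. *)
Lemma fiber_integral_fin : exists2 b : R, 0 < b & ((l ^+ k)%:E * Iq = b%:E)%E.
Proof.
have /andP[l0 l1] := l01; have [m0 moo] := integral_marginal_bounds.
have IP0 : (0 <= IP)%E by apply: integral_ge0 => x _; rewrite lee_fin powR_ge0.
have Iq0 : (0 <= Iq)%E by apply: integral_ge0 => x _; rewrite lee_fin powR_ge0.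
have c0 : 0 < (1 - l) ^+ i * l ^+ k by rewrite mulr_gt0// exprn_gt0// subr_gt0.
move: EQ IP0 Iq0 => E; rewrite -E in m0 moo.
case: Iq E m0 moo => [b| |]// _ m0 moo IP0 Iq0; last first.
  move: moo; have [IP00|IP00] := eqVneq IP 0%E; first by rewrite IP00 mul0e mule0 ltxx in m0.
  by rewrite gt0_muley ?lt0e ?IP00// gt0_muley.
exists (l ^+ k * b) => //; rewrite mulr_gt0 ?exprn_gt0// lt_neqAle.
rewrite -lee_fin Iq0 andbT; apply: contraTneq m0 => <-.
by rewrite mule0 mule0 ltxx.
Qed.

Local Notation u := ((1 - l)^-1).

(* By [fiber_integral_ge_proj] the converse inequality holds, and both sides have
   the same integral: they agree a.e., hence everywhere by contraction. *)
Lemma marginal_le_everywhere b : 0 < b -> ((l ^+ k)%:E * Iq = b%:E)%E ->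
  forall x, (marginal x <= (P (u *: x) `^ (1 - l) * b)%:E)%E.
Proof.
move=> b0 bE; have /andP[l0 l1] := l01; have [m0 moo] := integral_marginal_bounds.
have l1' : 0 < 1 - l by rewrite subr_gt0.
have l01' : 0 <= l <= 1 by rewrite !ltW.
have [x0 [y0 [r [c [r0 c0 cf]]]]] := fiber_box.
(* The lower bound of [fiber_integral_ge_proj] for the fibre over x = (1 - l) u x. The homothety of
   ratio 1 - l turns its integral into the left-hand side of [EQ]. *)
pose g x := P (u *: x) `^ (1 - l) * b.
have g0 x : 0 <= g x by rewrite mulr_ge0 ?powR_ge0// ltW.
have gusc a : open [set x | g x < a] by apply: usc_scale_powR => //; exact: ltW.
apply: (ae_le_everywhere r0 c0 (marginal_contract c0 cf) _ g0 gusc).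
  by move=> x; apply: integral_ge0 => y _; rewrite lee_fin.
have Ig : (\int[leb i]_x (g x)%:E = \int[leb i]_x marginal x)%E.
  have gE0 x : (0 <= (EFin \o g) x)%E by rewrite lee_fin.
  rewrite -EQ -(@integral_homothety _ i (1 - l) 0 _ (or_introl l1') gE0).
  rewrite EFinM -muleA; congr (_ * _)%E => /=.
  rewrite (_ : (fun x => _) = (fun x => b%:E * (P x `^ (1 - l))%:E)%E); last first.
    apply/funext => x; rewrite addr0 /g scalerA mulVf ?gt_eqF// scale1r.
    by rewrite mulrC EFinM.
  rewrite integralZT ?(ltW b0)//; last by move=> x; rewrite lee_fin powR_ge0.
  by rewrite -bE muleAC -muleA [(_ * Iq)%E]muleC.
apply: ae_le_of_integral_le => //.
- have := @measurable_fiber_integral _ _ _ _ B C 0 _ mf.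
  under eq_fun do under eq_integral do rewrite addr0.
  by apply=> x; rewrite lee_fin.
- exact: measurable_fun_usc.
- move=> x.
  have := @fiber_integral_ge_proj R i k n B C f f0 flc fmax l l01' (u *: x)
    (or_introl l0).
  rewrite scalerA mulfV ?gt_eqF// scale1r; apply: le_trans.
  by rewrite muleCA bE -EFinM.
- by rewrite Ig.
- by rewrite Ig.
Qed.

Let q_ge0 y : 0 <= q y. Proof. exact: f0. Qed.

Let q_lc : log_concave qf.
Proof. by move=> x y t t01; rewrite mulmxDl -!scalemxAl; exact: flc. Qed.

Let q_le1 y : q y <= q 0. Proof. by rewrite /= mul0mx f1. Qed.

Let q_usc (a : R) : open [set y | q y < a].
Proof.
have := @open_preimage_affine _ _ _ C 0 _ (@fusc a).
by congr open; apply/seteqP; split=> y /=; rewrite addr0.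
Qed.

Let q_contract y v e c : 0 < e < 1 -> 0 <= c -> c <= q v ->
  c `^ e * q y <= q ((1 - e) *: y + e *: v).
Proof. by rewrite mulmxDl -!scalemxAl; exact: fcontract. Qed.

(* [marginal_le_everywhere] at [x = 0] compares the integrals of [q] and of
   [q (y / l) `^ l <= q y]. *)
Lemma fiber_one_ratio b : 0 < b -> ((l ^+ k)%:E * Iq = b%:E)%E ->
  (forall y, q (l *: y) = q y `^ l) /\ (\int[leb k]_y (q y)%:E = b%:E)%E.
Proof.
move=> b0 bE; have /andP[l0 l1] := l01; have l01' : 0 <= l <= 1 by rewrite !ltW.
pose g y := q (l^-1 *: y) `^ l * 1.
have gq y : g y <= q y.
  have /= := star_shaped (l^-1 *: y *m C) l01'.
  by rewrite -scalemxAl scalerA mulfV ?gt_eqF// scale1r /g /= -scalemxAl mulr1.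
have g0 y : 0 <= g y by rewrite /g mulr1 powR_ge0.
have gusc a : open [set y | g y < a] by apply: (@usc_scale_powR R k qf).
have Ig : (\int[leb k]_y (g y)%:E = b%:E)%E.
  have gE0 y : (0 <= (EFin \o g) y)%E by rewrite lee_fin.
  rewrite -bE -(@integral_homothety _ k l 0 _ (or_introl l0) gE0).
  congr (_ * _)%E; apply: eq_integral => y _ /=.
  by rewrite addr0 /g scalerA mulVf ?gt_eqF// scale1r mulr1.
have Iqb : (\int[leb k]_y (q y)%:E <= b%:E)%E.
  have := marginal_le_everywhere b0 bE 0; rewrite scaler0 P00 powR1 mul1r.
  by under eq_integral do rewrite mul0mx add0r.
have mq : measurable_fun setT (EFin \o qf) by exact: measurable_fun_usc.
have bI : (b%:E <= \int[leb k]_y (q y)%:E)%E.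
  by rewrite -Ig; apply: le_integralT => y; rewrite lee_fin.
have Iqpos : (0 < \int[leb k]_y (q y)%:E)%E by apply: lt_le_trans bI; rewrite lte_fin.
have [y0 [r [c [r0 c0 cq]]]] := @log_concave_box R k qf q_ge0 q_lc q_le1 Iqpos.
have qg y : q y <= g y.
  rewrite -lee_fin.
  (* The exponent is 0 because [q] itself is contracted: no integral over a fibre, hence no
     Jacobian. *)
  apply: (@ae_le_everywhere _ _ (EFin \o qf) g y0 r c 0 r0 c0 _ _ g0 gusc).
  - move=> w v e e01 /cq cv /=.
    by rewrite expr0 mul1r -EFinM lee_fin q_contract// ltW.
  - by move=> w; rewrite lee_fin.
  - apply: ae_le_of_integral_le => //; last by rewrite Ig ltry.
    + exact: measurable_fun_usc.
    + by rewrite Ig; exact: Iqb.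
split; last by apply/eqP; rewrite eq_le Iqb bI.
move=> y; apply/eqP; rewrite eq_le; apply/andP; split.
  by have := qg (l *: y); rewrite /g scalerA mulVf ?gt_eqF// scale1r mulr1.
by rewrite -scalemxAl star_shaped.
Qed.

Lemma fiber_homogeneous s y : 0 < s -> q (s *: y) = q y `^ s.
Proof.
have [b b0 bE] := fiber_integral_fin; have [ql _] := fiber_one_ratio b0 bE.
apply: (@homogeneous_of_one_ratio R k qf l l01) => // t z t01.
by rewrite -scalemxAl star_shaped.
Qed.

(** Put x' = (1 - l) x and suppose P(u x')^(1 - l) < P(x'). Semicontinuity keeps the left side below
    P(x') when x' is replaced by (1 - e) x', [e] small. There the marginal is at least P(x')^(1 - e)
    b, as the integral of q^e is e^-k b by homogeneity, and at most P(u (1 - e) x')^(1 - l) b. Since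
    P <= 1, P(x') <= P(x')^(1 - e), a contradiction. *)
Lemma coord_proj_one_ratio x : P ((1 - l) *: x) = P x `^ (1 - l).
Proof.
have /andP[l0 l1] := l01; have l1' : 0 < 1 - l by rewrite subr_gt0.
have l01' : 0 <= 1 - l <= 1 by rewrite ltW//= gerBl ltW.
apply/eqP; rewrite eq_le coord_proj_star_shaped// andbT.
have [x' x'E xE] : exists2 x', (1 - l) *: x = x' & x = u *: x'.
  by exists ((1 - l) *: x) => //; rewrite scalerA mulVf ?gt_eqF// scale1r.
rewrite x'E xE => {x x'E xE}.
have [b b0 bE] := fiber_integral_fin; have [_ Iqb] := fiber_one_ratio b0 bE.
rewrite leNgt; apply/negP => Px'.
have Po := @usc_scale_powR R i P u (1 - l) 1 P0 Pusc l1' ler01 (P x').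
rewrite -[X in X < _]mulr1 in Px'.
have [s s0 sP] := (open_boxP _).1 Po x' Px'.
pose D := 1 + \sum_j `|x' 0 j|.
have D0 : 0 < D by rewrite ltr_pwDl// sumr_ge0.
have [j jsD] := exists_expr_lt l01 (divr_gt0 s0 D0).
set e := l ^+ j in jsD; have e0 : 0 < e by rewrite exprn_gt0.
have e1 : e <= 1 by rewrite exprn_ile1// ltW.
have e01 : 0 <= e <= 1 by rewrite ltW.
have : P (u *: ((1 - e) *: x')) `^ (1 - l) * 1 < P x'.
  apply: sP => m; rewrite !mxE mulrBl mul1r addrAC subrr add0r normrN normrM gtr0_norm//.
  apply: (@le_lt_trans _ _ (e * D)); last by rewrite -ltr_pdivlMr.
  by rewrite ler_wpM2l ?(ltW e0)// /D (bigD1 m)//= addrCA lerDl addr_ge0// sumr_ge0.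
apply/negP; rewrite -leNgt mulr1.
have := marginal_le_everywhere b0 bE ((1 - e) *: x').
have := @fiber_integral_ge_proj R i k n B C f f0 flc fmax e e01 x' (or_introl e0).
have -> : (\int[leb k]_y (f (y *m C) `^ e)%:E = (e ^- k)%:E * b%:E)%E.
  have qE0 y : (0 <= (EFin \o qf) y)%E by rewrite lee_fin.
  have := @integral_homothety _ k e 0 _ (or_introl e0) qE0; rewrite Iqb => <-.
  rewrite muleA -EFinM mulVf ?expf_neq0 ?gt_eqF// mul1e.
  by apply: eq_integral => y _ /=; rewrite addr0 fiber_homogeneous.
rewrite [X in (X <= _)%E]muleCA [X in (_ * X <= _)%E]muleA -[X in (_ * (X * _) <= _)%E]EFinM.
rewrite mulfV ?expf_neq0 ?gt_eqF// mul1e -EFinM => /le_trans H /H.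
rewrite lee_fin ler_pM2r//; apply: le_trans.
have [Px0|Px0] := eqVneq (P x') 0; first by rewrite Px0 powR_ge0.
rewrite ger1_powR ?gerBl ?(ltW e0)// lt_neqAle eq_sym Px0 P0/=.
exact: coord_proj_le.
Qed.

(** Let [y] attain P(u x). Log-concavity between (u x, y) and (0, w / l) gives P(x) q(w) <= f(x, (1
    - l) y + w), because P(u x)^(1 - l) = P(x) and q(w / l)^l = q(w). The bound on the marginal at
    [x] forces equality almost everywhere in [w], then everywhere. *)
Lemma fiber_translate x : exists y, forall w, f (x *m B + (y + w) *m C) = P x * q w.
Proof.
have /andP[l0 l1] := l01; have l1' : 0 < 1 - l by rewrite subr_gt0.
have l01' : 0 <= l <= 1 by rewrite !ltW.
have [Px0|Px0] := eqVneq (P x) 0.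
  exists 0 => w; rewrite Px0 mul0r; apply/eqP; rewrite eq_le f0 andbT -Px0.
  exact: coord_proj_ge.
have {}Px0 : 0 < P x by rewrite lt_neqAle eq_sym Px0 P0.
have [b b0 bE] := fiber_integral_fin; have [_ Iqb] := fiber_one_ratio b0 bE.
have PE : P (u *: x) `^ (1 - l) = P x.
  by rewrite -coord_proj_one_ratio scalerA mulfV ?gt_eqF// scale1r.
have [y yP] := coord_proj_attained ikn BC fB fC f0 fmax fusc fcompact (u *: x).
exists ((1 - l) *: y); pose h w := f (x *m B + ((1 - l) *: y + w) *m C).
pose g w := q (1 *: w) `^ 1 * P x.
have gE w : g w = P x * q w by rewrite /g scale1r powRr1// mulrC.
have g0 w : 0 <= g w by rewrite gE mulr_ge0.
have gh w : g w <= h w.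
  have := flc (u *: x *m B + y *m C) (l^-1 *: w *m C) l01'.
  rewrite yP PE (fiber_homogeneous w (_ : 0 < l^-1)) ?invr_gt0//.
  rewrite -powRrM mulVf ?gt_eqF// powRr1// gE /h; congr (_ <= f _).
  rewrite scalerDr !scalemxAl !scalerA mulfV ?gt_eqF// mulfV ?gt_eqF// !scale1r.
  by rewrite mulmxDl addrA.
have hg w : h w <= g w.
  have h0 v : 0 <= h v by exact: f0.
  have mh : measurable_fun setT (EFin \o h).
    have := @measurable_comp_affine R n k (EFin \o f) C (x *m B + ((1 - l) *: y) *m C) mf.
    congr measurable_fun; apply/funext => v /=.
    by rewrite /h mulmxDl [_ + v *m C]addrC addrCA addrA.
  have gusc a : open [set v | g v < a] by apply: (@usc_scale_powR R k qf).
  have Iqpos : (0 < \int[leb k]_y (q y)%:E)%E by rewrite Iqb lte_fin.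
  have [y0 [r [c [r0 c0 cq]]]] := @log_concave_box R k qf q_ge0 q_lc q_le1 Iqpos.
  have Ig : (\int[leb k]_v (g v)%:E = (P x * b)%:E)%E.
    under eq_integral do rewrite gE EFinM.
    by rewrite integralZT// ?Iqb.
  rewrite -lee_fin.
  apply: (@ae_le_everywhere _ _ (EFin \o h) g y0 r (P x * c) 0 r0 _ _ _ g0 gusc).
  - by rewrite mulr_gt0.
  - move=> v1 v2 e e01 /cq cv /=; rewrite expr0 mul1r -EFinM lee_fin.
    have cv2 : P x * c <= h v2 by apply: le_trans (gh v2); rewrite gE ler_wpM2l// ltW.
    apply: le_trans (fcontract _ e01 _ cv2) _; first by rewrite mulr_ge0// ltW.
    rewrite /h !scalerDr addrACA -scalerDl subrK scale1r !mulmxDl -!scalemxAl.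
    by rewrite !scalerDr addrACA -scalerDl subrK scale1r.
  - by move=> v; rewrite lee_fin.
  - apply: ae_le_of_integral_le => //; last by rewrite Ig ltry.
    + exact: measurable_fun_usc.
    rewrite Ig -PE; apply: le_trans (marginal_le_everywhere b0 bE x).
    have fE0 v : (0 <= (f (x *m B + v *m C))%:E)%E by rewrite lee_fin.
    rewrite -(@integral_homothety _ k 1 ((1 - l) *: y) _ (or_introl ltr01) fE0).
    rewrite expr1n mul1e; apply: le_integralT => v; first by rewrite lee_fin.
    by rewrite scale1r [v + _]addrC.
by move=> w; apply/eqP; rewrite -gE eq_le hg gh.
Qed.

Lemma fiber_max_unique w : q w = 1 -> w = 0.
Proof.
move=> qw1; have : w *m C = 0.
  apply: (@superlevel_no_ray R n f f0 flc fmax fpos ffin 1 _ ltr01) => t.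
  rewrite le_eqVlt => /predU1P[<-|t0]; first by rewrite scale0r f1.
  by rewrite scalemxAl fiber_homogeneous// qw1 powR1.
by move=> wC; rewrite -(coordC BC fC 0 w) wC addr0 mul0mx mul0mx.
Qed.

(** The ratio 1 - l suffices. If [a] is the maximizer over [x], then (1 - l) a is one over (1 - l)
    x, so it equals the maximizer [a'] there and the product formulas of the two fibres
    correspond. *)
Lemma equality_homogeneous s z : 0 < s -> f (s *: z) = f z `^ s.
Proof.
have /andP[l0 l1] := l01; have l1' : 0 < 1 - l by rewrite subr_gt0.
have l01' : 0 <= 1 - l <= 1 by rewrite ltW//= gerBl ltW.
apply: (@homogeneous_of_one_ratio R n f (1 - l)) => //.
- by rewrite l1' gtrBl.
- by move=> t v t01; exact: star_shaped.
move=> {s}{}z; have [x [y ->]] := coords_exist ikn BC fB fC z.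
have [Px|Px] := eqVneq (P x) 0.
  have -> : f (x *m B + y *m C) = 0.
    by apply/eqP; rewrite eq_le f0 andbT -Px coord_proj_ge.
  rewrite powR0 ?gt_eqF//; apply/eqP; rewrite eq_le f0 andbT.
  rewrite scalerDr !scalemxAl (le_trans (coord_proj_ge B C fmax _ _))//.
  by rewrite coord_proj_one_ratio Px powR0 ?gt_eqF.
have [a aP] := fiber_translate x; have [a' aP'] := fiber_translate ((1 - l) *: x).
have [w ->] : exists w, y = a + w by exists (y - a); rewrite addrC subrK.
have [w' aa'] : exists w', (1 - l) *: a = a' + w'.
  by exists ((1 - l) *: a - a'); rewrite [RHS]addrC subrK.
have w'0 : w' = 0.
  apply: fiber_max_unique; apply/eqP; rewrite eq_le fle1/=.
  have P'0 : 0 < P ((1 - l) *: x).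
    by rewrite coord_proj_one_ratio powR_gt0// lt_neqAle eq_sym Px P0.
  rewrite -(ler_pM2l P'0) mulr1 -aP' -aa' -scalemxAl -scalemxAl -scalerDr.
  apply: le_trans (star_shaped _ l01').
  by rewrite coord_proj_one_ratio -[X in X *m C]addr0 aP mul0mx f1 mulr1.
rewrite aP powRM// -fiber_homogeneous// -coord_proj_one_ratio -aP'.
by rewrite scalerDr !scalemxAl scalerDr aa' w'0 addr0.
Qed.

End equality_case.

(** * Gauges and superlevel sets *)

Section gauge_functions.
Context {R : realType} {n : nat}.
Implicit Types (A K : set 'rV[R]_n) (f : 'rV[R]_n -> R) (H : 'M[R]_n).

Lemma convex_setP A : convex_set A <-> segment_closed A.
Proof.
split=> [cA x y l l01 Ax Ay|cA x y t /set_mem Ax /set_mem Ay].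
  have /andP[l0 l1] : 0 <= 1 - l <= 1 by move: l01; lra.
  have := cA x y (Itv01 l0 l1) (mem_set Ax) (mem_set Ay); rewrite inE.
  by congr A; congr (_ + _ *: _); exact: subKr.
apply/mem_set; have t01 : 0 <= 1 - t%:num <= 1 by rewrite subr_ge0 gerBl ge0 le1.
by have := cA x y _ t01 Ax Ay; rewrite subKr.
Qed.

Lemma segment_closed_hull A x y (l : R) : 0 <= l <= 1 ->
  convex_hull A x -> convex_hull A y -> convex_hull A ((1 - l) *: x + l *: y).
Proof.
move=> l01 Ax Ay M [cM AM]; apply/(convex_setP M).1 => //.
  exact: Ax.
exact: Ay.
Qed.

Lemma gauge_ge0 K x : (0 <= gauge K x)%E.
Proof. by apply: le_ereal_inf_tmp => _ [r [r0 _] <-]; rewrite lee_fin. Qed.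

Lemma gauge_scale_le K (s : R) x : 0 < s -> (gauge K (s *: x) <= s%:E * gauge K x)%E.
Proof.
move=> s0; rewrite -lee_pdivrMl//; apply: le_ereal_inf_tmp => _ [r [r0 [y Ky ->]] <-].
rewrite lee_pdivrMl// -EFinM; apply: ereal_inf_lbound; exists (s * r) => //=.
split; first by rewrite mulr_ge0// ltW.
by exists y => //; rewrite scalerA.
Qed.

Lemma gauge_homogeneous K (s : R) x : 0 < s -> gauge K (s *: x) = (s%:E * gauge K x)%E.
Proof.
move=> s0; apply/eqP; rewrite eq_le gauge_scale_le//= -lee_pdivlMl//.
have := @gauge_scale_le K s^-1 (s *: x).
by rewrite scalerA mulVf ?gt_eqF// scale1r invr_gt0; exact.
Qed.

(** For r > 0, [z] lies in r K exactly when f(z) >= e^-r. Hence the gauge is -ln f(z), and +oo, the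
    infimum of the empty set, when f(z) = 0. *)
Lemma exp_gauge f z : (forall x, 0 <= f x <= 1) ->
  (forall s z, 0 < s -> f (s *: z) = f z `^ s) -> f 0 = 1 ->
  (f z)%:E = expeR (- gauge [set x | expR (-1) <= f x]%R z).
Proof.
move=> f01 fhom f0; have f_ge0 x : 0 <= f x by have /andP[] := f01 x.
pose K := [set x | expR (-1) <= f x]; rewrite -/K.
have fK r x : 0 < r -> K x -> expR (- r) <= f (r *: x).
  move=> r0 Kx; rewrite fhom// -[- r]mulN1r expRM.
  by apply: ge0_ler_powR; rewrite ?nnegrE ?expR_ge0 ?(ltW r0)//.
have [fz|fz] := eqVneq (f z) 0.
  rewrite fz (_ : gauge K z = +oo%E)//; apply/eqP; rewrite -leye_eq.
  apply: le_ereal_inf_tmp => _ [r [r0 [y Ky zy]] <-].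
  exfalso; move: r0; rewrite le_eqVlt => /predU1P[r0|r0].
    by move: fz; rewrite zy -r0 scale0r f0 => /eqP; rewrite oner_eq0.
  by have := fK r y r0 Ky; rewrite -zy fz leNgt expR_gt0.
have {}fz : 0 < f z by rewrite lt_neqAle eq_sym fz f_ge0.
suff -> : gauge K z = (- ln (f z))%:E by rewrite -EFinN opprK /= lnK.
have u0 : 0 <= - ln (f z) by rewrite oppr_ge0 ln_le0//; have /andP[] := f01 z.
apply/eqP; rewrite eq_le; apply/andP; split; last first.
  apply: le_ereal_inf_tmp => _ [r [r0 [y Ky zy]] <-]; rewrite lee_fin lerNl.
  move: r0; rewrite le_eqVlt => /predU1P[r0|r0].
    by rewrite zy -r0 scale0r f0 ln1 oppr0.
  by rewrite -ler_expR lnK// zy fK.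
apply/lee_addgt0Pr => e e0; apply: ereal_inf_lbound.
(* The increment keeps the scale positive even where f(z) = 1. *)
have r0 : 0 < - ln (f z) + e by rewrite ltr_wpDl.
exists (- ln (f z) + e) => //=; split; first exact: ltW.
exists ((- ln (f z) + e)^-1 *: z); last by rewrite scalerA mulfV ?gt_eqF// scale1r.
rewrite /K /= fhom ?invr_gt0// /powR gt_eqF// ler_expR.
rewrite mulrC ler_pdivlMr// mulN1r lerNl lerDl ltW//.
Qed.

Lemma superlevel_convex_body f : (forall x, 0 <= f x) -> log_concave f ->
  (forall s z, 0 < s -> f (s *: z) = f z `^ s) ->
  compact [set x | expR (-1) <= f x] ->
  (exists (z0 : 'rV[R]_n) (r c : R),
    [/\ 0 < r, 0 < c & forall z, box z0 r z -> c <= f z]) ->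
  convex_body [set x | expR (-1) <= f x].
Proof.
move=> f0 flc fhom fcpt [z0 [r [c [r0 c0 cf]]]]; split => //.
  by apply/convex_setP; exact: superlevel_segment_closed.
(* With this factor c^s >= e^-1, so the box where f >= c, shrunk by [s], lies in the superlevel
   set. *)
pose s := (1 + `|ln c|)^-1.
have s0 : 0 < s by rewrite invr_gt0 ltr_pwDl.
exists (s *: z0); apply/nbhs_ballP; exists (s * r) => /=; first by rewrite mulr_gt0.
rewrite ball_box ?mulr_gt0// => w wz /=.
have -> : w = s *: (s^-1 *: w) by rewrite scalerA mulfV ?gt_eqF// scale1r.
rewrite fhom//.
have /cf cw : box z0 r (s^-1 *: w).
  move=> j; have := wz j; rewrite !mxE.
  have -> : s^-1 * w 0 j - z0 0 j = s^-1 * (w 0 j - s * z0 0 j) by field; rewrite gt_eqF.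
  by rewrite normrM gtr0_norm ?invr_gt0// ltr_pdivrMl.
apply: (@le_trans _ _ (c `^ s)).
  rewrite /powR gt_eqF// ler_expR /s mulrC ler_pdivlMr ?ltr_pwDl//.
  by rewrite mulN1r lerNl (le_trans (ler_norm _))// normrN lerDr.
by apply: ge0_ler_powR; rewrite ?nnegrE ?(ltW s0) ?(ltW c0).
Qed.

End gauge_functions.

(** * Sections of [K] as convex hulls with one point *)

Section hulls.
Context {R : realType} {n : nat} (H : 'M[R]_n).
Local Notation B := (row_base H).
Local Notation C := (row_base (orth_compl H)).
Implicit Types (f : 'rV[R]_n -> R) (K : set 'rV[R]_n).

Let BC : B *m C^T = 0. Proof. exact: row_base_orth. Qed.
Let fB : row_free B. Proof. exact: row_base_free. Qed.
Let fC : row_free C. Proof. exact: row_base_free. Qed.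

Lemma coords_inj (x x' : 'rV[R]_(\rank H)) (y y' : 'rV[R]_(\rank (orth_compl H))) :
  x *m B + y *m C = x' *m B + y' *m C -> x = x' /\ y = y'.
Proof.
move=> E; split; first by rewrite -(coordB BC fB x y) E coordB.
by rewrite -(coordC BC fC x y) E coordC.
Qed.

Lemma orth_halfspaceP (x : 'rV[R]_(\rank H)) (w : 'rV[R]_n) : orth_halfspace H (x *m B) w <->
  exists2 s : R, 0 <= s & exists y, w = (s *: x) *m B + y *m C.
Proof.
split=> [[s s0 /sub_row_baseP[y wy]]|[s s0 [y ->]]]; exists s => //.
  by exists y; rewrite -wy -scalemxAl addrC subrK.
by apply/sub_row_baseP; exists y; rewrite -scalemxAl addrC addKr.
Qed.

Lemma orth_halfspace_segment_closed (v : 'rV[R]_n) : segment_closed (orth_halfspace H v).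
Proof.
move=> x y l /andP[l0 l1] [s s0 xs] [t t0 yt].
exists ((1 - l) * s + l * t); first by rewrite addr_ge0// mulr_ge0// subr_ge0.
have -> : (1 - l) *: x + l *: y - ((1 - l) * s + l * t) *: v =
    (1 - l) *: (x - s *: v) + l *: (y - t *: v).
  by rewrite !scalerBr [(_ * s + _) *: v]scalerDl opprD addrACA !scalerA.
by rewrite addmx_sub// scalemx_sub.
Qed.

Lemma orth_segment_closed : segment_closed [set y | (y <= orth_compl H)%MS].
Proof. by move=> x y l _ xO yO; rewrite /= addmx_sub// scalemx_sub. Qed.

Lemma segment_closedI (A A' : set 'rV[R]_n) : segment_closed A -> segment_closed A' ->
  segment_closed (A `&` A').
Proof. by move=> cA cA' x y l l01 [? ?] [? ?]; split; [exact: cA|exact: cA']. Qed.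

Lemma convex_hull_sub (A M : set 'rV[R]_n) : segment_closed M -> A `<=` M ->
  convex_hull A `<=` M.
Proof. by move=> /convex_setP cM AM x; apply. Qed.

Lemma sub_convex_hull (A : set 'rV[R]_n) : A `<=` convex_hull A.
Proof. by move=> x Ax M [_]; exact. Qed.

Section product_hull.
Variables (f : 'rV[R]_n -> R) (P : 'rV[R]_(\rank H) -> R).
Hypotheses (f01 : forall x, 0 <= f x <= 1) (flc : log_concave f).
Hypotheses (f1 : forall z, f z = 1 <-> z = 0).
Hypothesis fhom : forall s z, 0 < s -> f (s *: z) = f z `^ s.
Hypothesis fprod :
  forall x, exists y, forall w, f (x *m B + (y + w) *m C) = P x * f (w *m C).
Let K := [set z | expR (-1) <= f z].

Lemma product_hull_with_one_point : hull_with_one_point_over H K.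
Proof.
have f0 z : 0 <= f z by have /andP[] := f01 z.
have f00 : f 0 = 1 by exact/f1.
have cK : segment_closed K by exact: superlevel_segment_closed.
have K0 : K 0 by rewrite /K /= f00 -[leRHS]expR0 ler_expR oppr_le0.
have cF := segment_closedI cK orth_segment_closed.
move=> v /sub_row_baseP[x ->].
have [y fxy] := fprod x.
have Px : P x = f (x *m B + y *m C).
  by rewrite -[y]addr0 fxy mul0mx f00 mulr1.
(* In these cases the section is just the part of [K] in the orthogonal complement, and 0 is already
   one of its points. *)
have [zero|/eqP nz] := eqVneq ((x == 0) || (P x == 0)) true.
  exists 0; rewrite (_ : _ `|` _ = K `&` [set y | (y <= orth_compl H)%MS]); last first.
    apply/seteqP; split=> [z [//|->]|z]; last by left.
    by split => //=; exact: sub0mx.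
  apply/seteqP; split=> [z [Kz /orth_halfspaceP[s s0 [y' zE]]]|z Kz].
    apply: sub_convex_hull; split => //=; apply/sub_row_baseP; exists y'.
    rewrite zE; move: s0; rewrite le_eqVlt => /predU1P[<-|s0].
      by rewrite scale0r mul0mx add0r.
    move: zero; case/orP => /eqP x0; first by rewrite x0 scaler0 mul0mx add0r.
    exfalso; move: Kz; rewrite /K/= zE leNgt => /negP; apply.
    have -> : y' = s *: (y + (s^-1 *: y' - y)).
      by rewrite addrC subrK scalerA mulfV ?gt_eqF// scale1r.
    rewrite -!scalemxAl -scalerDr fhom// fxy x0 mul0r powR0 ?gt_eqF// expR_gt0.
  have {}Kz := convex_hull_sub cF (@subset_refl _ _) Kz.
  split; first by case: Kz.
  case: Kz => _ /= /sub_row_baseP[y' ->]; apply/orth_halfspaceP.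
  by exists 0 => //; exists y'; rewrite scale0r mul0mx add0r.
move: nz => /negP; rewrite negb_or => /andP[x0 P0].
have Pgt0 : 0 < P x by rewrite lt_neqAle eq_sym P0 Px f0.
have Plt1 : P x < 1.
  rewrite lt_neqAle Px; have /andP[_ ->] := f01 (x *m B + y *m C); rewrite andbT.
  apply/eqP => /f1; rewrite -[RHS](addr0 0) -{1}(mul0mx 1 B) -(mul0mx 1 C).
  by move=> /coords_inj[/eqP]; rewrite (negbTE x0).
pose a := - ln (P x).
have a0 : 0 < a by rewrite oppr_gt0 ln_lt0// Pgt0.
have PE s : P x `^ s = expR (- (s * a)).
  by rewrite /powR gt_eqF// /a mulrN opprK.
(* The maximizer over [x], rescaled so that f(p) = e^-1. For [z] in [K] over s x and t = s a, the
   product formula leaves q(s w) >= e^(t - 1); so s w / (1 - t) represents a point of [K] in the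
   orthogonal complement, and [z] is on the segment from it to [p]. *)
pose p := a^-1 *: (x *m B + y *m C).
have fp : f p = expR (-1).
  by rewrite fhom ?invr_gt0// -Px PE mulVf// gt_eqF.
exists p; apply/seteqP; split=> [z [Kz /orth_halfspaceP[s s0 [y' zE]]]|].
  move: s0; rewrite le_eqVlt => /predU1P[s0|s0].
    apply: sub_convex_hull; left; split => //=; apply/sub_row_baseP; exists y'.
    by rewrite zE -s0 scale0r mul0mx add0r.
  have [w zw] : exists w, z = s *: (x *m B + (y + w) *m C).
    exists (s^-1 *: y' - y); rewrite [y + _]addrC subrK zE scalerDr !scalemxAl.
    by rewrite scalerA mulfV ?gt_eqF// scale1r.
  have Kz' : expR (-1) <= expR (- (s * a)) * f ((s *: w) *m C).
    by rewrite -scalemxAl fhom// -PE -powRM ?f0 ?(ltW Pgt0)// -fxy -fhom// -zw.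
  set t := s * a in Kz'; have t0 : 0 < t by rewrite mulr_gt0.
  have sE : s = t / a by rewrite mulfK// gt_eqF.
  have fw : expR (t - 1) <= f ((s *: w) *m C).
    by rewrite -(ler_pM2l (expR_gt0 (- t))) -expRD addrA addNr add0r.
  have t1 : t <= 1.
    rewrite -subr_le0 -ler_expR expR0 (le_trans fw)//.
    by have /andP[] := f01 ((s *: w) *m C).
  have zE' : z = t *: p + (s *: w) *m C.
    rewrite zw mulmxDl addrA scalerDr -scalemxAl; congr (_ + _).
    by rewrite /p scalerA -sE.
  have ph : convex_hull (K `&` [set y | (y <= orth_compl H)%MS] `|` [set p]) p.
    by apply: sub_convex_hull; right.
  move: t1; rewrite le_eqVlt => /predU1P[t1|t1].
    suff wC : (s *: w) *m C = 0 by rewrite zE' wC t1 scale1r addr0.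
    apply/f1/eqP; rewrite eq_le; have /andP[_ ->] := f01 ((s *: w) *m C).
    by move: fw; rewrite t1 subrr expR0.
  have t1' : 0 < 1 - t by rewrite subr_gt0.
  have -> : z = (1 - t) *: ((1 - t)^-1 *: ((s *: w) *m C)) + t *: p.
    by rewrite scalerA mulfV ?gt_eqF// scale1r addrC.
  apply: segment_closed_hull => //; first by rewrite !ltW.
  apply: sub_convex_hull; left; split=> /=; last first.
    by rewrite scalemx_sub//; apply/sub_row_baseP; exists (s *: w).
  rewrite /K /= fhom ?invr_gt0//; apply: (@le_trans _ _ (expR (t - 1) `^ (1 - t)^-1)).
    by rewrite -expRM ler_expR -[t - 1]opprB mulNr mulfV ?gt_eqF.
  by apply: ge0_ler_powR; rewrite ?nnegrE ?expR_ge0 ?invr_ge0 ?(ltW t1').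
apply: convex_hull_sub.
  by apply: segment_closedI => //; exact: orth_halfspace_segment_closed.
move=> z [[Kz /sub_row_baseP[y' zE]]|->]; split=> //.
- by apply/orth_halfspaceP; exists 0 => //; exists y'; rewrite scale0r mul0mx add0r.
- by rewrite /K/= fp.
- apply/orth_halfspaceP; exists a^-1; first by rewrite invr_ge0 ltW.
  by exists (a^-1 *: y); rewrite /p scalerDr !scalemxAl.
Qed.

End product_hull.

Section hull_product.
Variable K : set 'rV[R]_n.
Hypotheses (cK : segment_closed K) (K0 : K 0) (hK : hull_with_one_point_over H K).

(** The join of [F] and [a], written with explicit weights, is convex; hence it contains the hull,
    and points of the hull can be decomposed. *)
Lemma cone_segment_closed F (a : 'rV[R]_n) : segment_closed F -> F 0 ->
  segment_closed [set z | exists t k, [/\ 0 <= t <= 1, F k & z = (1 - t) *: k + t *: a]].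
Proof.
move=> cF F0 _ _ l l01 [t1 [k1 [t101 Fk1 ->]]] [t2 [k2 [t201 Fk2 ->]]].
have /andP[l0 l1] := l01; have /andP[t10 t11] := t101; have /andP[t20 t21] := t201.
pose t := (1 - l) * t1 + l * t2.
have t1E : 1 - t = (1 - l) * (1 - t1) + l * (1 - t2) by rewrite /t; ring.
have u0 : 0 <= (1 - l) * (1 - t1) by rewrite mulr_ge0// subr_ge0.
have v0 : 0 <= l * (1 - t2) by rewrite mulr_ge0// subr_ge0.
have t01 : 0 <= t <= 1.
  apply/andP; split; first by rewrite addr_ge0// mulr_ge0// subr_ge0.
  by rewrite -subr_ge0 t1E addr_ge0.
have eqE : (1 - l) *: ((1 - t1) *: k1 + t1 *: a) + l *: ((1 - t2) *: k2 + t2 *: a) =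
    ((1 - l) * (1 - t1)) *: k1 + (l * (1 - t2)) *: k2 + t *: a.
  by rewrite !scalerDr !scalerA addrACA -scalerDl.
(* All the weight may be on [a]; the point of [F] is then arbitrary, and 0 is taken. *)
rewrite eqE; exists t; have [T|T] := eqVneq (1 - t) 0.
  exists 0; split => //; rewrite scaler0 add0r.
  move: T; rewrite t1E => /eqP; rewrite paddr_eq0// => /andP[/eqP-> /eqP->].
  by rewrite !scale0r !add0r.
have Tp : 0 < 1 - t by rewrite lt_neqAle eq_sym T subr_ge0; case/andP: t01.
pose m := l * (1 - t2) / (1 - t).
have mE : (1 - t) * m = l * (1 - t2) by rewrite mulrC divfK.
exists ((1 - m) *: k1 + m *: k2); split => //.
  apply: cF => //; rewrite divr_ge0 ?(ltW Tp)//= ler_pdivrMr// mul1r t1E.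
  by rewrite lerDr.
rewrite scalerDr !scalerA; congr (_ *: _ + _ *: _ + _).
  by rewrite [RHS]mulrBr mulr1 mE t1E addrK.
by rewrite mE.
Qed.

(** Let the extra point [a] lie over s x. If s > 0, then a / s lies over [x], and adding r k with
    [k] in [K] costs 1/s + r by convexity. Conversely, write a point of the half-space as (1 - t) k'
    + t a; comparing components along H gives r t = 1/s, so r = 1/s + r (1 - t). *)
Lemma hull_gauge_split (x : 'rV[R]_(\rank H)) : (exists (a : R) y, 0 <= a /\ forall w,
    gauge K (x *m B + (y + w) *m C) = (a%:E + gauge K (w *m C))%E) \/
  (forall w, gauge K (x *m B + w *m C) = +oo%E).
Proof.
have [->|x0] := eqVneq x 0.
  by left; exists 0, 0; split=> // w; rewrite mul0mx !add0r.
have [a Ka] : exists a, K `&` orth_halfspace H (x *m B) =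
    convex_hull (K `&` [set y | (y <= orth_compl H)%MS] `|` [set a]).
  by apply: hK; apply/sub_row_baseP; exists x.
have cF := segment_closedI cK orth_segment_closed.
have : (K `&` orth_halfspace H (x *m B)) a by rewrite Ka; apply: sub_convex_hull; right.
move=> [aK /orth_halfspaceP[s s0 [ya aE]]].
have posr r z k : 0 <= r -> x *m B + z *m C = r *: k -> 0 < r.
  rewrite le_eqVlt => /predU1P[<-|//]; rewrite scale0r => E; exfalso.
  have := @coords_inj x 0 z 0; rewrite E !mul0mx addr0 => /(_ erefl)[/eqP].
  by rewrite (negbTE x0).
have halfK r z k : 0 <= r -> K k -> x *m B + z *m C = r *: k ->
    (K `&` orth_halfspace H (x *m B)) k.
  move=> r_ge0 Kk E; have r0 := posr _ _ _ r_ge0 E; split => //.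
  apply/orth_halfspaceP; exists r^-1; first by rewrite invr_ge0 ltW.
  exists (r^-1 *: z); rewrite -!scalemxAl -scalerDr E scalerA mulVf ?gt_eqF//.
  by rewrite scale1r.
move: s0; rewrite le_eqVlt => /predU1P[s0|s0].
  (* If s = 0 the whole section lies in the orthogonal complement, so no multiple of [K] reaches the
     fibre over x != 0. *)
  right=> z; apply/eqP; rewrite -leye_eq; apply: le_ereal_inf_tmp.
  move=> _ [r [r_ge0 [k Kk E]] <-]; exfalso.
  have r0 := posr _ _ _ r_ge0 E.
  have := halfK _ _ _ r_ge0 Kk E; rewrite Ka => kh.
  have /sub_row_baseP[y' kE] : (k <= orth_compl H)%MS.
    apply: (convex_hull_sub orth_segment_closed _ kh) => u [[_ //]|->] /=.
    by apply/sub_row_baseP; exists ya; rewrite aE -s0 scale0r mul0mx add0r.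
  have := @coords_inj x 0 z (r *: y'); rewrite mul0mx add0r -scalemxAl -kE.
  by move=> /(_ E)[/eqP]; rewrite (negbTE x0).
left; exists s^-1, (s^-1 *: ya); split; first by rewrite invr_ge0 ltW.
have sa : s^-1 *: a = x *m B + (s^-1 *: ya) *m C.
  by rewrite aE scalerDr !scalemxAl scalerA mulVf ?gt_eqF// scale1r.
move=> w; apply/eqP; rewrite eq_le; apply/andP; split.
  rewrite -leeBlDl//; apply: le_ereal_inf_tmp => _ [r [r0 [k Kk E]] <-].
  rewrite leeBlDl// -EFinD; apply: ereal_inf_lbound.
  have sr0 : 0 < s^-1 + r by rewrite ltr_pwDl// invr_gt0.
  exists (s^-1 + r) => //=; split; first exact: ltW.
  exists ((1 - r / (s^-1 + r)) *: a + (r / (s^-1 + r)) *: k).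
    apply: cK => //; rewrite divr_ge0 ?(ltW sr0)//= ler_pdivrMr// mul1r lerDr.
    by rewrite invr_ge0 ltW.
  rewrite mulmxDl addrA -sa E scalerDr !scalerA mulrBr mulr1.
  by rewrite [_ * (r / _)]mulrC divfK ?gt_eqF// addrK.
apply: le_ereal_inf_tmp => _ [r [r_ge0 [k Kk E]] <-].
have r0 := posr _ _ _ r_ge0 E.
have := halfK _ _ _ r_ge0 Kk E; rewrite Ka => kh.
have F0 : (K `&` [set y | (y <= orth_compl H)%MS]) 0 by split => //=; exact: sub0mx.
have [t [k' [t01 [Kk' /sub_row_baseP[y' k'E]] kE]]] : [set z | exists t k,
    [/\ 0 <= t <= 1, (K `&` [set y | (y <= orth_compl H)%MS]) k &
        z = (1 - t) *: k + t *: a]] k.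
  apply: (convex_hull_sub (cone_segment_closed cF F0) _ kh) => u [Fu|->].
    by exists 0, u; rewrite lexx ler01 subr0 scale1r scale0r addr0.
  by exists 1, 0; rewrite ler01 lexx subrr scale0r scale1r add0r.
have := @coords_inj x ((r * t * s) *: x) (s^-1 *: ya + w)
  ((r * (1 - t)) *: y' + (r * t) *: ya).
case.
  rewrite E kE k'E aE !scalerDr !scalemxAl !scalerA !mulmxDl -!scalemxAl.
  by rewrite addrCA addrA [X in X + _]addrC -!addrA.
move=> xE yE.
have rts : r * t = s^-1.
  have : (1 - r * t * s) *: x = 0 by rewrite scalerBl scale1r -xE subrr.
  move/eqP; rewrite scaler_eq0 (negbTE x0) orbF subr_eq0 => /eqP rts.
  by rewrite -[RHS]mul1r rts mulfK// gt_eqF.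
have wE : w = (r * (1 - t)) *: y'.
  by move: yE; rewrite rts [RHS]addrC => /addrI.
have : (gauge K (w *m C) <= (r * (1 - t))%:E)%E.
  apply: ereal_inf_lbound; exists (r * (1 - t)) => //=; split.
    by rewrite mulr_ge0// subr_ge0; case/andP: t01.
  by exists k' => //; rewrite k'E wE scalemxAl.
rewrite -(@leeD2lE _ s^-1%:E)// => /le_trans; apply.
by rewrite -EFinD -rts -mulrDr addrC subrK mulr1.
Qed.

End hull_product.

End hulls.

(** * The product structure implies equality *)

Section converse.
Context {R : realType} (i k n : nat) (B : 'M[R]_(i, n)) (C : 'M[R]_(k, n)).
Variable f : 'rV[R]_n -> R.
Hypotheses (f0 : forall x, 0 <= f x) (f1 : f 0 = 1) (fle1 : forall x, f x <= 1).
Hypothesis fhom : forall s z, 0 < s -> f (s *: z) = f z `^ s.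
Local Notation P := (coord_proj B C f).
Hypothesis Pusc : forall a, open [set x | P x < a].
Hypothesis fprod :
  forall x, exists y, forall w, f (x *m B + (y + w) *m C) = P x * f (w *m C).
Variable l : R.
Hypothesis l01 : 0 < l < 1.

Let fmax x : f x <= f 0. Proof. by rewrite f1. Qed.

Lemma coord_proj_homogeneous s x : 0 < s -> P (s *: x) = P x `^ s.
Proof.
have attained z : exists y, f (z *m B + y *m C) = P z.
  by have [y fy] := fprod z; exists y; rewrite -[y]addr0 fy mul0mx f1 mulr1.
have ge t z : 0 < t -> P z `^ t <= P (t *: z).
  move=> t0; have [y <-] := attained z; rewrite -fhom// scalerDr !scalemxAl.
  exact: coord_proj_ge.
move=> s0; apply/eqP; rewrite eq_le ge// andbT.
have := @ge s^-1 (s *: x); rewrite invr_gt0 scalerA mulVf ?gt_eqF// scale1r => /(_ s0).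
move=> /(ge0_ler_powR (ltW s0)); rewrite !nnegrE powR_ge0 coord_proj_ge0//.
rewrite -powRrM mulVf ?gt_eqF// powRr1 ?coord_proj_ge0//; exact.
Qed.

(** By homogeneity the powers 1 - l and l are dilations, whose Jacobians cancel the constant; the
    product formula then splits each fibre integral. *)
Lemma product_equality :
  (((1 - l) ^+ i * l ^+ k)%:E *
     (\int[leb i]_x (P x `^ (1 - l))%:E * \int[leb k]_y (f (y *m C) `^ l)%:E) =
   \int[leb i]_x \int[leb k]_y (f (x *m B + y *m C))%:E)%E.
Proof.
have /andP[l0 l1] := l01; have l1' : 0 < 1 - l by rewrite subr_gt0.
have PE0 x : (0 <= (EFin \o P) x)%E by rewrite lee_fin coord_proj_ge0.
have qE0 y : (0 <= (EFin \o (fun y => f (y *m C))) y)%E by rewrite lee_fin.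
have IPE : (((1 - l) ^+ i)%:E * \int[leb i]_x (P x `^ (1 - l))%:E =
    \int[leb i]_x (P x)%:E)%E.
  rewrite -(@integral_homothety _ i (1 - l) 0 _ (or_introl l1') PE0); congr (_ * _)%E.
  by apply: eq_integral => x _ /=; rewrite addr0 coord_proj_homogeneous.
have IqE : ((l ^+ k)%:E * \int[leb k]_y (f (y *m C) `^ l)%:E =
    \int[leb k]_y (f (y *m C))%:E)%E.
  rewrite -(@integral_homothety _ k l 0 _ (or_introl l0) qE0); congr (_ * _)%E.
  by apply: eq_integral => y _ /=; rewrite addr0 -scalemxAl fhom.
rewrite EFinM muleACA IPE IqE.
rewrite -ge0_integralZr//; last 3 first.
- exact: measurable_fun_usc.
- by move=> x _; exact: PE0.
- by apply: integral_ge0 => y _; exact: qE0.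
apply: eq_integral => x _; have [y fy] := fprod x.
have fE0 v : (0 <= (f (x *m B + v *m C))%:E)%E by rewrite lee_fin.
rewrite -[RHS](@integral_homothety _ k 1 y _ (or_introl ltr01) fE0) expr1n mul1e.
rewrite -integralZT ?coord_proj_ge0//.
by apply: eq_integral => v _; rewrite scale1r [v + _]addrC fy EFinM.
Qed.

End converse.

(** * The equality case for functions of maximum 1 *)

Section normalized.
Context {R : realType} {n : nat} (H : 'M[R]_n) (f : 'rV[R]_n -> R).
Hypotheses (f0 : forall x, 0 <= f x) (flc : log_concave f).
Hypotheses (f1 : f 0 = 1) (fle1 : forall x, f x <= 1).
Hypothesis fusc : forall a, open [set x | f x < a].
Hypotheses (fpos : (0 < \int[leb n]_x (f x)%:E)%E)
           (ffin : (\int[leb n]_x (f x)%:E < +oo)%E).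
Variable l : R.
Hypothesis l01 : 0 < l < 1.
Local Notation B := (row_base H).
Local Notation C := (row_base (orth_compl H)).
Local Notation i := (\rank H).
Local Notation k := (\rank (orth_compl H)).
Local Notation IP := (\int[leb i]_x (coord_proj B C f x `^ (1 - l))%:E)%E.
Local Notation Iq := (\int[leb k]_y (f (y *m C) `^ l)%:E)%E.

Let ikn : (i + k)%N = n. Proof. exact: rank_orth_compl. Qed.
Let BC : B *m C^T = 0. Proof. exact: row_base_orth. Qed.
Let fB : row_free B. Proof. exact: row_base_free. Qed.
Let fC : row_free C. Proof. exact: row_base_free. Qed.
Let fmax x : f x <= f 0. Proof. by rewrite f1. Qed.

Lemma equality_coordsE :
  (((1 - l) ^+ i * l ^+ k)%:E * ((gram_vol B)%:E * IP) * ((gram_vol C)%:E * Iq) =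
    \int[leb n]_x (f x)%:E)%E <->
  (((1 - l) ^+ i * l ^+ k)%:E * (IP * Iq) =
    \int[leb i]_x \int[leb k]_y (f (x *m B + y *m C))%:E)%E.
Proof.
have mf : measurable_fun setT (EFin \o f) by exact: measurable_fun_usc.
have -> : (((1 - l) ^+ i * l ^+ k)%:E * ((gram_vol B)%:E * IP) * ((gram_vol C)%:E * Iq) =
    (gram_vol B * gram_vol C)%:E * (((1 - l) ^+ i * l ^+ k)%:E * (IP * Iq)))%E.
  rewrite [in RHS]EFinM -!muleA muleCA; congr (_ * _)%E.
  by rewrite [RHS]muleCA; congr (_ * _)%E; rewrite muleCA.
have v0 : 0 < gram_vol B * gram_vol C by rewrite mulr_gt0// gram_vol_gt0.
rewrite (integral_coords ikn BC fB fC mf)//; split=> [|->]//.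
move=> /(congr1 (fun x => (gram_vol B * gram_vol C)^-1%:E * x)%E).
have cancel X : ((gram_vol B * gram_vol C)^-1%:E * ((gram_vol B * gram_vol C)%:E * X) = X)%E.
  by rewrite muleA -EFinM mulVf ?mul1e// gt_eqF.
by rewrite /= !cancel.
Qed.

Lemma normalized_equality :
  (((1 - l) ^+ i * l ^+ k)%:E * (IP * Iq) =
    \int[leb i]_x \int[leb k]_y (f (x *m B + y *m C))%:E)%E <->
  exists K : set 'rV[R]_n, [/\ convex_body K, K 0,
    forall z, (f z)%:E = expeR (- gauge K z)%E & hull_with_one_point_over H K].
Proof.
have fcompact (a : R) : 0 < a -> compact [set x | a <= f x] by exact: superlevel_compact.
split=> [EQ|[K [[_ cK _] K0 fK hK]]].
  have fhom := equality_homogeneous ikn BC fB fC f0 flc f1 fle1 fusc fpos ffin l01 EQ.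
  have f01 x : 0 <= f x <= 1 by rewrite f0 fle1.
  exists [set z | expR (-1) <= f z]; split.
  - apply: superlevel_convex_body => //; first by apply: fcompact; exact: expR_gt0.
    exact: log_concave_box.
  - by rewrite /= f1 -[leRHS]expR0 ler_expR oppr_le0.
  - by move=> z; apply: exp_gauge.
  apply: (@product_hull_with_one_point R n H f (coord_proj B C f)) => //.
    move=> z; split=> [fz|->//].
    apply: (@superlevel_no_ray R n f f0 flc fmax fpos ffin 1 _ ltr01) => t.
    rewrite le_eqVlt => /predU1P[<-|t0]; first by rewrite scale0r f1.
    by rewrite fhom// fz powR1.
  exact: (fiber_translate ikn BC fB fC f0 flc f1 fle1 fusc fpos ffin l01 EQ).
have {}cK : segment_closed K by exact/convex_setP.
have fE z : f z = if gauge K z is r%:E then expR (- r) else 0.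
  by apply: EFin_inj; rewrite fK; have := gauge_ge0 K z; case: (gauge K z).
have fhom s z : 0 < s -> f (s *: z) = f z `^ s.
  move=> s0; rewrite !fE gauge_homogeneous//; have := gauge_ge0 K z.
  case: (gauge K z) => [r _||//].
    by rewrite -EFinM -expRM mulNr mulrC.
  by rewrite gt0_muley ?lte_fin// powR0 ?gt_eqF.
have fprod x : exists (p : R) y, 0 <= p /\
    forall w, f (x *m B + (y + w) *m C) = p * f (w *m C).
  have [[a [y [a0 ya]]]|zero] := hull_gauge_split cK K0 hK x.
    exists (expR (- a)), y; split=> [|w]; first exact: expR_ge0.
    rewrite !fE ya; have := gauge_ge0 K (w *m C); case: (gauge K _) => [r _||//].
      by rewrite -EFinD -expRD opprD.
    by rewrite addey// mulr0.
  by exists 0, 0; split=> // w; rewrite fE zero mul0r.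
apply: product_equality => //.
  exact: coord_proj_usc.
move=> x; have [p [y [p0 fy]]] := fprod x.
(* The factor is the maximum over the fibre: it is attained at w = 0, and f <= 1 bounds the other
   values. *)
suff <- : p = coord_proj B C f x by exists y.
apply/eqP; rewrite eq_le; apply/andP; split.
  have := fy 0; rewrite addr0 mul0mx f1 mulr1 => <-; exact: coord_proj_ge.
apply: coord_proj_le => z; have -> : z = y + (z - y) by rewrite addrC subrK.
by rewrite fy ler_piMr.
Qed.

End normalized.

(** * Reduction to maximum 1 and conclusion *)

Section normalization.
Context {R : realType} {n : nat}.

Lemma integral_RnE (g : 'rV[R]_n -> R) : (forall x, 0 <= g x) ->
  integral_Rn g = (\int[leb n]_x (g x)%:E)%E.
Proof. by move=> g0; rewrite integral_leb// => x; rewrite lee_fin. Qed.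

Lemma integral_subspaceE (H : 'M[R]_n) (g : 'rV[R]_n -> R) : (forall x, 0 <= g x) ->
  integral_subspace H g =
  ((gram_vol (row_base H))%:E * \int[leb (\rank H)]_x (g (x *m row_base H))%:E)%E.
Proof.
move=> g0; congr (_ * _)%E.
by rewrite (@integral_leb R _ (fun x => (g (x *m row_base H))%:E))// => x; rewrite lee_fin.
Qed.

Lemma coord_projZ i k (B : 'M[R]_(i, n)) (C : 'M[R]_(k, n)) (f : 'rV[R]_n -> R) (a : R) x :
  0 < a -> (forall x, f x <= f 0) ->
  coord_proj B C (fun z => a * f z) x = a * coord_proj B C f x.
Proof.
move=> a0 fmax; apply/eqP; rewrite eq_le; apply/andP; split.
  by apply: coord_proj_le => y; rewrite ler_pM2l// coord_proj_ge.
rewrite -ler_pdivlMl//; apply: coord_proj_le => y; rewrite ler_pdivlMl//.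
by apply: (@coord_proj_ge R i k n B C (fun z => a * f z)) => z; rewrite ler_pM2l.
Qed.

Lemma log_concaveZ (f : 'rV[R]_n -> R) (a : R) : 0 < a -> (forall x, 0 <= f x) ->
  log_concave f -> log_concave (fun x => a * f x).
Proof.
move=> a0 f0 flc x y l l01; rewrite !powRM ?(ltW a0)//.
rewrite mulrACA -powRD ?subrK ?powRr1 ?(ltW a0)//; last by rewrite gt_eqF// implybT.
by rewrite ler_pM2l// flc.
Qed.

End normalization.

Theorem theorem1p2 (R : realType) (n i : nat) (f : 'rV[R]_n -> R)
    (H : 'M[R]_n) (lambda : R)
    (f_lc : integrable_log_concave f)
    (f_max : (f 0)%:E = sup_norm f)
    (rank_H : \rank H = i)
    (lambda01 : 0 <= lambda <= 1) :
  let lhs : \bar R :=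
    (((1 - lambda) ^+ i * lambda ^+ (n - i))%R%:E
     * integral_subspace H (fun x => (proj_fun H f x `^ (1 - lambda))%R)
     * integral_subspace (orth_compl H) (fun y => (f y `^ lambda)%R))%E in
  (lhs <= integral_Rn f)%E /\
  (0 < lambda < 1 -> (0 < integral_Rn f)%E -> upper_semicontinuous f ->
   (lhs = integral_Rn f <->
    exists K : set 'rV[R]_n,
      [/\ convex_body K,
          K 0,
          forall x y : 'rV[R]_n, (x <= H)%MS -> (y <= orth_compl H)%MS ->
            (f (x + y))%:E = ((f 0)%:E * expeR (- gauge K (x + y)))%E
        & hull_with_one_point_over H K])).
Proof.
move=> lhs; have [f0 flc ffin] := f_lc.
have fmax x : f x <= f 0.
  by rewrite -lee_fin f_max; apply: ereal_sup_ubound; exists x.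
subst i; set B := row_base H; set C := row_base (orth_compl H).
have ikn : (\rank H + \rank (orth_compl H))%N = n := rank_orth_compl H.
have BC : B *m C^T = 0 := row_base_orth H.
have fB : row_free B := row_base_free H.
have fC : row_free C := row_base_free _.
pose IP (g : 'rV[R]_n -> R) := (\int[leb (\rank H)]_x (coord_proj B C g x `^ (1 - lambda))%:E)%E.
pose Iq (g : 'rV[R]_n -> R) := (\int[leb (\rank (orth_compl H))]_y (g (y *m C) `^ lambda)%:E)%E.
pose L g := (((1 - lambda) ^+ \rank H * lambda ^+ \rank (orth_compl H))%:E *
  ((gram_vol B)%:E * IP g) * ((gram_vol C)%:E * Iq g))%E.
have lhsE : lhs = L f.
  have nE : (n - \rank H)%N = \rank (orth_compl H) by rewrite mxrank_ker mxrank_tr.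
  have E1 : integral_subspace H (fun x => proj_fun H f x `^ (1 - lambda)) =
      ((gram_vol B)%:E * IP f)%E.
    rewrite integral_subspaceE; last by move=> x; exact: powR_ge0.
    apply: congr1; by apply: eq_integral => x _; rewrite proj_funE.
  have E2 : integral_subspace (orth_compl H) (fun y => f y `^ lambda) =
      ((gram_vol C)%:E * Iq f)%E.
    by rewrite integral_subspaceE// => x; exact: powR_ge0.
  by rewrite /lhs E1 E2 nE.
rewrite lhsE integral_RnE//; split; first exact: coord_inequality.
move=> l01 fpos /lower_semicontinuousP fusc.
have l01' : 0 <= lambda <= 1 by case/andP: l01 => *; rewrite !ltW.
have a0 : 0 < f 0.
  rewrite lt_neqAle f0 andbT eq_sym; apply: contraTneq fpos => f00.
  rewrite -leNgt (_ : (fun x => _) = cst 0%E) ?integral0//.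
  by apply/funext => x; congr EFin; apply/eqP; rewrite eq_le f0 -f00 fmax.
(* Both sides are homogeneous of degree 1 in [f], the left one because (1 - lambda) + lambda = 1, so
   dividing by [f 0] preserves equality. *)
pose a := (f 0)^-1; have a_gt0 : 0 < a by rewrite invr_gt0.
pose g x := a * f x.
have g0 x : 0 <= g x by rewrite mulr_ge0// ltW.
have glc : log_concave g by exact: log_concaveZ.
have g1 : g 0 = 1 by rewrite /g mulVf// gt_eqF.
have gle1 x : g x <= 1 by rewrite -g1 ler_pM2l.
have gusc b : open [set x | g x < b].
  have := fusc (- (f 0 * b)); congr open; apply/seteqP; split=> x /=;
    by rewrite lte_fin ltrN2 /g ltr_pdivrMl.
have fE0 x : (0 <= (f x)%:E)%E by rewrite lee_fin.
have Ig : (\int[leb n]_x (g x)%:E = a%:E * \int[leb n]_x (f x)%:E)%E.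
  by under eq_integral do rewrite EFinM; rewrite integralZT// ltW.
have gpos : (0 < \int[leb n]_x (g x)%:E)%E by rewrite Ig mule_gt0.
have gfin : (\int[leb n]_x (g x)%:E < +oo)%E.
  by rewrite Ig lte_mul_pinfty// ?lee_fin ?(ltW a_gt0)// -integral_RnE.
have Lg : L g = (a%:E * L f)%E.
  have IPg : IP g = ((a `^ (1 - lambda))%:E * IP f)%E.
    rewrite -integralZT ?powR_ge0//; last by move=> x; rewrite lee_fin powR_ge0.
    apply: eq_integral => x _; rewrite coord_projZ// powRM ?EFinM ?(ltW a_gt0)//.
    exact: coord_proj_ge0.
  have Iqg : Iq g = ((a `^ lambda)%:E * Iq f)%E.
    rewrite -integralZT ?powR_ge0//; last by move=> x; rewrite lee_fin powR_ge0.
    by apply: eq_integral => x _; rewrite powRM ?EFinM ?(ltW a_gt0).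
  have aE : a = a `^ (1 - lambda) * a `^ lambda.
    by rewrite -powRD ?subrK ?powRr1 ?(ltW a_gt0)// gt_eqF// implybT.
  rewrite /L IPg Iqg [X in (_ = X%:E * _)%E]aE EFinM.
  rewrite (muleCA (gram_vol B)%:E) [X in (X * _)%E]muleCA (muleCA (gram_vol C)%:E).
  by rewrite muleACA.
have -> : L f = (\int[leb n]_x (f x)%:E)%E <-> L g = (\int[leb n]_x (g x)%:E)%E.
  rewrite Lg Ig; split=> [->//|/(congr1 (fun X => (f 0)%:E * X)%E)].
  have cancel X : ((f 0)%:E * (a%:E * X) = X)%E.
    by rewrite muleA -EFinM mulfV ?mul1e// gt_eqF.
  by rewrite /= !cancel.
apply: iff_trans (equality_coordsE H g0 gusc lambda) _.
apply: iff_trans (normalized_equality H g0 glc g1 gle1 gusc gpos gfin l01) _.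
have gf K z : (g z)%:E = expeR (- gauge K z)%E <->
    (f z)%:E = ((f 0)%:E * expeR (- gauge K z))%E.
  split=> [<-|fz]; first by rewrite -EFinM /g mulrA mulfV ?mul1r// gt_eqF.
  by rewrite /g EFinM fz muleA -EFinM mulVf ?mul1e// gt_eqF.
split=> -[K [cK K0 gK hK]]; exists K; split=> //.
  by move=> x y _ _; apply/gf.
move=> z; apply/gf; have [x [y ->]] := coords_exist ikn BC fB fC z.
by apply: gK; apply/sub_row_baseP; [exists x|exists y].
Qed.
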